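(* Let $n\ge1$, let $\mathcal{Z}=\{z_1,\dots,z_m\}\subset\mathbb{D}^n$ be $m$ distinct points and $w_1,\dots,w_m\in\mathbb{D}$. Let $\mathcal{Q}_{\mathcal{Z}}=\operatorname{span}\{\mathbb{S}(\cdot,z_i):i=1,\dots,m\}\subseteq H^2(\mathbb{T}^n)$, let $X_{\mathcal{Z},\mathcal{W}}\in\mathcal{B}(\mathcal{Q}_{\mathcal{Z}})$ be defined by $X_{\mathcal{Z},\mathcal{W}}^*\mathbb{S}(\cdot,z_j)=\bar w_j\mathbb{S}(\cdot,z_j)$ for $j=1,\dots,m$, let $\psi=X_{\mathcal{Z},\mathcal{W}}(P_{\mathcal{Q}_{\mathcal{Z}}}1)$ and \[ \tilde{\mathcal{M}}_{\mathcal{Q}_{\mathcal{Z}}}=(\mathcal{Q}_{\mathcal{Z}}^{conj}\ominus\{\bar\psi\})+\mathcal{M}_n+H^2_0(\mathbb{T}^n)\subseteq L^1(\mathbb{T}^n). \] Then there exists $\varphi\in\mathcal{S}(\mathbb{D}^n)$ with $\varphi(z_i)=w_i$ for all $i$ if and only if \[ \operatorname{dist}_{L^1(\mathbb{T}^n)}\Big(\frac{\bar\psi}{\|\psi\|_2^2},\tilde{\mathcal{M}}_{\mathcal{Q}_{\mathcal{Z}}}\Big)\ge1. \] Moreover, in this case $\psi(z_i)=w_i$ for all $i=1,\dots,m$.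
   Context: $\mu$ is normalized Lebesgue measure on $\mathbb{T}^n$; $\|\cdot\|_p$ the $L^p(\mathbb{T}^n,\mu)$ norm. $H^2(\mathbb{T}^n)$ is the closed subspace of $L^2(\mathbb{T}^n)$ of functions whose Fourier coefficients vanish off $\mathbb{Z}_+^n$, identified with analytic functions on $\mathbb{D}^n$. $\mathbb{S}(z,w)=\prod_{i=1}^n(1-z_i\bar w_i)^{-1}$ is the Szegő kernel and $\mathbb{S}(\cdot,w)(z)=\mathbb{S}(z,w)$. $P_{\mathcal{Q}_{\mathcal{Z}}}$ is the orthogonal projection of $H^2(\mathbb{T}^n)$ onto $\mathcal{Q}_{\mathcal{Z}}$. $\mathcal{S}(\mathbb{D}^n)$ is the closed unit ball of $H^\infty(\mathbb{D}^n)$. $S^{conj}=\{\bar f:f\in S\}$; $\mathcal{Q}_{\mathcal{Z}}^{conj}\ominus\{\bar\psi\}$ is the orthogonal complement of $\bar\psi$ in $\mathcal{Q}_{\mathcal{Z}}^{conj}$; $H^2_0(\mathbb{T}^n)=\{f\in H^2:f(0)=0\}$; $\mathcal{M}_n=L^2(\mathbb{T}^n)\ominus(H^2(\mathbb{T}^n)^{conj}+H^2(\mathbb{T}^n))$. $\operatorname{dist}_{L^1}(g,M)=\inf_{h\in M}\|g-h\|_1$.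
   Formalization: It is assumed in addition that some $w_j\neq0$; if all $w_j=0$ (or $m=0$) then $\psi=0$ and the quotient $\bar\psi/\|\psi\|_2^2$ in the statement is undefined. *)

(* Defs.v *)
From HB Require Import structures.
From mathcomp Require Import all_boot all_order all_algebra.
From mathcomp Require Import all_classical all_reals all_analysis.
From mathcomp Require Import complex.

Set Implicit Arguments.
Unset Strict Implicit.
Unset Printing Implicit Defensive.

Import Order.TTheory GRing.Theory Num.Theory.
Import numFieldTopology.Exports numFieldNormedType.Exports.
Local Open Scope ring_scope.
Local Open Scope classical_set_scope.

Section Polydisc.
Context {R : realType}.
Local Notation C := R[i].

Definition cabs (z : C) : R := Num.sqrt (complex.Re z ^+ 2 + complex.Im z ^+ 2).

Definition expi (t : R) : C := (cos t +i* sin t)%C.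

Definition fconj (T : Type) (f : T -> C) : T -> C := fun x => (f x)^*%C.

Definition ccvg (u : nat -> C) (l : C) : Prop :=
  ((fun N => complex.Re (u N)) @ \oo --> complex.Re l) /\ ((fun N => complex.Im (u N)) @ \oo --> complex.Im l).

(** The torus T^n is parametrized by angles theta in [0, 2 pi]^n,
    zeta_k = e^{i theta_k}. Normalized Lebesgue measure mu on T^n is the
    n-fold product of the normalized Lebesgue measure d theta / (2 pi) on
    [0, 2 pi]; integrals w.r.t. mu are written as iterated integrals
    (Fubini--Tonelli). *)
Fixpoint tint (n : nat) : (n.-tuple R -> \bar R) -> \bar R :=
  match n return (n.-tuple R -> \bar R) -> \bar R with
  | 0 => fun f => f [tuple]
  | n'.+1 => fun f =>
      (((pi *+ 2)^-1)%:E *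
       \int[@lebesgue_measure R]_(t in `[0%R, (pi *+ 2 : R)%R])
          tint (fun x : n'.-tuple R => f [tuple of t :: x]))%E
  end.

Definition cint n (f : n.-tuple R -> C) : C :=
  (fine (tint (fun x => (complex.Re (f x))%:E)) +i*
   fine (tint (fun x => (complex.Im (f x))%:E)))%C.

Definition norm1 n (f : n.-tuple R -> C) : \bar R :=
  tint (fun x => (cabs (f x))%:E).
Definition norm2sq n (f : n.-tuple R -> C) : \bar R :=
  tint (fun x => (cabs (f x) ^+ 2)%:E).

Definition cmeasurable n (f : n.-tuple R -> C) : Prop :=
  measurable_fun [set: n.-tuple R] (fun x => complex.Re (f x)) /\
  measurable_fun [set: n.-tuple R] (fun x => complex.Im (f x)).

Definition L2 n (f : n.-tuple R -> C) : Prop :=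
  cmeasurable f /\ (norm2sq f < +oo)%E.

Definition ip n (f g : n.-tuple R -> C) : C :=
  cint (fun x => f x * (g x)^*%C).

Definition fcoef n (f : n.-tuple R -> C) (k : n.-tuple int) : C :=
  cint (fun x => f x * expi (- \sum_(i < n) (tnth k i)%:~R * tnth x i)).

Definition H2 n (f : n.-tuple R -> C) : Prop :=
  L2 f /\ forall k : n.-tuple int, (exists i, tnth k i < 0) -> fcoef f k = 0.

Definition mono n (z : n.-tuple C) (a : n.-tuple nat) : C :=
  \prod_(i < n) tnth z i ^+ tnth a i.

Definition midx n N (a : {ffun 'I_n -> 'I_N}) : n.-tuple nat :=
  [tuple (a i : nat) | i < n].

(** value at z in D^n of (the analytic function identified with)
    f in H^2:  f(z) = sum_alpha \hat f(alpha) z^alpha  *)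
Definition h2val n (f : n.-tuple R -> C) (z : n.-tuple C) (v : C) : Prop :=
  ccvg (fun N => \sum_(a : {ffun 'I_n -> 'I_N})
          fcoef f [tuple ((tnth (midx a) i)%:Z) | i < n] * mono z (midx a)) v.

Definition H2_0 n (f : n.-tuple R -> C) : Prop :=
  H2 f /\ h2val f [tuple (0 : C) | i < n] 0.

Definition Mn n (f : n.-tuple R -> C) : Prop :=
  L2 f /\ forall h1 h2, H2 h1 -> H2 h2 ->
    ip f (fun x => (h1 x)^*%C + h2 x) = 0.

Definition in_disc n (z : n.-tuple C) : Prop := forall i, cabs (tnth z i) < 1.

Definition tor n (x : n.-tuple R) : n.-tuple C := map_tuple expi x.

Definition szego n (z w : n.-tuple C) : C :=
  \prod_(i < n) (1 - tnth z i * (tnth w i)^*%C)^-1.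

Definition kern n (w : n.-tuple C) : n.-tuple R -> C :=
  fun x => szego (tor x) w.

(** holomorphic (= analytic) functions on D^n: locally sums of
    absolutely convergent power series *)
Definition psum n (a : n.-tuple nat -> C) (c z : n.-tuple C) (N : nat) : C :=
  \sum_(al : {ffun 'I_n -> 'I_N})
     a (midx al) * mono [tuple tnth z i - tnth c i | i < n] (midx al).
Definition pabssum n (a : n.-tuple nat -> C) (c z : n.-tuple C) (N : nat) : R :=
  \sum_(al : {ffun 'I_n -> 'I_N})
     cabs (a (midx al) * mono [tuple tnth z i - tnth c i | i < n] (midx al)).

Definition holomorphic_polydisc n (phi : n.-tuple C -> C) : Prop :=
  forall c, in_disc c -> exists2 r : R, 0 < r &
    exists a : n.-tuple nat -> C, forall z, in_disc z ->
      (forall i, cabs (tnth z i - tnth c i) < r) ->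
      (exists M : R, forall N, pabssum a c z N <= M) /\
      ccvg (psum a c z) (phi z).

Definition schur_class n (phi : n.-tuple C -> C) : Prop :=
  holomorphic_polydisc phi /\ forall z, in_disc z -> cabs (phi z) <= 1.

Definition QZ n m (Z : 'I_m -> n.-tuple C) (f : n.-tuple R -> C) : Prop :=
  exists c : 'I_m -> C, f = fun x => \sum_(j < m) c j * kern (Z j) x.

Definition is_orth_proj n (Q : (n.-tuple R -> C) -> Prop)
    (g p : n.-tuple R -> C) : Prop :=
  Q p /\ forall q, Q q -> ip (fun x => g x - p x) q = 0.

(** X = X_{Z,W} in B(Q_Z): linear on Q_Z, Q_Z-valued, and
    X^* S(., z_j) = conj(w_j) S(., z_j), i.e.
    <X f, S(., z_j)> = <f, conj(w_j) S(., z_j)> for f in Q_Z *)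
Definition is_XZW n m (Z : 'I_m -> n.-tuple C) (W : 'I_m -> C)
    (X : (n.-tuple R -> C) -> (n.-tuple R -> C)) : Prop :=
  [/\ forall f, QZ Z f -> QZ Z (X f),
      forall (a : C) f g, QZ Z f -> QZ Z g ->
        X (fun x => a * f x + g x) = (fun x => a * X f x + X g x) &
      forall f j, QZ Z f ->
        ip (X f) (kern (Z j)) = ip f (fun x => (W j)^*%C * kern (Z j) x)].

Definition Mtilde n m (Z : 'I_m -> n.-tuple C) (psi : n.-tuple R -> C)
    (h : n.-tuple R -> C) : Prop :=
  exists a b c : n.-tuple R -> C,
    [/\ (exists q, [/\ QZ Z q, ip (fconj q) (fconj psi) = 0 & a = fconj q]),
        Mn b, H2_0 c & h = fun x => a x + b x + c x].

Definition distL1 n (g : n.-tuple R -> C) (M : (n.-tuple R -> C) -> Prop) :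
  \bar R := ereal_inf [set norm1 (fun x => g x - h x) | h in M].

End Polydisc.

(* Main.v *)
Require Import Defs.
From HB Require Import structures.
From mathcomp Require Import all_boot all_order all_algebra.
From mathcomp Require Import all_classical all_reals all_analysis.
From mathcomp Require Import complex.
From mathcomp Require Import measurable_realfun giry ring lra.
Import Order.TTheory GRing.Theory Num.Theory.
Import numFieldTopology.Exports numFieldNormedType.Exports.
Local Open Scope ring_scope.
Local Open Scope classical_set_scope.

Set Implicit Arguments.
Unset Strict Implicit.
Unset Printing Implicit Defensive.

(** Since [<psi, S(., z_j)> = w_j], the function [psi] is the projection on
[Q_Z] of every interpolant, and [<., S(., z)>] is evaluation at [z] of the
associated analytic function.

If [phi] interpolates, its dilates are uniform limits on the torus of analytic
polynomials, which annihilate [M_n] and [H^2_0]; pairing them with [g - h]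
gives [1] in the limit, whence [1 <= ||g - h||_1]. The polynomial approximation
comes from the slices [l |-> phi (l z)]: by the maximum modulus principle their
Taylor coefficients are at most [1], so the Taylor series converges uniformly
on smaller discs.

Conversely, a distance at least [1] makes [s g + h |-> s] a contraction on
[C g + Mtilde] for the [L^1] norm; let [Lam] be a Hahn-Banach extension. Then
[phi z := Lam (conj S(., z))] is analytic, takes the value [w_j] at [z_j], and
since [Lam] kills every character having a positive exponent, [phi z] is also
the value of [Lam] at the Poisson kernel, which has [L^1] norm [1]. *)

(** * Complex modulus and convergence *)

(** Neither L1 duality nor Cauchy's formula is used. [Lam] is never represented by a bounded
    function: being bounded for the L1 norm, it can be applied term by term to series converging
    uniformly on the torus. The same lemma, with an integral in place of [Lam], shows that pairing
    with the kernel evaluates the power series. In the other direction the obstacle is that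
    [holomorphic_polydisc] only gives a power series near each centre, with no control of its
    radius, so nothing relates at once the expansion at 0 to the values far away. Along a slice,
    local expansions are enough for a maximum modulus principle; applied to quotients by powers of
    the variable, it controls the expansion at 0 on the whole closed disc. That expansion is common
    to all slices, whence uniformity in [z]. The factor [1 / ||psi||^2] normalizes the pairing: the
    integral of [g psi] is 1. *)

Section ComplexModulus.
Context {R : realType}.
Local Notation C := R[i].
Implicit Types (x y z : C) (r t : R).

(** The norm of [R[i]] takes values in [R[i]]; through this identity its laws pass to the
    real-valued [cabs]. *)
Lemma cabsE z : (cabs z)%:C%C = `|z|.
Proof. by case: z => a b. Qed.

Lemma le_cabs r z : (cabs z <= r) = (`|z| <= r%:C%C).
Proof. by rewrite -cabsE lecR. Qed.

Lemma cabs_ge0 z : 0 <= cabs z.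
Proof. exact: sqrtr_ge0. Qed.

Lemma cabs0 : cabs (0 : C) = 0.
Proof. by apply: (@complexI R); rewrite cabsE normr0. Qed.

Lemma cabs1 : cabs (1 : C) = 1.
Proof. by apply: (@complexI R); rewrite cabsE normr1. Qed.

Lemma cabs_eq0 z : (cabs z == 0) = (z == 0).
Proof. by rewrite -(inj_eq (@complexI R)) cabsE normr_eq0. Qed.

Lemma cabs_gt0 z : (0 < cabs z) = (z != 0).
Proof. by rewrite lt_def cabs_eq0 cabs_ge0 andbT. Qed.

Lemma cabsM x y : cabs (x * y) = cabs x * cabs y.
Proof. by apply: (@complexI R); rewrite rmorphM /= !cabsE normrM. Qed.

Lemma cabsX z k : cabs (z ^+ k) = cabs z ^+ k.
Proof. by apply: (@complexI R); rewrite rmorphXn /= !cabsE normrX. Qed.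

Lemma cabsV z : cabs z^-1 = (cabs z)^-1.
Proof. by apply: (@complexI R); rewrite fmorphV /= !cabsE normfV. Qed.

Lemma cabsN z : cabs (- z) = cabs z.
Proof. by apply: (@complexI R); rewrite !cabsE normrN. Qed.

Lemma cabs_distrC x y : cabs (x - y) = cabs (y - x).
Proof. by rewrite -cabsN opprB. Qed.

Lemma cabs_real r : cabs r%:C%C = `|r|.
Proof. by rewrite /cabs /= expr0n addr0 sqrtr_sqr. Qed.

Lemma cabs_conj z : cabs z^*%C = cabs z.
Proof. by case: z => a b; rewrite /cabs /= sqrrN. Qed.

Lemma cabs_prod I (s : seq I) (P : pred I) (F : I -> C) :
  cabs (\prod_(i <- s | P i) F i) = \prod_(i <- s | P i) cabs (F i).
Proof. exact: (big_morph _ cabsM cabs1). Qed.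

Lemma le_cabsD x y : cabs (x + y) <= cabs x + cabs y.
Proof. by rewrite le_cabs rmorphD /= !cabsE ler_normD. Qed.

Lemma le_cabsB x y : cabs (x - y) <= cabs x + cabs y.
Proof. by rewrite (le_trans (le_cabsD _ _))// cabsN. Qed.

Lemma le_cabs_dist x y z : cabs (x - z) <= cabs (x - y) + cabs (y - z).
Proof. by rewrite (le_trans _ (le_cabsD _ _))// subrKA. Qed.

Lemma ge_cabsB x y : cabs x - cabs y <= cabs (x - y).
Proof. by rewrite lerBlDr (le_trans _ (le_cabsD _ _))// subrK. Qed.

Lemma le_cabs_sum I (s : seq I) (P : pred I) (F : I -> C) :
  cabs (\sum_(i <- s | P i) F i) <= \sum_(i <- s | P i) cabs (F i).
Proof.
elim/big_ind2 : _ => //; first by rewrite cabs0.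
by move=> a b c d ab cd; rewrite (le_trans (le_cabsD _ _))// lerD.
Qed.

Lemma normr_Re z : `|complex.Re z| <= cabs z.
Proof.
rewrite /cabs -sqrtr_sqr ler_wsqrtr// lerDl; exact: sqr_ge0.
Qed.

Lemma normr_Im z : `|complex.Im z| <= cabs z.
Proof. by rewrite /cabs -sqrtr_sqr ler_wsqrtr// lerDr; exact: sqr_ge0. Qed.

Lemma cabs_le_ReIm z : cabs z <= `|complex.Re z| + `|complex.Im z|.
Proof.
rewrite {1}[z]complexE (le_trans (le_cabsD _ _))// cabsM !cabs_real.
by rewrite {1}/cabs /= expr0n add0r expr1n sqrtr1 mul1r.
Qed.

Lemma cabs_sqr z : cabs z ^+ 2 = complex.Re z ^+ 2 + complex.Im z ^+ 2.
Proof. by rewrite sqr_sqrtr// addr_ge0// sqr_ge0. Qed.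

Lemma mul_conj z : z * z^*%C = (cabs z ^+ 2)%:C%C.
Proof.
by rewrite cabs_sqr; case: z => a b; apply/eqP; rewrite eq_complex /=; apply/andP; split; apply/eqP; ring.
Qed.

Lemma ReB x y : complex.Re (x - y) = complex.Re x - complex.Re y.
Proof. by case: x y => [? ?] [? ?]. Qed.

Lemma ImB x y : complex.Im (x - y) = complex.Im x - complex.Im y.
Proof. by case: x y => [? ?] [? ?]. Qed.

Lemma ReD x y : complex.Re (x + y) = complex.Re x + complex.Re y.
Proof. by case: x y => [? ?] [? ?]. Qed.

Lemma ImD x y : complex.Im (x + y) = complex.Im x + complex.Im y.
Proof. by case: x y => [? ?] [? ?]. Qed.

Lemma ReM x y : complex.Re (x * y) =
  complex.Re x * complex.Re y - complex.Im x * complex.Im y.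
Proof. by case: x y => [? ?] [? ?]. Qed.

Lemma ImM x y : complex.Im (x * y) =
  complex.Re x * complex.Im y + complex.Im x * complex.Re y.
Proof. by case: x y => [? ?] [? ?]. Qed.

Lemma complexP x y : complex.Re x = complex.Re y -> complex.Im x = complex.Im y -> x = y.
Proof. by case: x y => [? ?] [? ?] /= -> ->. Qed.

Lemma cabs_expi t : cabs (expi t) = 1.
Proof. by rewrite /cabs /= cos2Dsin2 sqrtr1. Qed.

Lemma expi0 : expi (0 : R) = 1.
Proof. by rewrite /expi cos0 sin0. Qed.

Lemma expiD r t : expi (r + t) = expi r * expi t.
Proof. by rewrite /expi cosD sinD; apply: complexP => /=; ring. Qed.

Lemma expi_conj t : (expi t)^*%C = expi (- t).
Proof. by rewrite /expi cosN sinN. Qed.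

Lemma expi_sum I (s : seq I) (P : pred I) (F : I -> R) :
  expi (\sum_(i <- s | P i) F i) = \prod_(i <- s | P i) expi (F i).
Proof. exact: (big_morph _ expiD expi0). Qed.

Lemma expi_natM k t : expi (k%:R * t) = expi t ^+ k.
Proof.
elim: k => [|k IH]; first by rewrite mul0r expi0.
by rewrite -natr1 mulrDl mul1r expiD IH exprSr.
Qed.

Lemma ccvgP (u : nat -> C) l :
  ccvg u l <-> (fun N => cabs (u N - l)) @ \oo --> (0 : R).
Proof.
split=> [[uR uI]|u0].
  have H : (fun N => `|complex.Re (u N) - complex.Re l| + `|complex.Im (u N) - complex.Im l|)
     @ \oo --> (0 : R).
    rewrite -[0 in X in _ --> X]addr0; apply: cvgD; apply/norm_cvg0P => /=;
      exact/subr_cvg0.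
  apply: squeeze_cvgr (cvg_cst 0) H.
  near=> N; rewrite cabs_ge0 /=.
  by rewrite -ReB -ImB cabs_le_ReIm.
split; apply/subr_cvg0; apply/norm_cvg0P; apply: squeeze_cvgr (cvg_cst 0) u0;
  near=> N; rewrite normr_ge0 /=.
- by rewrite -ReB normr_Re.
- by rewrite -ImB normr_Im.
Unshelve. all: by end_near.
Qed.

Lemma ccvg_squeeze (u : nat -> C) l (e : nat -> R) :
  (forall N, cabs (u N - l) <= e N) -> e @ \oo --> 0 -> ccvg u l.
Proof.
move=> ue e0; apply/ccvgP; apply: squeeze_cvgr (cvg_cst 0) e0.
by near=> N; rewrite cabs_ge0 /=.
Unshelve. all: by end_near.
Qed.

Lemma ccvg_dist_le (u : nat -> C) l a B : ccvg u l ->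
  (\forall N \near \oo, cabs (u N - a) <= B) -> cabs (l - a) <= B.
Proof.
move=> /ccvgP ul uB; apply/ler_addgt0Pr => e e0.
have /cvgr0_norm_lt/(_ _ e0) ule := ul.
near \oo => N.
rewrite (le_trans (le_cabs_dist _ (u N) _))// addrC lerD//; first by near: N.
rewrite cabs_distrC -[X in X <= _]ger0_norm ?cabs_ge0//; apply: ltW.
by near: N.
Unshelve. all: by end_near.
Qed.

Lemma ccvg_unique (u : nat -> C) l l' : ccvg u l -> ccvg u l' -> l = l'.
Proof.
by move=> [a b] [c d]; apply: complexP; [exact: (cvg_unique _ a c)|exact: (cvg_unique _ b d)].
Qed.

Lemma ccvg_near (u : nat -> C) l :
  (\forall N \near \oo, u N = l) -> ccvg u l.
Proof.
move=> ul; split; apply: cvg_near_cst; apply: filterS ul => N; exact: congr1.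
Qed.

End ComplexModulus.

(** * Normalized Lebesgue measure on the torus *)

Section TorusMeasure.
Context {R : realType}.
Local Open Scope ereal_scope.

Lemma pi2_gt0 : (0 < pi *+ 2 :> R)%R.
Proof. by rewrite mulrn_wgt0 ?pi_gt0. Qed.

(** [integral_uniform] is applied to the positive and negative parts separately. Scaling by a
    positive real distributes over their difference even when both integrals are infinite. *)
Lemma integral_uniform_measurable (a b : R) (ab : (a < b)%R) (f : R -> \bar R) :
  measurable_fun setT f ->
  \int[uniform_prob ab]_x f x =
  (b - a)^-1%:E * \int[@lebesgue_measure R]_(x in `[a, b]) f x.
Proof.
move=> mf; rewrite integralE [in RHS]integralE.
rewrite !integral_uniform//; [|exact: measurable_funeneg|exact: measurable_funepos].
have key (c : R) (x y : \bar R) : (0 < c)%R -> 0 <= x -> 0 <= y ->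
    c%:E * x - c%:E * y = c%:E * (x - y).
  move=> c0; case: x y => [x| |] [y| |]//= _ _;
    rewrite ?(gt0_muley, gt0_muleNy, lte_fin)//=.
  by congr EFin; rewrite mulrBr.
by rewrite key// ?invr_gt0 ?subr_gt0//; exact: integral_ge0.
Qed.

Lemma tint_ge0 n (f : n.-tuple R -> \bar R) : (forall x, 0 <= f x) -> 0 <= tint f.
Proof.
elim: n f => [|n IH] f f0 //=.
rewrite mule_ge0//; first by rewrite lee_fin invr_ge0 ltW// pi2_gt0.
by apply: integral_ge0 => t _; exact: IH.
Qed.

Lemma tintSE n (f : n.+1.-tuple R -> \bar R) :
  measurable_fun setT (fun t : R => tint (fun x : n.-tuple R => f [tuple of t :: x])) ->
  tint f = \int[uniform_prob pi2_gt0]_t tint (fun x : n.-tuple R => f [tuple of t :: x]).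
Proof. by move=> mf; rewrite integral_uniform_measurable//= subr0. Qed.

(* No integrability is needed: this makes the inner iterated integral measurable
   also on the null set where Fubini does not identify it with an integral. *)
Lemma measurable_tint_param n d (T : measurableType d) (f : T * n.-tuple R -> \bar R) :
  measurable_fun setT f -> measurable_fun setT (fun y => tint (fun x => f (y, x))).
Proof.
elim: n d T f => [|n IH] d T f mf.
  by apply: measurableT_comp => //; exact: measurable_fun_pair.
pose h (yt : T * R) := tint (fun x : n.-tuple R => f (yt.1, [tuple of yt.2 :: x])).
have mh : measurable_fun setT h.
  apply: (IH _ _ (fun ytx : (T * R) * n.-tuple R =>
    f (ytx.1.1, [tuple of ytx.1.2 :: ytx.2]))).
  apply: measurableT_comp => //; apply: measurable_fun_pair => /=.
    exact: measurableT_comp.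
  by apply: measurable_cons => //; exact: measurableT_comp.
have -> : (fun y => tint (fun x => f (y, x))) =
    (fun y => \int[uniform_prob pi2_gt0]_t h (y, t)).
  apply/funext => y; rewrite tintSE//.
  by apply: (measurableT_comp (f := h) (g := fun t => (y, t))) => //; exact: measurable_fun_pair.
have -> : (fun y => \int[uniform_prob pi2_gt0]_t h (y, t)) =
    fubini_F (uniform_prob pi2_gt0) h^\+ \- fubini_F (uniform_prob pi2_gt0) h^\-.
  apply/funext => y; rewrite [LHS]integralE; congr (_ - _); apply: eq_integral => t _;
    [by rewrite !funeposE|by rewrite !funenegE].
apply: emeasurable_funB.
  apply: measurable_fun_fubini_tonelli_F => //; exact: measurable_funepos.
apply: measurable_fun_fubini_tonelli_F => //; exact: measurable_funeneg.
Qed.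

Lemma measurable_tint_cons n (f : n.+1.-tuple R -> \bar R) :
  measurable_fun setT f ->
  measurable_fun setT (fun t : R => tint (fun x : n.-tuple R => f [tuple of t :: x])).
Proof.
move=> mf.
apply: (measurable_tint_param (f := fun tx : R * n.-tuple R => f [tuple of tx.1 :: tx.2])).
by apply: measurableT_comp => //; exact: measurable_cons.
Qed.

Lemma tint_integral_exists n : exists P : giry (n.-tuple R) R,
  (forall f, measurable_fun setT f -> (forall x, 0 <= f x) -> tint f = \int[P]_x f x) /\
  (forall f, P.-integrable setT f -> tint f = \int[P]_x f x).
Proof.
elim: n => [|n [P [P1 P2]]].
  exists (giry_ret ([tuple] : 0.-tuple R)); split=> f mf => [_|] /=.
    by rewrite integral_dirac// diracT mul1e.
  rewrite integral_dirac//; first by rewrite diracT mul1e.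
  exact: measurable_int mf.
pose U : subprobability (measurableTypeR R) R := uniform_prob pi2_gt0.
pose c (tx : measurableTypeR R * n.-tuple R) : n.+1.-tuple R := [tuple of tx.1 :: tx.2].
have mc : measurable_fun setT c by exact: measurable_cons.
pose UP := product_subprobability (U, P).
exists (giry_map mc UP).
split=> f mf => [f0|].
  have mfc : measurable_fun setT (f \o c) := measurableT_comp mf mc.
  transitivity (\int[U \x P]_x (f \o c) x); last first.
    by rewrite ge0_integral_pushforward//= preimage_setT.
  rewrite (fubini_tonelli1 (f \o c) mfc (fun=> f0 _)).
  rewrite tintSE; last exact: measurable_tint_cons.
  apply: eq_integral => t _; rewrite /fubini_F P1//.
  by apply: measurableT_comp => //; exact: measurable_cons.
have mf' := measurable_int _ mf.
have ifc : (U \x P).-integrable setT (f \o c).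
  apply/integrableP; split; first exact: (measurableT_comp mf' mc).
  have [_] := (integrableP _ _ _ mf).
  have mabs : measurable_fun setT (abse \o f) by exact: measurableT_comp.
  by rewrite ge0_integral_pushforward// preimage_setT.
transitivity (\int[U \x P]_x (f \o c) x); last first.
  by rewrite integral_pushforward// ?preimage_setT.
rewrite -integral12_prod_meas1// tintSE; last exact: measurable_tint_cons.
(* The section at [t] is known to be integrable for almost every [t] only, hence an
   almost-everywhere comparison of the outer integrands. *)
apply: ae_eq_integral => //.
- exact: measurable_tint_cons.
- exact: (measurable_fubini_F ifc).
apply: filterS (ae_integrable1 ifc) => t it _.
by rewrite /fubini_F P2.
Qed.

Definition tmeas n : giry (n.-tuple R) R := projT1 (cid (tint_integral_exists n)).

Lemma ge0_tintE n f : measurable_fun setT f -> (forall x, 0 <= f x) ->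
  tint f = \int[tmeas n]_x f x.
Proof. by rewrite /tmeas; case: cid => P [/= + _]; exact. Qed.

Lemma tintE n f : (tmeas n).-integrable setT f -> tint f = \int[tmeas n]_x f x.
Proof. by rewrite /tmeas; case: cid => P [/= _]; exact. Qed.

End TorusMeasure.

(** * Integration of complex functions on the torus *)

Section ComplexIntegral.
Context {R : realType} {n : nat}.
Local Notation C := R[i].
Local Notation T := (n.-tuple R).
Implicit Types (f g h : T -> C).

Lemma cmeasurable_cst (c : C) : cmeasurable (fun _ : T => c).
Proof. by split. Qed.

Lemma cmeasurableD f g : cmeasurable f -> cmeasurable g ->
  cmeasurable (fun x => f x + g x).
Proof.
move=> [fr fi] [gr gi]; split.
  by under eq_fun do rewrite ReD; exact: measurable_funD.
by under eq_fun do rewrite ImD; exact: measurable_funD.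
Qed.

Lemma cmeasurableM f g : cmeasurable f -> cmeasurable g ->
  cmeasurable (fun x => f x * g x).
Proof.
move=> [fr fi] [gr gi]; split.
  by under eq_fun do rewrite ReM; apply: measurable_funB; exact: measurable_funM.
by under eq_fun do rewrite ImM; apply: measurable_funD; exact: measurable_funM.
Qed.

Lemma cmeasurable_conj f : cmeasurable f -> cmeasurable (fun x => (f x)^*%C).
Proof.
move=> [fr fi]; split.
  by rewrite [X in measurable_fun _ X](_ : _ = fun x => complex.Re (f x))//;
    apply/funext => x; case: (f x).
rewrite [X in measurable_fun _ X](_ : _ = fun x => - complex.Im (f x)).
  exact: measurable_funN.
by apply/funext => x; case: (f x).
Qed.

Lemma cmeasurableZ (c : C) f : cmeasurable f -> cmeasurable (fun x => c * f x).
Proof. by move=> mf; apply: cmeasurableM => //; exact: cmeasurable_cst. Qed.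

Lemma cmeasurableB f g : cmeasurable f -> cmeasurable g ->
  cmeasurable (fun x => f x - g x).
Proof.
move=> mf mg; under eq_fun do rewrite -[- _]mulN1r.
by apply: cmeasurableD => //; exact: cmeasurableZ.
Qed.

Lemma cmeasurable_sum I (s : seq I) (P : pred I) (F : I -> T -> C) :
  (forall i, cmeasurable (F i)) -> cmeasurable (fun x => \sum_(i <- s | P i) F i x).
Proof.
move=> mF; elim: s => [|i s IH].
  by under eq_fun do rewrite big_nil; exact: cmeasurable_cst.
under eq_fun do rewrite big_cons.
by case: (P i) => //; exact: cmeasurableD.
Qed.

Lemma cmeasurable_prod I (s : seq I) (P : pred I) (F : I -> T -> C) :
  (forall i, cmeasurable (F i)) -> cmeasurable (fun x => \prod_(i <- s | P i) F i x).
Proof.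
move=> mF; elim: s => [|i s IH].
  by under eq_fun do rewrite big_nil; exact: cmeasurable_cst.
under eq_fun do rewrite big_cons.
by case: (P i) => //; exact: cmeasurableM.
Qed.

Lemma cmeasurableX f k : cmeasurable f -> cmeasurable (fun x => f x ^+ k).
Proof.
move=> mf; elim: k => [|k IH].
  by under eq_fun do rewrite expr0; exact: cmeasurable_cst.
by under eq_fun do rewrite exprS; exact: cmeasurableM.
Qed.

Lemma measurable_cabs f : cmeasurable f -> measurable_fun setT (fun x => cabs (f x)).
Proof.
move=> [fr fi]; apply: (measurableT_comp (f := @Num.sqrt R)).
  by apply: continuous_measurable_fun; exact: sqrt_continuous.
by apply: measurable_funD; exact: measurable_funX.
Qed.

Lemma cmeasurable_real (r : T -> R) : measurable_fun setT r ->
  cmeasurable (fun x => (r x)%:C%C).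
Proof. by move=> mr; split => //=; exact: measurable_cst. Qed.

Lemma invc_cabs (z : C) : z^-1 = z^*%C * ((cabs z ^+ 2)^-1)%:C%C.
Proof.
have [->|z0] := eqVneq z 0; first by rewrite invr0 conjc0 mul0r.
apply: (mulfI z0); rewrite divff// mulrA mul_conj -rmorphM/= mulfV//.
by rewrite expf_neq0// cabs_eq0.
Qed.

Lemma cmeasurableV f : cmeasurable f -> cmeasurable (fun x => (f x)^-1).
Proof.
move=> mf; under eq_fun do rewrite invc_cabs.
apply: cmeasurableM; first exact: cmeasurable_conj.
apply: cmeasurable_real.
(* The inverse of a nonnegative real is its power of exponent -1, at 0 as well, so zeros of [f] need
   no separate treatment. *)
under eq_fun do rewrite -powR_inv1 ?sqr_ge0//.
apply: (measurableT_comp (measurable_powR _)).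
by apply: measurable_funX; exact: measurable_cabs.
Qed.

Lemma cmeasurable_expi (l : T -> R) : measurable_fun setT l ->
  cmeasurable (fun x => expi (l x)).
Proof.
move=> ml; split; apply: measurableT_comp => //; apply: continuous_measurable_fun.
  exact: continuous_cos.
exact: continuous_sin.
Qed.

Definition cL1 f := cmeasurable f /\ (norm1 f < +oo)%E.

Definition L1norm f : R := fine (norm1 f).

Lemma norm1E f : cmeasurable f -> norm1 f = (\int[tmeas n]_x (cabs (f x))%:E)%E.
Proof.
move=> mf; rewrite /norm1 ge0_tintE//.
  by apply/measurable_EFinP; exact: measurable_cabs.
by move=> x; rewrite lee_fin cabs_ge0.
Qed.

Lemma norm1_ge0 f : (0 <= norm1 f)%E.
Proof. by apply: tint_ge0 => x; rewrite lee_fin cabs_ge0. Qed.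

Lemma L1norm_ge0 f : 0 <= L1norm f.
Proof. by rewrite fine_ge0// norm1_ge0. Qed.

Lemma norm1_fin f : cL1 f -> norm1 f = (L1norm f)%:E.
Proof. by move=> [_ ?]; rewrite fineK// ge0_fin_numE// norm1_ge0. Qed.

Lemma cL1_cabs f : cL1 f <->
  cmeasurable f /\ (tmeas n).-integrable setT (EFin \o (fun x => cabs (f x))).
Proof.
split=> -[mf h]; split=> //.
  apply/integrableP; split; first by apply/measurable_EFinP; exact: measurable_cabs.
  under eq_integral do rewrite /= ger0_norm ?cabs_ge0//.
  by rewrite -norm1E.
rewrite norm1E//; have /integrableP[_] := h.
by under eq_integral do rewrite /= ger0_norm ?cabs_ge0//.
Qed.

Lemma cL1_le f g : cmeasurable f -> (forall x, cabs (f x) <= cabs (g x)) ->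
  cL1 g -> cL1 f.
Proof.
move=> mf fg /cL1_cabs[mg ig]; apply/cL1_cabs; split=> //.
apply: le_integrable ig => //; first by apply/measurable_EFinP; exact: measurable_cabs.
by move=> x _ /=; rewrite lee_fin !ger0_norm ?cabs_ge0.
Qed.

Lemma cL1_Re f : cL1 f -> (tmeas n).-integrable setT (EFin \o (fun x => complex.Re (f x))).
Proof.
move=> /cL1_cabs[[mf _] i]; apply: le_integrable i => //; first exact/measurable_EFinP.
by move=> x _ /=; rewrite lee_fin [leRHS]ger0_norm ?cabs_ge0// normr_Re.
Qed.

Lemma cL1_Im f : cL1 f -> (tmeas n).-integrable setT (EFin \o (fun x => complex.Im (f x))).
Proof.
move=> /cL1_cabs[[_ mf] i]; apply: le_integrable i => //; first exact/measurable_EFinP.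
by move=> x _ /=; rewrite lee_fin [leRHS]ger0_norm ?cabs_ge0// normr_Im.
Qed.

Lemma cL1D f g : cL1 f -> cL1 g -> cL1 (fun x => f x + g x).
Proof.
move=> /cL1_cabs[mf fi] /cL1_cabs[mg gi]; apply/cL1_cabs.
split; first exact: cmeasurableD.
apply: le_integrable (integrableD measurableT fi gi) => //.
  by apply/measurable_EFinP; apply: measurable_cabs; exact: cmeasurableD.
move=> x _ /=; rewrite lee_fin !ger0_norm ?cabs_ge0// ?le_cabsD//.
by rewrite addr_ge0 ?cabs_ge0.
Qed.

Lemma cL1Z (c : C) f : cL1 f -> cL1 (fun x => c * f x).
Proof.
move=> /cL1_cabs[mf fi]; apply/cL1_cabs; split; first exact: cmeasurableZ.
have := integrableZl measurableT (cabs c) fi.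
apply: eq_integrable => // x _ /=.
by rewrite cabsM.
Qed.

Lemma cL1B f g : cL1 f -> cL1 g -> cL1 (fun x => f x - g x).
Proof.
move=> lf lg; under eq_fun do rewrite -[- _]mulN1r.
by apply: cL1D => //; exact: cL1Z.
Qed.

Lemma cL1_conj f : cL1 f -> cL1 (fun x => (f x)^*%C).
Proof.
move=> lf; apply: (cL1_le _ _ lf); first by apply: cmeasurable_conj; case: lf.
by move=> x; rewrite cabs_conj.
Qed.

Lemma cL1_cst (c : C) : cL1 (fun _ : T => c).
Proof.
apply/cL1_cabs; split; first exact: cmeasurable_cst.
by apply: finite_measure_integrable_cst.
Qed.

Lemma cL1_sum I (s : seq I) (P : pred I) (F : I -> T -> C) :
  (forall i, cL1 (F i)) -> cL1 (fun x => \sum_(i <- s | P i) F i x).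
Proof.
move=> mF; elim: s => [|i s IH].
  by under eq_fun do rewrite big_nil; exact: cL1_cst.
under eq_fun do rewrite big_cons.
by case: (P i) => //; exact: cL1D.
Qed.

Lemma cintE f : cL1 f ->
  cint f = (Rintegral (tmeas n) setT (fun x => complex.Re (f x)) +i*
            Rintegral (tmeas n) setT (fun x => complex.Im (f x)))%C.
Proof. by move=> lf; rewrite /cint !tintE//; [exact: cL1_Im|exact: cL1_Re]. Qed.

Lemma cintD f g : cL1 f -> cL1 g -> cint (fun x => f x + g x) = cint f + cint g.
Proof.
move=> lf lg; rewrite !cintE//; last exact: cL1D.
apply: complexP => /=.
  under eq_Rintegral do rewrite ReD.
  by rewrite RintegralD//; exact: cL1_Re.
under eq_Rintegral do rewrite ImD.
by rewrite RintegralD//; exact: cL1_Im.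
Qed.

Lemma cintZ (c : C) f : cL1 f -> cint (fun x => c * f x) = c * cint f.
Proof.
move=> lf; rewrite !cintE//; last exact: cL1Z.
have iR := cL1_Re lf; have iI := cL1_Im lf.
have Z (a : R) (u : T -> R) : (tmeas n).-integrable setT (EFin \o u) ->
    (tmeas n).-integrable setT (EFin \o (fun x => a * u x)).
  move=> iu; have := integrableZl measurableT a iu.
  by apply: eq_integrable.
apply: complexP; rewrite ?ReM ?ImM /=.
  under eq_Rintegral do rewrite ReM.
  by rewrite RintegralB ?RintegralZl//; exact: Z.
under eq_Rintegral do rewrite ImM.
by rewrite RintegralD ?RintegralZl//; exact: Z.
Qed.

Lemma cintB f g : cL1 f -> cL1 g -> cint (fun x => f x - g x) = cint f - cint g.
Proof.
move=> lf lg; rewrite -[- cint g]mulN1r -cintZ// -cintD//; last exact: cL1Z.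
by under [in RHS]eq_fun do rewrite mulN1r.
Qed.

Lemma cint_sum I (s : seq I) (P : pred I) (F : I -> T -> C) :
  (forall i, cL1 (F i)) ->
  cint (fun x => \sum_(i <- s | P i) F i x) = \sum_(i <- s | P i) cint (F i).
Proof.
move=> mF; elim: s => [|i s IH].
  under eq_fun do rewrite big_nil; rewrite big_nil.
  transitivity (cint (fun _ : T => 0 * (0 : C))).
    by congr cint; apply/funext => x; rewrite mul0r.
  by rewrite cintZ ?mul0r//; exact: cL1_cst.
under eq_fun do rewrite big_cons.
rewrite big_cons; case: (P i) => //.
by rewrite cintD// ?IH//; exact: cL1_sum.
Qed.

Lemma cint_conj f : cL1 f -> cint (fun x => (f x)^*%C) = (cint f)^*%C.
Proof.
move=> lf; rewrite !cintE//; last exact: cL1_conj.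
apply: complexP => /=; first by apply: eq_Rintegral => x _; case: (f x).
rewrite -mulN1r -RintegralZl//; last exact: cL1_Im.
by apply: eq_Rintegral => x _; case: (f x) => a b /=; rewrite mulN1r.
Qed.

(** After multiplication by the unimodular [u = conj c / |c|] the integral becomes the real number
    [|c|], and only real parts remain to be compared. *)
Lemma le_cint f : cL1 f -> cabs (cint f) <= L1norm f.
Proof.
move=> lf; have [->|c0] := eqVneq (cint f) 0; first by rewrite cabs0 L1norm_ge0.
set c := cint f in c0 *.
pose u : C := c^*%C * ((cabs c)^-1)%:C%C.
have cc : cabs c != 0 by rewrite cabs_eq0.
have u1 : cabs u = 1.
  by rewrite cabsM cabs_conj cabs_real ger0_norm ?invr_ge0 ?cabs_ge0// mulfV.
have uf := cL1Z u lf.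
have -> : cabs c = complex.Re (cint (fun x => u * f x)).
  rewrite cintZ// -/c /u mulrAC -[c^*%C * c]mulrC mul_conj -rmorphM/=.
  by rewrite expr2 mulfK.
rewrite cintE//= /L1norm norm1E; last by case: lf.
apply: le_Rintegral => //; first exact: cL1_Re.
  by have /cL1_cabs[] := lf.
move=> x _; rewrite (le_trans (ler_norm _))// (le_trans (normr_Re _))//.
by rewrite cabsM u1 mul1r.
Qed.

Lemma le_L1norm f g : cL1 f -> cL1 g -> (forall x, cabs (f x) <= cabs (g x)) ->
  L1norm f <= L1norm g.
Proof.
move=> lf lg fg; rewrite /L1norm !norm1E; [|by case: lg|by case: lf].
apply: le_Rintegral => //; first by have /cL1_cabs[] := lf.
by have /cL1_cabs[] := lg.
Qed.

Lemma L1normD f g : cL1 f -> cL1 g -> L1norm (fun x => f x + g x) <= L1norm f + L1norm g.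
Proof.
move=> lf lg; have lfg := cL1D lf lg.
rewrite /L1norm !norm1E; [|by case: lg|by case: lf|by case: lfg].
have /cL1_cabs[_ fi] := lf. have /cL1_cabs[_ gi] := lg. have /cL1_cabs[_ fgi] := lfg.
rewrite -RintegralD//; apply: le_Rintegral => //.
  exact: (integrableD measurableT fi gi).
by move=> x _; exact: le_cabsD.
Qed.

Lemma L1normZ (c : C) f : cL1 f -> L1norm (fun x => c * f x) = cabs c * L1norm f.
Proof.
move=> lf; have lcf := cL1Z c lf.
rewrite /L1norm !norm1E; [|by case: lf|by case: lcf].
have /cL1_cabs[_ fi] := lf.
rewrite -[RHS]RintegralZl//; apply: eq_Rintegral => x _.
by rewrite cabsM.
Qed.

(** The measure enters only through its total mass being at most 1. Evaluating the bound at the zero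
    tuple gives [0 <= B]. *)
Lemma L1norm_bound f B : cmeasurable f -> (forall x, cabs (f x) <= B) -> 
  cL1 f /\ L1norm f <= B.
Proof.
move=> mf fB.
have B0 : 0 <= B by rewrite (le_trans (cabs_ge0 _) (fB [tuple 0 | i < n])).
have lB := cL1_cst B%:C%C.
have fB' x : cabs (f x) <= cabs B%:C%C by rewrite cabs_real ger0_norm.
have lf := cL1_le mf fB' lB; split=> //.
rewrite (le_trans (le_L1norm lf lB fB'))// /L1norm norm1E; last by case: lB.
rewrite -[X in X <= _]/(Rintegral _ _ _) Rintegral_cst// cabs_real ger0_norm//.
rewrite -[leRHS]mulr1 ler_wpM2l// -lee_fin fineK; first exact: sprobability_setT.
by rewrite fin_num_measure.
Qed.

Lemma L2_cL1 f : L2 f -> cL1 f.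
Proof.
move=> [mf f2]; apply/cL1_cabs; split=> //.
have i2 : (tmeas n).-integrable setT (EFin \o (fun x => cabs (f x) ^+ 2)).
  have m2 : measurable_fun setT (EFin \o (fun x => cabs (f x) ^+ 2)).
    by apply/measurable_EFinP; apply: measurable_funX; exact: measurable_cabs.
  apply/integrableP; split=> //.
  under eq_integral do rewrite /= ger0_norm ?sqr_ge0//.
  by rewrite -ge0_tintE// => x; rewrite lee_fin sqr_ge0.
have i1 := finite_measure_integrable_cst (tmeas n) (1 : R) measurableT.
apply: le_integrable (integrableD measurableT i1 i2) => //.
  by apply/measurable_EFinP; exact: measurable_cabs.
move=> x _ /=; rewrite lee_fin ger0_norm ?cabs_ge0//.
rewrite ger0_norm ?addr_ge0 ?sqr_ge0//.
have := sqr_ge0 (cabs (f x) - 1); have := cabs_ge0 (f x); nra.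
Qed.

Lemma L2_bound f B : cmeasurable f -> (forall x, cabs (f x) <= B) -> L2 f.
Proof.
move=> mf fB; split=> //; rewrite /norm2sq ge0_tintE; last 2 first.
- by apply/measurable_EFinP; apply: measurable_funX; exact: measurable_cabs.
- by move=> x; rewrite lee_fin sqr_ge0.
apply: (@le_lt_trans _ _ (\int[tmeas n]_x (cst (B ^+ 2)%:E x))%E).
  apply: ge0_le_integral => //.
  - by move=> x _; rewrite lee_fin sqr_ge0.
  - by apply/measurable_EFinP; apply: measurable_funX; exact: measurable_cabs.
  - move=> x _; rewrite lee_fin lerXn2r// ?nnegrE ?cabs_ge0//.
    exact: le_trans (cabs_ge0 _) (fB x).
rewrite integral_cst// lte_mul_pinfty// ?lee_fin ?sqr_ge0//.
by rewrite ltey_eq fin_num_measure.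
Qed.

Lemma L2_lin (c : C) f g : L2 f -> L2 g -> L2 (fun x => c * f x + g x).
Proof.
move=> [mf f2] [mg g2]; have m := cmeasurableD (cmeasurableZ c mf) mg; split=> //.
have m2 h : cmeasurable h -> measurable_fun setT (fun x => ((cabs (h x)) ^+ 2)%:E).
  by move=> mh; by apply/measurable_EFinP; apply: measurable_funX; exact: measurable_cabs.
move: f2 g2; rewrite /norm2sq !ge0_tintE//; try exact: m2;
  try by move=> x; rewrite lee_fin sqr_ge0.
move=> f2 g2.
apply: (@le_lt_trans _ _ (\int[tmeas n]_x ((2 * cabs c ^+ 2)%:E * (cabs (f x) ^+ 2)%:E +
    2%:E * (cabs (g x) ^+ 2)%:E))%E).
  apply: ge0_le_integral => //.
  - by move=> x _; rewrite lee_fin sqr_ge0.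
  - exact: m2.
  - by apply: emeasurable_funD; apply: measurable_funeM; exact: m2.
  - move=> x _; rewrite -!EFinM -EFinD lee_fin.
    have /(lerXn2r 2) : cabs (c * f x + g x) <= cabs c * cabs (f x) + cabs (g x).
      by rewrite -cabsM le_cabsD.
    rewrite !nnegrE cabs_ge0 addr_ge0 ?mulr_ge0 ?cabs_ge0// => /(_ isT isT) H.
    apply: (le_trans H).
    have := sqr_ge0 (cabs c * cabs (f x) - cabs (g x)); nra.
rewrite ge0_integralD//; last 4 first.
- by move=> x _; rewrite -EFinM lee_fin !mulr_ge0// ?sqr_ge0 ?cabs_ge0//.
- by apply: measurable_funeM; exact: m2.
- by move=> x _; rewrite -EFinM lee_fin !mulr_ge0// ?sqr_ge0 ?cabs_ge0//.
- by apply: measurable_funeM; exact: m2.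
rewrite !ge0_integralZl_EFin//; try exact: m2; try by rewrite !mulr_ge0// ?sqr_ge0 ?cabs_ge0//.
- by rewrite lte_add_pinfty// lte_mul_pinfty// lee_fin !mulr_ge0// ?sqr_ge0 ?cabs_ge0//.
- by move=> x _; rewrite lee_fin sqr_ge0.
- by move=> x _; rewrite lee_fin sqr_ge0.
Qed.

Lemma cL1_mul_bound f g B : cmeasurable f -> (forall x, cabs (f x) <= B) ->
  cL1 g -> cL1 (fun x => f x * g x) /\ L1norm (fun x => f x * g x) <= B * L1norm g.
Proof.
move=> mf fB lg; have [mg _] := lg.
have B0 : 0 <= B by rewrite (le_trans (cabs_ge0 _) (fB [tuple 0 | i < n])).
have lBg := cL1Z B%:C%C lg.
have h x : cabs (f x * g x) <= cabs (B%:C%C * g x).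
  by rewrite !cabsM cabs_real ger0_norm// ler_wpM2r ?cabs_ge0.
have lfg := cL1_le (cmeasurableM mf mg) h lBg; split => //.
by rewrite (le_trans (le_L1norm lfg lBg h))// L1normZ// cabs_real ger0_norm.
Qed.

End ComplexIntegral.

(** * Characters of the torus *)

Section Orthogonality.
Context {R : realType}.
Local Notation C := R[i].

Lemma expi_2pi (k : int) : expi (k%:~R * (pi *+ 2) : R) = 1.
Proof.
have H (j : nat) : expi (j%:R * (pi *+ 2) : R) = 1.
  rewrite expi_natM (_ : expi _ = 1) ?expr1n//.
  rewrite mulr2n expiD /expi cospi sinpi; apply: complexP => /=; ring.
case: k => j; first exact: H.
rewrite NegzE mulrNz mulNr -expi_conj H; exact: conjc1.
Qed.

Lemma integral_periodic_derive (f F : R -> R) : (forall t : R, is_derive t 1 F (f t)) ->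
  continuous f -> F (pi *+ 2) = F 0 ->
  (\int[@lebesgue_measure R]_(t in `[0%R, (pi *+ 2 : R)%R]) (f t)%:E = 0)%E.
Proof.
move=> dF cf F0; rewrite (@continuous_FTC2 _ f F)//.
- by rewrite F0 subee.
- exact: pi2_gt0.
- exact: continuous_subspaceT.
- have cF : continuous F.
    by move=> x; apply: differentiable_continuous; apply/derivable1_diffP; case: (dF x).
  split; first by move=> x _; case: (dF x).
  + exact/cvg_at_right_filter/cF.
  + exact/cvg_at_left_filter/cF.
- by move=> x _; rewrite derive1E; apply: derive_val.
Qed.

Lemma integral_cos (k : int) : k != 0 ->
  (\int[@lebesgue_measure R]_(t in `[0%R, (pi *+ 2 : R)%R]) (cos (k%:~R * t))%:E = 0)%E.
Proof.
move=> k0; have k0' : (k%:~R : R) != 0 by rewrite intr_eq0.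
apply: (integral_periodic_derive (F := fun t => k%:~R^-1 * sin (k%:~R * t))).
- by move=> t; apply: is_derive_eq; rewrite /GRing.scale /= mulr1 mulrCA mulVf// mulr1.
- by move=> t; apply: continuous_comp; [exact: mulrl_continuous|exact: continuous_cos].
have [_ +] := expi_2pi k; rewrite /= => ->.
by rewrite !mulr0 sin0 mulr0.
Qed.

Lemma integral_sin (k : int) :
  (\int[@lebesgue_measure R]_(t in `[0%R, (pi *+ 2 : R)%R]) (sin (k%:~R * t))%:E = 0)%E.
Proof.
have [->|k0] := eqVneq k 0.
  by apply: integral0_eq => t _; rewrite mul0r sin0.
have k0' : (k%:~R : R) != 0 by rewrite intr_eq0.
apply: (integral_periodic_derive (F := fun t => - (k%:~R^-1 * cos (k%:~R * t)))).
- move=> t; apply: is_derive_eq; rewrite /GRing.scale /= mulr1.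
  by rewrite mulNr mulrN opprK mulrCA mulVf// mulr1.
- by move=> t; apply: continuous_comp; [exact: mulrl_continuous|exact: continuous_sin].
have [+ _] := expi_2pi k; rewrite /= => ->.
by rewrite !mulr0 cos0.
Qed.

(** Puts an inner iterated integral in the form of a component of [cint]: integrability makes it
    finite, so the [fine] in [cint] loses nothing. *)
Lemma tint_Re n (f : n.-tuple R -> C) : cL1 f ->
  tint (fun x => (complex.Re (f x))%:E) = (complex.Re (cint f))%:E.
Proof.
move=> lf; rewrite cintE//= fineK ?tintE//; first exact: cL1_Re.
by apply: integrable_fin_num => //; exact: cL1_Re.
Qed.

Lemma tint_Im n (f : n.-tuple R -> C) : cL1 f ->
  tint (fun x => (complex.Im (f x))%:E) = (complex.Im (cint f))%:E.
Proof.
move=> lf; rewrite cintE//= fineK ?tintE//; first exact: cL1_Im.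
by apply: integrable_fin_num => //; exact: cL1_Im.
Qed.

Definition torchar n (k : 'I_n -> int) (x : n.-tuple R) : C :=
  expi (\sum_(i < n) (k i)%:~R * tnth x i).

Lemma cabs_torchar n (k : 'I_n -> int) x : cabs (torchar k x) = 1.
Proof. exact: cabs_expi. Qed.

Lemma cmeasurable_torchar n (k : 'I_n -> int) : cmeasurable (torchar k).
Proof.
apply: cmeasurable_expi; apply: measurable_sum => i.
by apply: measurable_funM => //; exact: measurable_tnth.
Qed.

Lemma cL1_torchar n (k : 'I_n -> int) : cL1 (torchar k).
Proof.
have H x : cabs (torchar k x) <= 1 by rewrite cabs_torchar.
by have [] := L1norm_bound (cmeasurable_torchar k) H.
Qed.

(** Induction on the dimension: the first variable is a scalar factor of the inner integral, and
    integrates to 0 over a period unless its exponent vanishes. *)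
Lemma cint_torchar n (k : 'I_n -> int) : cint (torchar k) = ([forall i, k i == 0]%:R : C).
Proof.
elim: n k => [|n IH] k.
  have -> : [forall i, k i == 0] by apply/forallP => -[].
  by rewrite /cint /tint /torchar !big_ord0 expi0.
have E t (x : n.-tuple R) : torchar k [tuple of t :: x] =
    expi ((k ord0)%:~R * t) * torchar (fun i => k (lift ord0 i)) x.
  rewrite /torchar big_ord_recl expiD; congr (_ * expi _).
  by apply: eq_bigr => i _; rewrite tnthS.
have lE t : cL1 (fun x : n.-tuple R =>
    expi ((k ord0)%:~R * t) * torchar (fun i => k (lift ord0 i)) x).
  by apply: cL1Z; exact: cL1_torchar.
pose d : C := [forall i, k (lift ord0 i) == 0]%:R.
have cI t : cint (fun x => torchar k [tuple of t :: x]) =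
    expi ((k ord0)%:~R * t) * d.
  by under eq_fun do rewrite E; rewrite cintZ ?IH//; exact: cL1_torchar.
have lE' t : cL1 (fun x : n.-tuple R => torchar k [tuple of t :: x]).
  by under eq_fun do rewrite E.
have -> : cint (torchar k) =
  (fine ((pi *+ 2)^-1%:E * \int[@lebesgue_measure R]_(t in `[0%R, (pi *+ 2 : R)%R])
    (complex.Re (expi ((k ord0)%:~R * t) * d))%:E)%E
   +i* fine ((pi *+ 2)^-1%:E * \int[@lebesgue_measure R]_(t in `[0%R, (pi *+ 2 : R)%R])
    (complex.Im (expi ((k ord0)%:~R * t) * d))%:E)%E)%C.
  apply: complexP => /=; congr (fine (_ * _)%E); apply: eq_integral => t _.
    by rewrite (tint_Re (lE' t)) cI.
  by rewrite (tint_Im (lE' t)) cI.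
have -> : [forall i, k i == 0] = (k ord0 == 0) && [forall i, k (lift ord0 i) == 0].
  apply/forallP/andP => [H|[H0 /forallP H] i]; first by split=> //; apply/forallP.
  by case: (unliftP ord0 i) => [j ->|->].
case: (boolP [forall i, k (lift ord0 i) == 0]) => Hd; rewrite ?andbF ?andbT; last first.
  have -> : d = 0 by rewrite /d (negbTE Hd).
  rewrite -[RHS]/(0 : C).
  apply: complexP => /=; rewrite integral0_eq ?mule0// => t _; rewrite !mulr0.
    by rewrite subr0.
  by rewrite addr0.
have -> : d = 1 by rewrite /d Hd.
apply: complexP => /=; last first.
  under eq_integral do rewrite mulr1 mulr0 add0r.
  by rewrite integral_sin mule0; case: eqP => _; [rewrite -[_%:R]/(1 : C)|rewrite -[_%:R]/(0 : C)].
under eq_integral do rewrite mulr1 mulr0 subr0.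
have [->|k0] := eqVneq (k ord0) 0; last first.
  by rewrite -[_%:R]/(0 : C) integral_cos// mule0.
rewrite -[_%:R in RHS]/(1 : C).
under eq_integral do rewrite mul0r cos0.
rewrite integral_cst//= lebesgue_measure_itv/= lte_fin pi2_gt0 oppr0 addr0 mul1e/=.
by rewrite mulVf// gt_eqF// pi2_gt0.
Qed.

End Orthogonality.

(** * Hahn-Banach extension *)

Section HahnBanach.
Context {R : realType} {U : lmodType R}.
Variables (V : set U) (p : U -> R).
Hypothesis V_lin : forall (s : R) x y, V x -> V y -> V (s *: x + y).
Hypothesis pD : forall x y, V x -> V y -> p (x + y) <= p x + p y.
Hypothesis pZ : forall (s : R) x, V x -> 0 < s -> p (s *: x) = s * p x.

(** Partial functionals are handled as graphs dominated by [p]. Everything is confined to [V]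
    because [L1norm] is a seminorm on integrable functions, whereas elsewhere [fine] sends infinite
    values to 0. *)
Let good (G : set (U * R)) :=
  (forall (s : R) x a y b, G (x, a) -> G (y, b) -> G (s *: x + y, s * a + b)) /\
  (forall x a, G (x, a) -> V x /\ a <= p x).

Let good_zero G x a : good G -> G (x, a) -> G (0, 0).
Proof.
move=> [Gl _] Gx; have := Gl (-1) _ _ _ _ Gx Gx.
by rewrite scaleN1r addNr mulN1r addNr.
Qed.

Let V0 x : V x -> V 0.
Proof. by move=> Vx; have := V_lin (-1) Vx Vx; rewrite scaleN1r addNr. Qed.

Let VD x y : V x -> V y -> V (x + y).
Proof. by move=> Vx Vy; have := V_lin 1 Vx Vy; rewrite scale1r. Qed.

Let VZ s x : V x -> V (s *: x).
Proof. by move=> Vx; have := V_lin s Vx (V0 Vx); rewrite addr0. Qed.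

Let p0 x : V x -> p 0 = 0.
Proof.
move=> Vx; have := pZ (V0 Vx) (ltr0n R 2 : 0 < 2%:R).
rewrite scaler0; lra.
Qed.

(** Two values at [x] would put [(0, a - b)] and its opposite in [G], where [p 0 = 0] dominates. *)
Let good_uniq G x a b : good G -> G (x, a) -> G (x, b) -> a = b.
Proof.
move=> gG Gxa Gxb.
have le u v : G (x, u) -> G (x, v) -> u <= v.
  move=> Gu Gv; have := gG.1 (-1) _ _ _ _ Gv Gu.
  rewrite scaleN1r addNr mulN1r => /gG.2[Vz]; rewrite (p0 Vz); lra.
by apply/eqP; rewrite eq_le !le.
Qed.

(** The value [c] at [x0] must satisfy [a - p (z - x0) <= c <= p (y + x0) - b] for all [(z, a)] and
    [(y, b)] in [G]. Subadditivity for [(z - x0) + (y + x0)] keeps the lower bounds below the upper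
    ones, so their supremum works; homogeneity passes from [x0] and [- x0] to all multiples. *)
Let good_extend G x0 : good G -> G (0, 0) -> V x0 ->
  exists c, good [set ya | exists z a s, [/\ G (z, a), ya.1 = z + s *: x0 & ya.2 = a + s * c]].
Proof.
move=> gG G00 Vx0.
pose A := [set r : R | exists z a, G (z, a) /\ r = a - p (z - x0)].
have VB z : V z -> V (z - x0).
  by move=> Vz; have := V_lin (-1) Vx0 Vz; rewrite scaleN1r addrC.
have AB y b : G (y, b) -> ubound A (p (y + x0) - b).
  move=> Gy _ [z [a [Gz ->]]].
  have [Vy _] := gG.2 _ _ Gy; have [Vz _] := gG.2 _ _ Gz.
  have := gG.1 1 _ _ _ _ Gz Gy; rewrite scale1r mul1r => /gG.2[_].
  have := pD (VB _ Vz) (VD Vy Vx0).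
  rewrite addrACA addNr addr0; lra.
have supA : has_sup A.
  split; first by exists (0 - p (0 - x0)), 0, 0.
  by exists (p (0 + x0) - 0); exact: AB.
pose c := sup A.
have c1 y b : G (y, b) -> b + c <= p (y + x0).
  by move=> Gy; have := ge_sup (proj1 supA) (AB _ _ Gy); rewrite -/c; lra.
have c2 y b : G (y, b) -> b - c <= p (y - x0).
  move=> Gy; have : b - p (y - x0) <= c by apply: ub_le_sup supA.2 _ _; exists y, b.
  lra.
exists c; split.
  move=> s x a y b [z [a' [t [Gz /= -> ->]]]] [z' [b' [t' [Gz' /= -> ->]]]].
  exists (s *: z + z'), (s * a' + b'), (s * t + t'); split.
  - exact: gG.1.
  - by rewrite /= scalerDl scalerDr scalerA addrACA.
  - by rewrite /=; ring.
move=> x a [z [a' [t [Gz /= -> ->]]]].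
have [Vz az] := gG.2 _ _ Gz.
split; first by apply: VD => //; exact: VZ.
have Gs s : G (s *: z, s * a').
  by have := gG.1 s _ _ _ _ Gz G00; rewrite !addr0.
have [t0|t0|->] := ltrgtP t 0; last by rewrite scale0r mul0r !addr0.
  have nt : 0 < - t by rewrite oppr_gt0.
  have -> : z + t *: x0 = (- t) *: ((- t)^-1 *: z - x0).
    by rewrite scalerBr scalerA mulfV ?gt_eqF// scale1r scaleNr opprK.
  rewrite pZ//; last by apply: VB; exact: VZ.
  have := c2 _ _ (Gs (- t)^-1); rewrite -(ler_pM2l nt) mulrBr mulrA mulfV ?gt_eqF//.
  by rewrite mul1r mulNr opprK.
have -> : z + t *: x0 = t *: (t^-1 *: z + x0).
  by rewrite scalerDr scalerA mulfV ?gt_eqF// scale1r.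
rewrite pZ//; last by apply: VD => //; exact: VZ.
have := c1 _ _ (Gs t^-1); rewrite -(ler_pM2l t0) mulrDr mulrA mulfV ?gt_eqF//.
by rewrite mul1r.
Qed.

Theorem hahn_banach (E : set U) (l : U -> R) : E 0 ->
  (forall x, E x -> V x) ->
  (forall (s : R) x y, E x -> E y -> E (s *: x + y)) ->
  (forall (s : R) x y, E x -> E y -> l (s *: x + y) = s * l x + l y) ->
  (forall x, E x -> l x <= p x) ->
  exists L : U -> R,
  [/\ forall (s : R) x y, V x -> V y -> L (s *: x + y) = s * L x + L y,
      forall x, V x -> L x <= p x &
      forall x, E x -> L x = l x].
Proof.
move=> E0 EV El ll lp.
pose gE := [set xa : U * R | E xa.1 /\ xa.2 = l xa.1].
have gEgood : good gE.
  split=> [s x a y b [/= Ex ->] [/= Ey ->]|x a [/= Ex ->]].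
    by split=> /=; [exact: El|rewrite ll].
  by split; [exact: EV|exact: lp].
(* Adjoining the graph [gE] inside the predicate, instead of requiring it to be contained in [G],
   makes the empty chain harmless. *)
pose P (G : set (U * R)) := good (G `|` gE).
have [|G [PG maxG]] := @Zorn_bigcup (U * R)%type P.
  move=> F FP totF.
  have [F0|/set0P[G0 FG0]] := eqVneq F set0.
    by rewrite F0 bigcup_set0 /P set0U.
  have pick u v : (\bigcup_(X in F) X `|` gE) u -> (\bigcup_(X in F) X `|` gE) v ->
      exists2 X, F X & (X `|` gE) u /\ (X `|` gE) v.
    move=> [[X FX Xu]|Eu] [[Y FY Yv]|Ev].
    - have [XY|YX] := totF _ _ FX FY.
        by exists Y => //; split; left => //; exact: XY.
      by exists X => //; split; left => //; exact: YX.
    - by exists X => //; split; [left|right].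
    - by exists Y => //; split; [right|left].
    - by exists G0 => //; split; right.
  have sub X u : F X -> (X `|` gE) u -> (\bigcup_(X in F) X `|` gE) u.
    by move=> FX [Xu|Eu]; [left; exists X|right].
  split=> [s x a y b Gx Gy|x a Gx].
    have [X FX [Xx Xy]] := pick _ _ Gx Gy.
    by apply: (sub X) => //; apply: (FP _ FX).1.
  have [X FX [Xx _]] := pick _ _ Gx Gx.
  exact: (FP _ FX).2.
pose H := G `|` gE.
have H00 : H (0, 0).
  by apply: (good_zero PG (x := 0) (a := l 0)); right; split.
have total x : V x -> exists a, H (x, a).
  move=> Vx; apply: contrapT => nH.
  have [c gc] := good_extend PG H00 Vx.
  set H' := [set ya | _] in gc.
  have HH' : H `<=` H'.
    by move=> [y a] Hy; exists y, a, 0; rewrite scale0r mul0r !addr0.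
  have H'x : H' (x, c) by exists 0, 0, 1; rewrite scale1r mul1r !add0r.
  have GH' : G `<` H'.
    split; first by move=> u Gu; apply: HH'; left.
    by move=> /(_ _ H'x) Gx; apply: nH; exists c; left.
  apply: (maxG _ GH'); rewrite /P (_ : H' `|` gE = H')//.
  by apply/setUidPl => u Eu; apply: HH'; right.
have ex x : exists a, V x -> H (x, a).
  have [Vx|nV] := pselect (V x); last by exists 0.
  by have [a Ha] := total x Vx; exists a.
have [L LH] := choice ex; exists L; split.
- move=> s x y Vx Vy; apply: (good_uniq PG (x := s *: x + y)).
    by apply: LH; exact: V_lin.
  by apply: PG.1; exact: LH.
- by move=> x Vx; have [] := PG.2 _ _ (LH _ Vx).
- move=> x Ex; apply: (good_uniq PG (x := x)); first by apply: LH; exact: EV.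
  by right.
Qed.

End HahnBanach.

(** * Functionals bounded by the L1 norm *)

Section BoundedFunctionals.
Context {R : realType} {n : nat}.
Local Notation C := R[i].
Local Notation T := (n.-tuple R).
Implicit Types (f g h : T -> C) (Lam : (T -> C) -> C) (B : R).

(** Covers the Hahn-Banach functional as well as integration against a bounded function, so that one
    set of series expansions serves both directions. *)
Definition bounded_functional B Lam :=
  (forall (c : C) f g, cL1 f -> cL1 g ->
     Lam (fun x => c * f x + g x) = c * Lam f + Lam g) /\
  (forall f, cL1 f -> cabs (Lam f) <= B * L1norm f).

Lemma bounded_functional_cint : bounded_functional 1 (@cint R n).
Proof.
split=> [c f g lf lg|f lf]; last by rewrite mul1r le_cint.
by rewrite cintD ?cintZ//; exact: cL1Z.
Qed.

Lemma bounded_functional_cint_mul f B : cmeasurable f -> (forall x, cabs (f x) <= B) ->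
  bounded_functional B (fun h => cint (fun x => f x * h x)).
Proof.
move=> mf fB; split=> [c g h lg lh|h lh]; last first.
  have [lfh Nfh] := cL1_mul_bound mf fB lh.
  exact: le_trans (le_cint lfh) Nfh.
have [lfg _] := cL1_mul_bound mf fB lg; have [lfh _] := cL1_mul_bound mf fB lh.
rewrite -cintZ// -cintD//; last exact: cL1Z.
by congr cint; apply/funext => x; ring.
Qed.

Section Linear.
Variables (B : R) (Lam : (T -> C) -> C).
Hypothesis bL : bounded_functional B Lam.

Lemma bounded_functional_0 : Lam (fun=> 0) = 0.
Proof.
have := bL.1 (-1) _ _ (cL1_cst 0) (cL1_cst 0); rewrite [in RHS]mulN1r [RHS]addNr => H; rewrite -[RHS]H.
by congr Lam; apply/funext => x; rewrite mulr0 addr0.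
Qed.

Lemma bounded_functional_Z (c : C) f : cL1 f -> Lam (fun x => c * f x) = c * Lam f.
Proof.
move=> lf; have := bL.1 c _ _ lf (cL1_cst 0); rewrite bounded_functional_0 addr0 => <-.
by congr Lam; apply/funext => x; rewrite addr0.
Qed.

Lemma bounded_functional_D f g : cL1 f -> cL1 g -> Lam (fun x => f x + g x) = Lam f + Lam g.
Proof.
move=> lf lg; have := bL.1 1 _ _ lf lg; rewrite mul1r => <-.
by congr Lam; apply/funext => x; rewrite mul1r.
Qed.

Lemma bounded_functional_B f g : cL1 f -> cL1 g -> Lam (fun x => f x - g x) = Lam f - Lam g.
Proof.
move=> lf lg; have := bL.1 (-1) _ _ lg lf; rewrite mulN1r addrC => <-.
by congr Lam; apply/funext => x; rewrite mulN1r addrC.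
Qed.

Lemma bounded_functional_sum I (s : seq I) (P : pred I) (F : I -> T -> C) :
  (forall i, cL1 (F i)) ->
  Lam (fun x => \sum_(i <- s | P i) F i x) = \sum_(i <- s | P i) Lam (F i).
Proof.
move=> mF; elim: s => [|i s IH].
  by under eq_fun do rewrite big_nil; rewrite big_nil bounded_functional_0.
under eq_fun do rewrite big_cons.
rewrite big_cons; case: (P i) => //.
by rewrite bounded_functional_D// ?IH//; exact: cL1_sum.
Qed.

Lemma bounded_functional_uniform (F : nat -> T -> C) f (e : nat -> R) : 0 <= B ->
  (forall K, cL1 (F K)) -> cL1 f ->
  (forall K x, cabs (F K x - f x) <= e K) -> e @ \oo --> 0 ->
  ccvg (fun K => Lam (F K)) (Lam f).
Proof.
move=> B0 lF lf Ff e0; apply: (@ccvg_squeeze _ _ _ (fun K => B * e K)).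
  move=> K; rewrite -bounded_functional_B//.
  have lFf := cL1B (lF K) lf; rewrite (le_trans (bL.2 _ lFf))// ler_wpM2l//.
  by have [] := L1norm_bound lFf.1 (Ff K).
by rewrite -[X in _ --> X](mulr0 B); apply: cvgMr.
Qed.

End Linear.

(** Telescoping: one factor is exchanged at a time, the others being bounded by [D]; [1 <= D] allows
    a common power of [D]. *)
Lemma dist_prod_le I (s : seq I) (a b : I -> C) (D e : R) : 1 <= D -> 0 <= e ->
  (forall i, cabs (a i) <= D) -> (forall i, cabs (b i) <= D) ->
  (forall i, cabs (a i - b i) <= e) ->
  cabs (\prod_(i <- s) a i - \prod_(i <- s) b i) <= (size s)%:R * D ^+ size s * e.
Proof.
move=> D1 e0 aD bD ab.
have D0 : 0 <= D by rewrite (le_trans _ D1).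
elim: s => [|i s IH] /=.
  by rewrite !big_nil subrr cabs0 mul0r mul0r.
have pb' : cabs (\prod_(i <- s) b i) <= D ^+ size s.
  rewrite cabs_prod; elim: s {IH} => [|j s IH] /=; first by rewrite big_nil.
  rewrite big_cons exprS ler_pM ?cabs_ge0// prodr_ge0// => k _; exact: cabs_ge0.
rewrite !big_cons.
have -> : a i * \prod_(j <- s) a j - b i * \prod_(j <- s) b j =
  a i * (\prod_(j <- s) a j - \prod_(j <- s) b j) + (a i - b i) * \prod_(j <- s) b j by ring.
rewrite (le_trans (le_cabsD _ _))// !cabsM.
have h1 : cabs (a i) * cabs (\prod_(j <- s) a j - \prod_(j <- s) b j) <=
    D * ((size s)%:R * D ^+ size s * e).
  by rewrite ler_pM ?cabs_ge0// IH.
have h2 : cabs (a i - b i) * cabs (\prod_(j <- s) b j) <= e * (D * D ^+ size s).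
  rewrite ler_pM ?cabs_ge0// (le_trans pb')//.
  by rewrite -[leLHS]mul1r ler_wpM2r// exprn_ge0.
apply: (le_trans (lerD h1 h2)); rewrite exprS -natr1 le_eqVlt; apply/orP; left; apply/eqP; ring.
Qed.

(** The sum over the box of side [K] is the product of the one-variable partial sums. These converge
    geometrically and uniformly in [x], hence so do their products, and [Lam] passes to uniform
    limits. *)
Lemma bounded_functional_product_series B Lam (t : 'I_n -> nat -> T -> C) (s : 'I_n -> T -> C)
    (M q : R) : 0 <= B -> bounded_functional B Lam -> 0 <= q < 1 ->
  (forall i a, cmeasurable (t i a)) -> (forall i, cmeasurable (s i)) ->
  (forall i x K, cabs (\sum_(a < K) t i a x - s i x) <= M * q ^+ K) ->
  ccvg (fun K => \sum_(al : {ffun 'I_n -> 'I_K}) Lam (fun x => \prod_i t i (al i) x))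
       (Lam (fun x => \prod_i s i x)).
Proof.
move=> B0 bL /andP[q0 q1] mt ms ts.
have sM i x : cabs (s i x) <= `|M|.
  by have := ts i x 0; rewrite big_ord0 sub0r cabsN expr0 mulr1 => /le_trans; apply; exact: ler_norm.
pose D := 1 + `|M| + `|M|.
have D1 : 1 <= D by rewrite /D -addrA lerDl addr_ge0.
have qK K : 0 <= q ^+ K <= 1 by rewrite exprn_ge0// exprn_ile1// ltW.
have tsM i x K : cabs (\sum_(a < K) t i a x - s i x) <= `|M| * q ^+ K.
  by rewrite (le_trans (ts _ _ _))// ler_wpM2r ?ler_norm//; have /andP[] := qK K.
have SD i x K : cabs (\sum_(a < K) t i a x) <= D.
  rewrite -[X in cabs X](subrK (s i x)) (le_trans (le_cabsD _ _))//.
  have := sM i x; have := tsM i x K; have /andP[_ h] := qK K.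
  have : `|M| * q ^+ K <= `|M| by rewrite ler_piMr.
  rewrite /D; lra.
have bdCL1 K : cL1 (fun x => \prod_i \sum_(a < K) t i a x).
  have H x : cabs (\prod_i \sum_(a < K) t i a x) <= D ^+ n.
    rewrite cabs_prod -[X in _ <= _ ^+ X]card_ord -prodr_const; apply: ler_prod.
    by move=> i _; rewrite cabs_ge0 SD.
  have [] // := L1norm_bound _ H.
  by apply: cmeasurable_prod => i; exact: cmeasurable_sum.
have sCL1 : cL1 (fun x => \prod_i s i x).
  have H x : cabs (\prod_i s i x) <= D ^+ n.
    rewrite cabs_prod -[X in _ <= _ ^+ X]card_ord -prodr_const; apply: ler_prod.
    move=> i _; rewrite cabs_ge0 (le_trans (sM i x))//.
    by rewrite /D addrAC lerDr addr_ge0.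
  have [] // := L1norm_bound _ H.
  exact: cmeasurable_prod.
have tCL1 K (al : {ffun 'I_n -> 'I_K}) : cL1 (fun x => \prod_i t i (al i) x).
  have tD i a x : cabs (t i a x) <= D + D.
    (* A single term is the difference of two consecutive partial sums, whence the bound [D + D]. *)
    have -> : t i a x = \sum_(b < a.+1) t i b x - \sum_(b < a) t i b x.
      by rewrite big_ord_recr /= addrAC subrr add0r.
    by rewrite (le_trans (le_cabsB _ _))// lerD.
  have H x : cabs (\prod_i t i (al i) x) <= (D + D) ^+ n.
    rewrite cabs_prod -[X in _ <= _ ^+ X]card_ord -prodr_const; apply: ler_prod.
    by move=> i _; rewrite cabs_ge0 tD.
  have [] // := L1norm_bound _ H.
  exact: cmeasurable_prod.
have -> : (fun K => \sum_(al : {ffun 'I_n -> 'I_K}) Lam (fun x => \prod_i t i (al i) x)) =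
    (fun K => Lam (fun x => \prod_i \sum_(a < K) t i a x)).
  apply/funext => K; rewrite -(bounded_functional_sum bL)//; congr Lam; apply/funext => x.
  by rewrite bigA_distr_bigA.
apply: (bounded_functional_uniform bL B0 (e := fun K => n%:R * D ^+ n * (`|M| * q ^+ K))) => //.
  move=> K x; have := @dist_prod_le _ (index_enum 'I_n) (fun i => \sum_(a < K) t i a x) (s^~ x) D
    (`|M| * q ^+ K) D1.
  have -> : size (index_enum 'I_n) = n by rewrite [index_enum _]unlock -enumT size_enum_ord.
  apply => //.
  - by rewrite mulr_ge0//; have /andP[] := qK K.
  - move=> i; rewrite (le_trans (sM i x))//.
    by rewrite /D addrAC lerDr addr_ge0.
rewrite -[X in _ --> X](mulr0 (n%:R * D ^+ n)); apply: cvgMr.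
rewrite -[X in _ --> X](mulr0 `|M|); apply: cvgMr.
by apply: cvg_expr; rewrite ger0_norm.
Qed.

End BoundedFunctionals.

(** * Conjugate Szego kernels and their expansions *)

Section Kernels.
Context {R : realType} {n : nat}.
Local Notation C := R[i].
Local Notation T := (n.-tuple R).
Implicit Types (c z : n.-tuple C) (x : T).

Definition zetabar (i : 'I_n) x : C := expi (- tnth x i).

Definition ckern z x : C := \prod_i (1 - tnth z i * zetabar i x)^-1.

Lemma conj_kern z x : (kern z x)^*%C = ckern z x.
Proof.
rewrite /kern /szego rmorph_prod /=; apply: eq_bigr => i _.
rewrite fmorphV rmorphB rmorph1 rmorphM /= conjcK tnth_map mulrC.
by rewrite /zetabar -expi_conj.
Qed.

Lemma kernE z x : kern z x = (ckern z x)^*%C.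
Proof. by rewrite -conj_kern conjcK. Qed.

Lemma cabs_zetabar i x : cabs (zetabar i x) = 1.
Proof. exact: cabs_expi. Qed.

Lemma cmeasurable_zetabar i : cmeasurable (zetabar i).
Proof.
apply: cmeasurable_expi; apply: measurable_funN; exact: measurable_tnth.
Qed.

Lemma geom_remainder (w : C) (q : R) K : q < 1 -> cabs w <= q ->
  cabs (\sum_(a < K) w ^+ a - (1 - w)^-1) <= (1 - q)^-1 * q ^+ K.
Proof.
move=> q1 wq; have q0 : 0 <= q := le_trans (cabs_ge0 _) wq.
have w1 : 1 - q <= cabs (1 - w).
  by have := ge_cabsB 1 w; rewrite cabs1; lra.
have w0 : 1 - w != 0 by rewrite -cabs_gt0; lra.
have -> : \sum_(a < K) w ^+ a - (1 - w)^-1 = - (w ^+ K * (1 - w)^-1).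
  apply: (mulfI w0); rewrite mulrBr mulrN mulrCA mulfV// mulr1.
  by have := subrX1 w K; rewrite -[w - 1]opprB mulNr => /(congr1 -%R); rewrite opprK => <-; rewrite opprB addrAC subrr add0r.
rewrite cabsN cabsM cabsX cabsV mulrC ler_pM ?invr_ge0 ?cabs_ge0 ?exprn_ge0 ?cabs_ge0//.
  by rewrite lef_pV2// posrE; lra.
by rewrite lerXn2r ?nnegrE ?cabs_ge0.
Qed.

Definition kterm c (al : n.-tuple nat) x : C :=
  \prod_i (zetabar i x ^+ tnth al i * (1 - tnth c i * zetabar i x) ^- (tnth al i).+1).

Lemma cabs_1Bmul (c u : C) (rho : R) : cabs u = 1 -> cabs c <= rho -> rho < 1 ->
  1 - rho <= cabs (1 - c * u).
Proof. by move=> u1 cr r1; have := ge_cabsB 1 (c * u); rewrite cabs1 cabsM u1 mulr1; lra. Qed.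

(** With [v = (z - c) u / (1 - c u)] one has [1 - z u = (1 - c u)(1 - v)] and [|v| <= q], so this is
    the geometric series in [v]. *)
Lemma shifted_geom_remainder (c z u : C) (rho q : R) K : cabs u = 1 -> cabs c <= rho -> rho < 1 ->
  0 <= q < 1 -> cabs (z - c) <= q * (1 - rho) ->
  cabs (\sum_(a < K) (z - c) ^+ a * (u ^+ a * (1 - c * u) ^- a.+1) - (1 - z * u)^-1)
   <= ((1 - rho)^-1 * (1 - q)^-1) * q ^+ K.
Proof.
move=> u1 cr r1 /andP[q0 q1] zc.
have c1 := cabs_1Bmul u1 cr r1.
have c0 : 1 - c * u != 0 by rewrite -cabs_gt0; lra.
have cp : 0 < cabs (1 - c * u) by rewrite cabs_gt0.
pose v := (z - c) * u / (1 - c * u).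
have vq : cabs v <= q.
  rewrite /v !cabsM u1 mulr1 cabsV ler_pdivrMr//.
  by rewrite (le_trans zc)// ler_wpM2l.
have -> : \sum_(a < K) (z - c) ^+ a * (u ^+ a * (1 - c * u) ^- a.+1) =
    (1 - c * u)^-1 * \sum_(a < K) v ^+ a.
  rewrite mulr_sumr; apply: eq_bigr => a _.
  by rewrite /v !exprMn exprVn exprS invfM; ring.
have -> : (1 - z * u)^-1 = (1 - c * u)^-1 * (1 - v)^-1.
  by rewrite -invfM; congr (_^-1); rewrite /v mulrBr mulr1 mulrCA mulfV// mulr1; ring.
rewrite -mulrBr cabsM cabsV -mulrA ler_pM ?invr_ge0 ?cabs_ge0//.
  by rewrite lef_pV2// posrE; lra.
exact: geom_remainder.
Qed.

Lemma cmeasurable_1B i (c : C) : cmeasurable (fun x => 1 - c * zetabar i x).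
Proof.
apply: cmeasurableB; first exact: cmeasurable_cst.
by apply: cmeasurableZ; exact: cmeasurable_zetabar.
Qed.

Lemma cmeasurable_ckern z : cmeasurable (ckern z).
Proof.
by apply: cmeasurable_prod => i; apply: cmeasurableV; exact: cmeasurable_1B.
Qed.

Lemma cmeasurable_kterm c al : cmeasurable (kterm c al).
Proof.
apply: cmeasurable_prod => i; apply: cmeasurableM.
  by apply: cmeasurableX; exact: cmeasurable_zetabar.
apply: cmeasurableV; apply: cmeasurableX; exact: cmeasurable_1B.
Qed.

Lemma kterm_bound c al (rho : R) x : (forall i, cabs (tnth c i) <= rho) -> rho < 1 ->
  cabs (kterm c al x) <= \prod_i (1 - rho) ^- (tnth al i).+1.
Proof.
move=> cr r1; rewrite cabs_prod; apply: ler_prod => i _; rewrite cabs_ge0 /=.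
rewrite cabsM cabsX cabs_zetabar expr1n mul1r cabsV cabsX.
have := cabs_1Bmul (cabs_zetabar i x) (cr i) r1 => h.
have h0 : 0 < cabs (1 - tnth c i * zetabar i x) by lra.
rewrite lef_pV2 ?posrE ?exprn_gt0//; last by lra.
by rewrite lerXn2r// nnegrE; lra.
Qed.

Lemma cL1_kterm c al (rho : R) : (forall i, cabs (tnth c i) <= rho) -> rho < 1 ->
  cL1 (kterm c al).
Proof.
move=> cr r1.
by have [] := L1norm_bound (cmeasurable_kterm c al) (fun x => kterm_bound al x cr r1).
Qed.

Lemma ckern_bound z (q : R) x : (forall i, cabs (tnth z i) <= q) -> q < 1 ->
  cabs (ckern z x) <= (1 - q) ^- n.
Proof.
move=> zq q1; rewrite cabs_prod -exprVn -[X in _ <= _ ^+ X]card_ord -prodr_const.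
apply: ler_prod => i _; rewrite cabs_ge0 /= cabsV.
have := cabs_1Bmul (cabs_zetabar i x) (zq i) q1 => h.
by rewrite lef_pV2 ?posrE//; lra.
Qed.

(* Expanding each factor at [c_i]: 1 / (1 - z u) = sum_a (z - c)^a u^a / (1 - c u)^(a+1). *)
Lemma kernel_expansion (B : R) (Lam : (T -> C) -> C) c z (rho q : R) :
  0 <= B -> bounded_functional B Lam -> (forall i, cabs (tnth c i) <= rho) -> rho < 1 ->
  0 <= q < 1 -> (forall i, cabs (tnth z i - tnth c i) <= q * (1 - rho)) ->
  ccvg (fun K => \sum_(al : {ffun 'I_n -> 'I_K})
          Lam (kterm c (midx al)) * mono [tuple tnth z i - tnth c i | i < n] (midx al))
       (Lam (ckern z)).
Proof.
move=> B0 bL cr r1 q01 zc.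
have /= := @bounded_functional_product_series _ _ B Lam
  (fun i a x => (tnth z i - tnth c i) ^+ a * (zetabar i x ^+ a * (1 - tnth c i * zetabar i x) ^- a.+1))
  (fun i x => (1 - tnth z i * zetabar i x)^-1) ((1 - rho)^-1 * (1 - q)^-1) q B0 bL q01 _ _ _.
have mt i a : cmeasurable (fun x : T =>
   (tnth z i - tnth c i) ^+ a * (zetabar i x ^+ a * (1 - tnth c i * zetabar i x) ^- a.+1)).
  apply: cmeasurableZ; apply: cmeasurableM.
    by apply: cmeasurableX; exact: cmeasurable_zetabar.
  apply: cmeasurableV; apply: cmeasurableX; exact: cmeasurable_1B.
have ms i : cmeasurable (fun x : T => (1 - tnth z i * zetabar i x)^-1).
  by apply: cmeasurableV; exact: cmeasurable_1B.
have hr i x K : cabs (\sum_(a < K) (tnth z i - tnth c i) ^+ a * (zetabar i x ^+ a * (1 - tnth c i * zetabar i x) ^- a.+1)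
     - (1 - tnth z i * zetabar i x)^-1) <= (1 - rho)^-1 * (1 - q)^-1 * q ^+ K.
  by apply: shifted_geom_remainder => //; exact: cabs_zetabar.
move=> /(_ mt ms hr).
congr ccvg; apply/funext => K; apply: eq_bigr => al _.
rewrite mulrC -(bounded_functional_Z bL); last exact: cL1_kterm cr r1.
congr Lam; apply/funext => x.
rewrite /mono /kterm -big_split /=; apply: eq_bigr => i _.
by rewrite !tnth_mktuple.
Qed.

Lemma kterm0E (al : n.-tuple nat) :
  kterm [tuple (0 : C) | i < n] al = torchar (fun i => - (tnth al i)%:Z).
Proof.
apply/funext => x; rewrite /kterm /torchar expi_sum; apply: eq_bigr => i _.
rewrite tnth_mktuple mul0r subr0 expr1n invr1 mulr1 mulrNz mulNr -mulrN.
by rewrite -pmulrn expi_natM.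
Qed.

Lemma kernel_expansion0 (B : R) (Lam : (T -> C) -> C) z (q : R) :
  0 <= B -> bounded_functional B Lam -> 0 <= q < 1 -> (forall i, cabs (tnth z i) <= q) ->
  ccvg (fun K => \sum_(al : {ffun 'I_n -> 'I_K})
          Lam (torchar (fun i => - (al i)%:Z)) * mono z (midx al))
       (Lam (ckern z)).
Proof.
move=> B0 bL q01 zq.
have h1 i : cabs (tnth [tuple (0 : C) | i < n] i) <= 0 by rewrite tnth_mktuple cabs0.
have h2 i : cabs (tnth z i - tnth [tuple (0 : C) | i < n] i) <= q * (1 - 0 : R).
  by rewrite tnth_mktuple !subr0 mulr1.
have := @kernel_expansion B Lam [tuple (0 : C) | i < n] z 0 q B0 bL h1 ltr01 q01 h2.
congr ccvg; apply/funext => K; apply: eq_bigr => al _.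
rewrite kterm0E; congr (Lam (torchar _) * _).
  by apply/funext => i; rewrite tnth_mktuple.
by rewrite /mono; apply: eq_bigr => i _; rewrite !tnth_mktuple subr0.
Qed.

End Kernels.

(** * Poisson kernel *)

Section Poisson.
Context {R : realType} {n : nat}.
Local Notation C := R[i].
Local Notation T := (n.-tuple R).
Implicit Types (z : n.-tuple C) (x : T).

(** With [w] the product of [z_i] and [zetabar i x], each factor is the Poisson kernel
    [(1 - |w|^2) / |1 - w|^2], split into its positive frequencies and the others so that the
    product can be expanded over subsets of the coordinates. *)
Definition poisson z x : C :=
  \prod_i ((tnth z i * zetabar i x)^*%C * (1 - (tnth z i * zetabar i x)^*%C)^-1
           + (1 - tnth z i * zetabar i x)^-1).

Lemma cmeasurable_zu i (c : C) : cmeasurable (fun x : T => c * zetabar i x).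
Proof. by apply: cmeasurableZ; exact: cmeasurable_zetabar. Qed.

Lemma conj_zu i (c : C) x : (c * zetabar i x)^*%C = c^*%C * expi (tnth x i).
Proof.
by rewrite rmorphM; congr (_ * _); rewrite -[tnth x i in RHS]opprK -expi_conj.
Qed.

Lemma cmeasurable_cauchy_conj i (c : C) :
  cmeasurable (fun x : T => (c * zetabar i x)^*%C * (1 - (c * zetabar i x)^*%C)^-1).
Proof.
apply: cmeasurableM; first by apply: cmeasurable_conj; exact: cmeasurable_zu.
apply: cmeasurableV; apply: cmeasurableB; first exact: cmeasurable_cst.
by apply: cmeasurable_conj; exact: cmeasurable_zu.
Qed.

Lemma cmeasurable_cauchy i (c : C) : cmeasurable (fun x : T => (1 - c * zetabar i x)^-1).
Proof. by apply: cmeasurableV; exact: cmeasurable_1B. Qed.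

(** [J] is the set of coordinates from which the positive frequencies are taken. The empty set
    contributes [ckern z]; every other term is a series of characters with a positive exponent at
    each [j] in [J], all killed by [Lam]. *)
Lemma bounded_functional_poisson (B : R) (Lam : (T -> C) -> C) z (q : R) :
  0 <= B -> bounded_functional B Lam -> 0 <= q < 1 -> (forall i, cabs (tnth z i) <= q) ->
  (forall k : 'I_n -> int, (exists i, 0 < k i) -> Lam (torchar k) = 0) ->
  cL1 (poisson z) /\ Lam (poisson z) = Lam (ckern z).
Proof.
move=> B0 bL q01 zq Lam0; have /andP[q0 q1] := q01.
have wq i x : cabs (tnth z i * zetabar i x) <= q by rewrite cabsM cabs_zetabar mulr1.
have wq' i x : cabs (tnth z i * zetabar i x)^*%C <= q by rewrite cabs_conj.
pose S (J : {set 'I_n}) (i : 'I_n) (x : T) : C :=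
  if i \in J then (tnth z i * zetabar i x)^*%C * (1 - (tnth z i * zetabar i x)^*%C)^-1
  else (1 - tnth z i * zetabar i x)^-1.
have mS J i : cmeasurable (S J i).
  by rewrite /S; case: (i \in J); [exact: cmeasurable_cauchy_conj|exact: cmeasurable_cauchy].
have inv_bound (w : C) : cabs w <= q -> cabs (1 - w)^-1 <= (1 - q)^-1.
  move=> wq1; have := @geom_remainder _ w q 0 q1 wq1.
  by rewrite big_ord0 sub0r cabsN expr0 mulr1.
have bS J i x : cabs (S J i x) <= (1 - q)^-1.
  rewrite /S; case: (i \in J); last exact: inv_bound.
  by rewrite cabsM -[leRHS]mul1r ler_pM ?cabs_ge0 ?inv_bound// (le_trans (wq' i x))// ltW.
have lS J : cL1 (fun x => \prod_i S J i x).
  have H x : cabs (\prod_i S J i x) <= (1 - q)^-1 ^+ n.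
    rewrite cabs_prod -[X in _ <= _ ^+ X]card_ord -prodr_const; apply: ler_prod.
    by move=> i _; rewrite cabs_ge0 bS.
  have [] // := L1norm_bound _ H; exact: cmeasurable_prod.
have pE : poisson z = fun x => \sum_(J : {set 'I_n}) \prod_i S J i x.
  by apply/funext => x; rewrite /poisson bigA_distr.
split; first by rewrite pE; exact: cL1_sum.
rewrite pE (bounded_functional_sum bL)// (bigD1 finset.set0)//= big1 ?addr0.
  by congr Lam; apply/funext => x; apply: eq_bigr => i _; rewrite /S inE.
move=> J J0; have [j jJ] : exists j, j \in J by apply/finset.set0Pn.
pose t (i : 'I_n) (a : nat) (x : T) : C :=
  if i \in J then (tnth z i * zetabar i x)^*%C ^+ a.+1 else (tnth z i * zetabar i x) ^+ a.
have mt i a : cmeasurable (t i a).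
  rewrite /t; case: (i \in J); apply: cmeasurableX; last exact: cmeasurable_zu.
  by apply: cmeasurable_conj; exact: cmeasurable_zu.
have tS i x K : cabs (\sum_(a < K) t i a x - S J i x) <= (1 - q)^-1 * q ^+ K.
  rewrite /t /S; case: (i \in J); last exact: geom_remainder.
  under eq_bigr do rewrite exprS.
  rewrite -mulr_sumr -mulrBr cabsM -[leRHS]mul1r ler_pM ?cabs_ge0//.
    by rewrite (le_trans (wq' i x))// ltW.
  exact: geom_remainder.
have H := @bounded_functional_product_series _ _ B Lam t (S J) _ q B0 bL q01 mt (mS J) tS.
apply: ccvg_unique H _.
rewrite (_ : (fun K => _) = fun=> 0).
  by split; exact: cvg_cst.
apply/funext => K; apply: big1 => al _.
pose k (i : 'I_n) : int := if i \in J then (al i).+1%:Z else - (al i)%:Z.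
pose cf (i : 'I_n) : C := if i \in J then (tnth z i)^*%C ^+ (al i).+1 else tnth z i ^+ al i.
have -> : (fun x => \prod_i t i (al i) x) = (fun x => (\prod_i cf i) * torchar k x).
  apply/funext => x; rewrite /torchar expi_sum -big_split /=; apply: eq_bigr => i _.
  rewrite /t /cf /k; case: (i \in J).
    by rewrite conj_zu exprMn -pmulrn expi_natM.
  by rewrite exprMn /zetabar mulrNz mulNr -mulrN -pmulrn expi_natM.
rewrite (bounded_functional_Z bL); last exact: cL1_torchar.
by rewrite Lam0 ?mulr0//; exists j; rewrite /k jJ.
Qed.

(** Nonnegativity of the kernel, read off from its closed form; it turns the L1 norm into an
    integral. *)
Lemma poisson_real z x (q : R) : 0 <= q < 1 -> (forall i, cabs (tnth z i) <= q) ->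
  poisson z x = (cabs (poisson z x))%:C%C.
Proof.
move=> /andP[q0 q1] zq; rewrite /poisson cabs_prod rmorph_prod; apply: eq_bigr => i _ /=.
have wq : cabs (tnth z i * zetabar i x) <= q by rewrite cabsM cabs_zetabar mulr1.
move: (_ * zetabar i x) wq => w wq.
have w1 : 1 - w != 0.
  by rewrite -cabs_gt0; have := ge_cabsB 1 w; rewrite cabs1; lra.
have w1' : 1 - w^*%C != 0.
  by rewrite -cabs_gt0; have := ge_cabsB 1 (w^*%C); rewrite cabs1 cabs_conj; lra.
have -> : w^*%C * (1 - w^*%C)^-1 + (1 - w)^-1 =
    ((1 - cabs w ^+ 2) / cabs (1 - w) ^+ 2)%:C%C.
  rewrite rmorphM fmorphV /= -mul_conj rmorphB rmorph1 /= -mul_conj.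
  rewrite rmorphB rmorph1 /=.
  by field; rewrite w1 w1'.
rewrite cabs_real ger0_norm// divr_ge0 ?sqr_ge0//.
rewrite subr_ge0 exprn_ile1 ?cabs_ge0//; lra.
Qed.

Lemma cint_ckern z (q : R) : 0 <= q < 1 -> (forall i, cabs (tnth z i) <= q) ->
  cint (ckern z) = 1.
Proof.
move=> q01 zq; have H := @kernel_expansion0 _ _ 1 _ z q ler01 bounded_functional_cint q01 zq.
apply: ccvg_unique H _.
(* A box of side 0 need not contain the zero multi-index, hence [K.+1]. *)
have E K : \sum_(al : {ffun 'I_n -> 'I_K.+1})
    cint (torchar (fun i => - (al i)%:Z)) * mono z (midx al) = 1.
  rewrite (bigD1 [ffun=> ord0])//= big1 ?addr0.
    rewrite cint_torchar (_ : [forall i, _]); last first.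
      by apply/forallP => i; rewrite ffunE.
    rewrite mul1r /mono big1// => i _.
    by rewrite tnth_mktuple ffunE expr0.
  move=> al al0; rewrite cint_torchar.
  case: forallP => [h|_]; last by rewrite mul0r.
  case/negP: al0; apply/eqP/ffunP => i; rewrite ffunE; apply/val_inj => /=.
  by have := h i; rewrite oppr_eq0 => /eqP[].
apply: ccvg_near; near=> K; have K0 : (0 < K)%N by near: K; exact: nbhs_infty_gt.
by rewrite -(prednK K0) E.
Unshelve. all: by end_near.
Qed.

(** The integral itself kills every character with a positive exponent, so
    [bounded_functional_poisson] applies to it and gives the kernel the same integral as [ckern z],
    namely 1. *)
Lemma L1norm_poisson z (q : R) : 0 <= q < 1 -> (forall i, cabs (tnth z i) <= q) ->
  L1norm (poisson z) = 1.
Proof.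
move=> q01 zq.
have H (k : 'I_n -> int) : (exists i, 0 < k i) -> cint (@torchar R _ k) = 0.
  move=> [i ki]; rewrite cint_torchar; case: forallP => // /(_ i) /eqP k0.
  by rewrite k0 ltxx in ki.
have [lp pE] := bounded_functional_poisson ler01 bounded_functional_cint q01 zq H.
have -> : L1norm (poisson z) = complex.Re (cint (poisson z)).
  rewrite cintE//= /L1norm norm1E; last by case: lp.
  rewrite -[LHS]/(Rintegral _ _ _); apply: eq_Rintegral => x _.
  by rewrite (poisson_real x q01 zq) cabs_real ger0_norm ?cabs_ge0.
by rewrite pE (cint_ckern q01 zq).
Qed.

End Poisson.

(** * From functionals to Schur functions *)

Section FunctionalToSchur.
Context {R : realType} {n : nat}.
Local Notation C := R[i].
Local Notation T := (n.-tuple R).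
Implicit Types (c z : n.-tuple C) (x : T).

Lemma in_disc_bound z : in_disc z ->
  exists2 q : R, 0 <= q < 1 & forall i, cabs (tnth z i) <= q.
Proof.
move=> zd; exists (\big[Num.max/0]_i cabs (tnth z i)).
  rewrite bigmax_ge_id /=; apply: bigmax_lt => // i _; exact: zd.
by move=> i; exact: le_bigmax.
Qed.

Lemma geom_half_le (N : nat) : \sum_(a < N) (2^-1 : R) ^+ a <= 2.
Proof.
have := @subrX1 R 2^-1 N.
have : 0 <= (2^-1 : R) ^+ N by rewrite exprn_ge0// invr_ge0.
have : (2^-1 : R) * 2 = 1 by rewrite mulVf.
move: (\sum_(_ < _) _) (_ ^+ N) => s t; lra.
Qed.

Lemma functional_schur (Lam : (T -> C) -> C) : bounded_functional 1 Lam ->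
  (forall k : 'I_n -> int, (exists i, 0 < k i) -> Lam (torchar k) = 0) ->
  schur_class (fun z => Lam (ckern z)).
Proof.
move=> bL Lam0; split; last first.
  move=> z /in_disc_bound[q q01 zq].
  have [lp <-] := bounded_functional_poisson ler01 bL q01 zq Lam0.
  by rewrite (le_trans (bL.2 _ lp))// mul1r (L1norm_poisson q01 zq).
move=> c /in_disc_bound[rho /andP[rho0 rho1] crho].
(* This radius corresponds to the ratio [q = 1/2] in [kernel_expansion]. *)
exists (2^-1 * (1 - rho)); first by rewrite mulr_gt0// ?invr_gt0//; lra.
exists (fun al => Lam (kterm c al)) => z _ zc.
have half01 : 0 <= (2^-1 : R) < 1 by apply/andP; split; lra.
split; last first.
  apply: (kernel_expansion ler01 bL crho rho1 half01) => i; exact/ltW.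
(* In each coordinate [(1 - rho)^-(a+1)] bounds the coefficient and [((1 - rho) / 2)^a] the power,
   which leaves [(1 - rho)^-1] times a geometric series of sum at most 2. *)
exists (((1 - rho)^-1 * 2) ^+ n) => N.
have rp : 0 < 1 - rho by lra.
have rp' : 0 <= (1 - rho)^-1 by rewrite invr_ge0; lra.
apply: (@le_trans _ _ (\sum_(al : {ffun 'I_n -> 'I_N})
    \prod_i ((1 - rho)^-1 * 2^-1 ^+ al i))).
  apply: ler_sum => al _; rewrite cabsM.
  have h1 : cabs (Lam (kterm c (midx al))) <= \prod_i (1 - rho) ^- (al i).+1.
    have H x : cabs (kterm c (midx al) x) <= \prod_i (1 - rho) ^- (al i).+1.
      apply: le_trans (kterm_bound _ x crho rho1) _.
      by under eq_bigr do rewrite tnth_mktuple.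
    have [lk Nk] := L1norm_bound (cmeasurable_kterm c (midx al)) H.
    by rewrite (le_trans (bL.2 _ lk))// mul1r.
  have h2 : cabs (mono [tuple tnth z i - tnth c i | i < n] (midx al)) <=
      \prod_i (2^-1 * (1 - rho)) ^+ al i.
    rewrite /mono cabs_prod; apply: ler_prod => i _; rewrite cabs_ge0 /=.
    rewrite !tnth_mktuple cabsX lerXn2r ?nnegrE ?cabs_ge0//; last exact: ltW.
    by rewrite mulr_ge0 ?invr_ge0//; lra.
  apply: (le_trans (ler_pM (cabs_ge0 _) (cabs_ge0 _) h1 h2)).
  rewrite -big_split /= le_eqVlt; apply/orP; left; apply/eqP; apply: eq_bigr => i _.
  rewrite exprMn exprS invfM -!mulrA; congr (_ * _).
  by rewrite mulrCA mulVf ?mulr1// expf_neq0// gt_eqF.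
rewrite -(bigA_distr_bigA (fun (_ : 'I_n) (a : 'I_N) => (1 - rho)^-1 * 2^-1 ^+ a)).
rewrite -[X in _ <= _ ^+ X]card_ord -prodr_const; apply: ler_prod => i _.
rewrite -mulr_sumr; apply/andP; split.
  by rewrite mulr_ge0// sumr_ge0// => a _; rewrite exprn_ge0 ?invr_ge0.
by rewrite ler_wpM2l// geom_half_le.
Qed.

End FunctionalToSchur.

(** * Complex form of the Hahn-Banach theorem for the L1 norm *)

Section ComplexHahnBanach.
Context {R : realType} {n : nat}.
Local Notation C := R[i].
Local Notation T := (n.-tuple R).

(** The real part of [l] is extended over the reals to [L]; then [Lam f = L f - i L (i f)] is the
    complex-linear functional with real part [L]. *)
Lemma complex_extension (E : set (T -> C)) (l : (T -> C) -> C) :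
  E (fun=> 0) -> (forall f, E f -> cL1 f) ->
  (forall c f g, E f -> E g -> E (fun x => c * f x + g x)) ->
  (forall c f g, E f -> E g -> l (fun x => c * f x + g x) = c * l f + l g) ->
  (forall f, E f -> cabs (l f) <= L1norm f) ->
  exists2 Lam, bounded_functional 1 Lam & forall f, E f -> Lam f = l f.
Proof.
move=> E0 EL Elin llin lN.
(* [Rcomplex R] is [R[i]] viewed as a module over [R], which supplies the scalar action for the real
   theorem. *)
pose U := T -> Rcomplex R.
have scE (s : R) (f g : U) : s *: f + g = (fun x => s%:C%C * (f x : C) + (g x : C)) :> (T -> C).
  apply/funext => x.
  rewrite -[LHS]/(s *: (f x : Rcomplex R) + (g x : Rcomplex R)).
  by case: (f x) (g x) => [a b] [c d]; apply: complexP => /=; ring.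
have scE0 (s : R) (f : U) : s *: f = (fun x => s%:C%C * (f x : C)) :> (T -> C).
  apply/funext => x; rewrite -[LHS]/(s *: (f x : Rcomplex R)).
  by case: (f x) => [a b]; apply: complexP => /=; ring.
have real_lin (s : R) (z w : C) : complex.Re (s%:C%C * z + w) = s * complex.Re z + complex.Re w.
  by rewrite ReD ReM /= mul0r subr0.
have Vl (s : R) (f g : U) : cL1 (f : T -> C) -> cL1 (g : T -> C) -> cL1 (s *: f + g : T -> C).
  by move=> lf lg; rewrite scE; apply: cL1D => //; exact: cL1Z.
have pD (f g : U) : cL1 (f : T -> C) -> cL1 (g : T -> C) ->
    L1norm (f + g : T -> C) <= L1norm (f : T -> C) + L1norm (g : T -> C).
  exact: L1normD.
have pZ (s : R) (f : U) : cL1 (f : T -> C) -> 0 < s -> L1norm (s *: f : T -> C) = s * L1norm (f : T -> C).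
  by move=> lf s0; rewrite scE0 L1normZ// cabs_real ger0_norm// ltW.
have El (s : R) (f g : U) : E f -> E g -> E (s *: f + g : U).
  by move=> Ef Eg; rewrite scE; exact: Elin.
have ll (s : R) (f g : U) : E f -> E g ->
    complex.Re (l (s *: f + g : U)) = s * complex.Re (l f) + complex.Re (l g).
  by move=> Ef Eg; rewrite scE llin// real_lin.
have lp (f : U) : E f -> complex.Re (l f) <= L1norm (f : T -> C).
  move=> Ef; rewrite (le_trans _ (lN _ Ef))// (le_trans (ler_norm _))//.
  exact: normr_Re.
have [L [Llin' LN LE]] := @hahn_banach R U (fun f => cL1 (f : T -> C)) (fun f => L1norm (f : T -> C))
  Vl pD pZ (fun f => E (f : T -> C)) (fun f => complex.Re (l f)) E0 EL El ll lp.
have Llin (s : R) (f g : T -> C) : cL1 f -> cL1 g ->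
    L (fun x => s%:C%C * f x + g x) = s * L f + L g.
  by move=> lf lg; rewrite -Llin'// scE.
pose I : C := ('i)%C.
pose J (f : T -> C) : T -> C := fun x => I * f x.
have lJ f : cL1 f -> cL1 (J f) by exact: cL1Z.
have Lc (a b : R) (f g : T -> C) : cL1 f -> cL1 g ->
    L (fun x => (a +i* b)%C * f x + g x) = a * L f + b * L (J f) + L g.
  move=> lf lg.
  have -> : (fun x => (a +i* b)%C * f x + g x) =
      (fun x => a%:C%C * f x + (b%:C%C * J f x + g x)).
    apply/funext => x; rewrite /J /I addrA mulrA -mulrDl; congr (_ * _ + _).
    by apply: complexP => /=; ring.
  rewrite Llin//; last by apply: cL1D => //; apply: cL1Z; exact: lJ.
  by rewrite Llin ?addrA//; exact: lJ.
pose Lam f : C := (L f +i* (- L (J f)))%C.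
have Lamlin c f g : cL1 f -> cL1 g -> Lam (fun x => c * f x + g x) = c * Lam f + Lam g.
  move=> lf lg; case: c => a b.
  have JE : J (fun x => (a +i* b)%C * f x + g x) =
     (fun x => ((- b) +i* a)%C * f x + J g x).
    apply/funext => x; rewrite /J mulrDr mulrA; congr (_ * _ + _).
    by apply: complexP => /=; ring.
  rewrite /Lam Lc// JE Lc//; last exact: lJ.
  by apply: complexP => /=; ring.
exists Lam.
  split=> // f lf; rewrite mul1r.
  have [->|c0] := eqVneq (Lam f) 0; first by rewrite cabs0 L1norm_ge0.
  set c := Lam f in c0 *.
  (* A rotation makes [Lam f] real and nonnegative, so that the domination of [L] bounds the
     modulus. *)
  pose u : C := c^*%C * ((cabs c)^-1)%:C%C.
  have cc : cabs c != 0 by rewrite cabs_eq0.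
  have u1 : cabs u = 1.
    by rewrite cabsM cabs_conj cabs_real ger0_norm ?invr_ge0 ?cabs_ge0// mulfV.
  have luf := cL1Z u lf.
  have LamZ : Lam (fun x => u * f x) = u * c.
    have L00 : Lam (fun=> 0) = 0.
      have := Lamlin (-1) _ _ (@cL1_cst _ n 0) (@cL1_cst _ n 0).
      rewrite [in RHS]mulN1r [RHS]addNr => H0; rewrite -[RHS]H0.
      by congr Lam; apply/funext => x; rewrite mulr0 addr0.
    have := Lamlin u _ _ lf (@cL1_cst _ n 0); rewrite L00 addr0 => <-.
    by congr Lam; apply/funext => x; rewrite addr0.
  have -> : cabs c = L (fun x => u * f x).
    rewrite -[RHS]/(complex.Re (Lam (fun x => u * f x))) LamZ /u.
    rewrite mulrAC -[c^*%C * c]mulrC mul_conj -rmorphM/=.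
    by rewrite expr2 mulfK.
  by rewrite (le_trans (LN _ luf))// L1normZ// u1 mul1r.
move=> f Ef; rewrite /Lam LE// LE; last first.
  have := Elin I f (fun=> 0) Ef E0; congr E; apply/funext => x; exact: addr0.
have -> : l (J f) = I * l f.
  have l0 : l (fun=> 0) = 0.
    have := llin (-1) _ _ E0 E0.
    rewrite [in RHS]mulN1r [RHS]addNr => H0; rewrite -[RHS]H0.
    by congr l; apply/funext => x; rewrite mulr0 addr0.
  have := llin I _ _ Ef E0; rewrite l0 addr0 => <-.
  by congr l; apply/funext => x; rewrite addr0.
by apply: complexP => //; rewrite ReM /= mul0r mul1r sub0r opprK.
Qed.

End ComplexHahnBanach.

(** * Taylor expansions on the closed disc *)

Section LocallyAnalytic.
Context {R : realType}.
Local Notation C := R[i].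
Implicit Types (f g : C -> C) (l h c : C) (b : nat -> C) (B : R).

(* The single inequality encodes convergence on [B |h| < 1] together with geometric
   bounds on the remainders, and is stable under all the operations below. *)
Definition taylor_at f l0 b B := 0 < B /\ forall K h, B * cabs h <= 1 ->
  cabs (f (l0 + h) - \sum_(k < K) b k * h ^+ k) <= B * (B * cabs h) ^+ K.

Definition analytic_at f l0 := exists b B, taylor_at f l0 b B.

Lemma bound_mono B B' (r : R) K : 0 < B -> B <= B' -> 0 <= r ->
  B * (B * r) ^+ K <= B' * (B' * r) ^+ K.
Proof.
move=> B0 BB r0; have B'0 : 0 < B' := lt_le_trans B0 BB.
rewrite ler_pM ?exprn_ge0 ?mulr_ge0// ?(ltW B0)//.
by rewrite lerXn2r ?nnegrE ?mulr_ge0// ?(ltW B0) ?(ltW B'0)// ler_wpM2r.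
Qed.

Lemma taylor_at_le f l0 b B B' : B <= B' -> taylor_at f l0 b B -> taylor_at f l0 b B'.
Proof.
move=> BB [B0 H]; split=> [|K h hB]; first exact: lt_le_trans BB.
apply: le_trans (H K h _) _; last exact: bound_mono (cabs_ge0 _).
by apply: le_trans hB; rewrite ler_wpM2r ?cabs_ge0.
Qed.

Lemma taylor_at_val f l0 b B : taylor_at f l0 b B -> b 0%N = f l0.
Proof.
move=> [B0 H]; have := H 1%N 0; rewrite cabs0 mulr0 expr1 mulr0 => /(_ ler01).
rewrite big_ord1 expr0 mulr1 addr0 => h.
have /eqP : cabs (f l0 - b 0%N) = 0 by apply/eqP; rewrite eq_le h cabs_ge0.
by rewrite cabs_eq0 subr_eq0 => /eqP.
Qed.

(** The k-th term is the difference of two consecutive remainders; at [|h| = 1/B] each of them is at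
    most [B]. *)
Lemma taylor_at_coef f l0 b B k : taylor_at f l0 b B -> cabs (b k) <= 2 * B * B ^+ k.
Proof.
move=> [B0 H]; pose h : C := (B^-1)%:C%C.
have ch : B * cabs h = 1.
  by rewrite cabs_real ger0_norm ?invr_ge0 ?(ltW B0)// mulfV// gt_eqF.
have h1 := H k h; have h2 := H k.+1 h; move: h1 h2.
rewrite ch lexx !expr1n !mulr1 => /(_ isT) h1 /(_ isT).
rewrite big_ord_recr /= => h2.
have : cabs (b k * h ^+ k) <= 2 * B.
  set s := \sum_(i < k) _ in h1 h2.
  have -> : b k * h ^+ k = (f (l0 + h) - s) - (f (l0 + h) - (s + b k * h ^+ k)) by ring.
  by rewrite (le_trans (le_cabsB _ _))//; lra.
rewrite cabsM cabsX => hb.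
have -> : cabs (b k) = cabs (b k) * cabs h ^+ k * B ^+ k.
  by rewrite -mulrA -exprMn mulrC [cabs h * B]mulrC ch expr1n mul1r.
by rewrite ler_wpM2r// exprn_ge0// ltW.
Qed.

Lemma taylor_at_add f g l0 b b' B B' : taylor_at f l0 b B -> taylor_at g l0 b' B' ->
  taylor_at (fun l => f l + g l) l0 (fun k => b k + b' k) (B + B').
Proof.
move=> Lf Lg; have [B0 _] := Lf; have [B'0 _] := Lg.
split=> [|K h hB]; first exact: addr_gt0.
have h0 := cabs_ge0 h.
have -> : f (l0 + h) + g (l0 + h) - \sum_(k < K) (b k + b' k) * h ^+ k =
  (f (l0 + h) - \sum_(k < K) b k * h ^+ k) + (g (l0 + h) - \sum_(k < K) b' k * h ^+ k).
  under eq_bigr do rewrite mulrDl.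
  by rewrite big_split /=; ring.
rewrite (le_trans (le_cabsD _ _))// mulrDl lerD//.
  apply: le_trans (Lf.2 K h _) _; first by nra.
  rewrite ler_pM2l// lerXn2r ?nnegrE ?mulr_ge0//; nra.
apply: le_trans (Lg.2 K h _) _; first by nra.
rewrite ler_pM2l// lerXn2r ?nnegrE ?mulr_ge0//; nra.
Qed.

Lemma taylor_at_scale c f l0 b B : taylor_at f l0 b B ->
  taylor_at (fun l => c * f l) l0 (fun k => c * b k) (B * (1 + cabs c)).
Proof.
move=> Lf; have [B0 _] := Lf; have c0 := cabs_ge0 c.
split=> [|K h hB]; first by rewrite mulr_gt0//; lra.
have h0 := cabs_ge0 h.
have -> : c * f (l0 + h) - \sum_(k < K) c * b k * h ^+ k =
  c * (f (l0 + h) - \sum_(k < K) b k * h ^+ k).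
  by rewrite mulrBr mulr_sumr; congr (_ - _); apply: eq_bigr => i _; rewrite mulrA.
have BB : B <= B * (1 + cabs c) by rewrite ler_peMr ?(ltW B0)//; lra.
have Bh : B * cabs h <= B * (1 + cabs c) * cabs h by rewrite ler_wpM2r.
rewrite cabsM -mulrA mulrCA ler_pM ?cabs_ge0//; first by lra.
apply: le_trans (Lf.2 K h (le_trans Bh hB)) _.
by rewrite ler_pM2l// lerXn2r ?nnegrE// mulr_ge0// ltW// mulr_gt0//; lra.
Qed.

Lemma taylor_at_rot (w : C) f l0 b B : cabs w = 1 -> taylor_at f (w * l0) b B ->
  taylor_at (fun l => f (w * l)) l0 (fun k => w ^+ k * b k) B.
Proof.
move=> w1 [B0 H]; split=> // K h hB.
have := H K (w * h); rewrite cabsM w1 mul1r -mulrDr => /(_ hB).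
congr (cabs (_ - _) <= _); apply: eq_bigr => k _; rewrite exprMn; ring.
Qed.

Definition shift_coef l0 b (k : nat) : C := l0 * b k + (if k is k'.+1 then b k' else 0).

Lemma taylor_at_mulX f l0 b B : taylor_at f l0 b B ->
  taylor_at (fun l => l * f l) l0 (shift_coef l0 b) (B * (1 + cabs l0) + 1).
Proof.
move=> Lf; have [B0 _] := Lf; have c0 := cabs_ge0 l0.
set B' := B * (1 + cabs l0) + 1.
have BB : B <= B' by rewrite /B'; nra.
have B'0 : 0 < B' := lt_le_trans B0 BB.
split=> // K h hB; have h0 := cabs_ge0 h.
have Bh : B * cabs h <= B' * cabs h by rewrite ler_wpM2r.
have Bh1 := le_trans Bh hB.
have lB : cabs l0 * B + 1 <= B' by rewrite /B'; nra.
case: K => [|K].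
  rewrite big_ord0 subr0 expr0 mulr1 cabsM.
  have := Lf.2 0%N h Bh1; rewrite big_ord0 subr0 expr0 mulr1 => fB.
  have := le_cabsD l0 h => lh; have := cabs_ge0 (f (l0 + h)); have := cabs_ge0 (l0 + h).
  by move: lB lh fB Bh1 B0; move: (cabs _) (cabs _) (cabs _) (cabs _) => *; nra.
have -> : (l0 + h) * f (l0 + h) - \sum_(k < K.+1) shift_coef l0 b k * h ^+ k =
  l0 * (f (l0 + h) - \sum_(k < K.+1) b k * h ^+ k) +
  h * (f (l0 + h) - \sum_(k < K) b k * h ^+ k).
  have -> : \sum_(k < K.+1) shift_coef l0 b k * h ^+ k =
      l0 * (\sum_(k < K.+1) b k * h ^+ k) + h * \sum_(k < K) b k * h ^+ k.
    rewrite /shift_coef; under eq_bigr do rewrite mulrDl.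
    rewrite big_split /= !mulr_sumr; congr (_ + _).
      by apply: eq_bigr => i _; rewrite mulrA.
    rewrite big_ord_recl mul0r add0r; apply: eq_bigr => i _ /=.
    by rewrite /bump /= add1n exprS; ring.
  ring.
rewrite (le_trans (le_cabsD _ _))// !cabsM.
have h1 := Lf.2 K.+1 h Bh1; have h2 := Lf.2 K h Bh1.
apply: (@le_trans _ _ ((cabs l0 * B + 1) * (B * cabs h) ^+ K.+1)).
  rewrite mulrDl mul1r lerD//; first by rewrite -mulrA ler_wpM2l.
  rewrite (le_trans (ler_wpM2l h0 h2))// exprS; lra.
rewrite ler_pM//.
- by rewrite addr_ge0// mulr_ge0// ltW.
- by rewrite exprn_ge0// mulr_ge0// ltW.
- by rewrite lerXn2r ?nnegrE// mulr_ge0// ltW.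
Qed.

Lemma taylor_at_cst c l0 : taylor_at (fun=> c) l0 (fun k => if k is 0 then c else 0) (1 + cabs c).
Proof.
have c0 := cabs_ge0 c; split=> [|K h hB]; first by lra.
case: K => [|K]; first by rewrite big_ord0 subr0 expr0 mulr1; lra.
rewrite big_ord_recl /= expr0 mulr1 big1 ?addr0 ?subrr ?cabs0.
  by rewrite mulr_ge0 ?exprn_ge0 ?mulr_ge0 ?cabs_ge0//; lra.
by move=> i _; rewrite mul0r.
Qed.

Lemma analytic_at_add f g l0 : analytic_at f l0 -> analytic_at g l0 -> analytic_at (fun l => f l + g l) l0.
Proof.
move=> [b [B Lf]] [b' [B' Lg]].
by exists (fun k => b k + b' k), (B + B'); exact: taylor_at_add.
Qed.

Lemma analytic_at_scale c f l0 : analytic_at f l0 -> analytic_at (fun l => c * f l) l0.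
Proof.
by move=> [b [B Lf]]; exists (fun k => c * b k), (B * (1 + cabs c)); exact: taylor_at_scale.
Qed.

Lemma analytic_at_monomial c j l0 : analytic_at (fun l => c * l ^+ j) l0.
Proof.
apply: analytic_at_scale; elim: j => [|j [b [B IH]]].
  by under eq_fun do rewrite expr0; exists (fun k => if k is 0 then 1 else 0), (1 + cabs 1); exact: taylor_at_cst.
under eq_fun do rewrite exprS.
by exists (shift_coef l0 b), (B * (1 + cabs l0) + 1); exact: taylor_at_mulX.
Qed.

Lemma taylor_at_ext f l0 b b' B : b =1 b' -> taylor_at f l0 b B -> taylor_at f l0 b' B.
Proof.
move=> bb [B0 H]; split=> // K h hB.
by under eq_bigr do rewrite -bb; exact: H.
Qed.

Lemma taylor_at_monomial0 c j : exists B, taylor_at (fun l => c * l ^+ j) 0 (fun k => c * (k == j)%:R) B.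
Proof.
suff [B LB] : exists B, taylor_at (fun l => l ^+ j) 0 (fun k => (k == j)%:R) B.
  by exists (B * (1 + cabs c)); exact: taylor_at_scale.
elim: j => [|j [B IH]].
  exists (1 + cabs (1 : C)); under [X in taylor_at X]eq_fun do rewrite expr0.
  by apply: taylor_at_ext (taylor_at_cst 1 0) => -[|k].
exists (B * (1 + cabs (0 : C)) + 1); under [X in taylor_at X]eq_fun do rewrite exprS.
apply: taylor_at_ext (taylor_at_mulX IH) => -[|k]; rewrite /shift_coef mul0r add0r//.
Qed.

Lemma analytic_at_sum I (s : seq I) (F : I -> C -> C) l0 : (forall i, analytic_at (F i) l0) ->
  analytic_at (fun l => \sum_(i <- s) F i l) l0.
Proof.
move=> H; elim: s => [|i s IH].
  under eq_fun do rewrite big_nil.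
  by exists (fun k => if k is 0 then 0 else 0), (1 + cabs 0); exact: taylor_at_cst.
by under eq_fun do rewrite big_cons; exact: analytic_at_add.
Qed.

Lemma taylor_at_sum0 I (s : seq I) (F : I -> C -> C) (b : I -> nat -> C) l0 :
  (forall i, exists B, taylor_at (F i) l0 (b i) B) ->
  exists B, taylor_at (fun l => \sum_(i <- s) F i l) l0 (fun k => \sum_(i <- s) b i k) B.
Proof.
move=> H; elim: s => [|i s [B IH]].
  exists (1 + cabs (0 : C)); under [X in taylor_at X]eq_fun do rewrite big_nil.
  by apply: taylor_at_ext (taylor_at_cst 0 l0) => -[|k]; rewrite big_nil.
have [Bi Hi] := H i; exists (Bi + B); under [X in taylor_at X]eq_fun do rewrite big_cons.
by apply: taylor_at_ext (taylor_at_add Hi IH) => k; rewrite big_cons.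
Qed.

(** Adding [2 / r] to the constant restricts the increments to [|h| <= r / 2], where the two
    functions agree. *)
Lemma analytic_at_congr f g l0 (r : R) : 0 < r ->
  (forall h, cabs h < r -> f (l0 + h) = g (l0 + h)) -> analytic_at f l0 -> analytic_at g l0.
Proof.
move=> r0 fg [b [B Lf]]; exists b, (B + 2 * r^-1).
have ri : 0 < r^-1 by rewrite invr_gt0.
have [B0 _] := Lf.
have [B'0 H] : taylor_at f l0 b (B + 2 * r^-1) by apply: taylor_at_le Lf; lra.
split=> // K h hB; rewrite -fg; first exact: H.
have h0 := cabs_ge0 h.
have : 2 * r^-1 * cabs h <= 1.
  by apply: le_trans hB; rewrite ler_wpM2r//; lra.
rewrite mulrAC ler_pdivrMr// mul1r; move: (cabs h) r0 h0 => *; lra.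
Qed.

End LocallyAnalytic.

(** * Division by powers of the variable, and maximum points on the closed disc *)

Section MaximumModulus.
Context {R : realType}.
Local Notation C := R[i].
Implicit Types (f g : C -> C) (l h c : C) (b : nat -> C) (B : R).

(** Solves [(l0 + h) (sum_k d_k h^k) = sum_k b_k h^k] term by term: [l0 d_k + d_(k-1) = b_k]. *)
Fixpoint div_coef (l0 : C) b (k : nat) : C :=
  if k is k'.+1 then (b k - div_coef l0 b k') / l0 else b 0%N / l0.

Lemma analytic_at_divX f l0 : l0 != 0 -> analytic_at f l0 -> analytic_at (fun l => f l / l) l0.
Proof.
move=> l00 [b [B Lf]]; have [B0 H] := Lf.
set a := cabs l0; have a0 : 0 < a by rewrite cabs_gt0.
pose d := div_coef l0 b.
pose i := a^-1; have i0 : 0 < i by rewrite invr_gt0.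
have ia : i * a = 1 by rewrite mulVf// gt_eqF.
(* [D >= 2 / |l0|] and [E = 4 B / |l0|] make each of the two terms of the recursion at most half of
   the bound [E D^k] aimed at for [|d_k|]. *)
pose D := B + 2 * i; pose E := 4 * B * i.
have D0 : 0 < D by rewrite /D; lra.
have E0 : 0 < E by rewrite /E mulr_gt0// mulr_gt0.
have dE k : cabs (d k) <= E * D ^+ k.
  elim: k => [|k IH].
    rewrite expr0 mulr1 cabsM cabsV -/a -/i /E.
    have := taylor_at_coef 0 Lf; rewrite expr0 mulr1 => h.
    by have := cabs_ge0 (b 0%N); nra.
  rewrite /d /= -/d cabsM cabsV -/a -/i.
  have h1 := le_cabsB (b k.+1) (d k); have h2 := taylor_at_coef k.+1 Lf.
  have h3 : B ^+ k.+1 <= D ^+ k.+1.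
    by rewrite lerXn2r ?nnegrE ?(ltW B0) ?(ltW D0)// /D; lra.
  have Dk : 0 < D ^+ k by rewrite exprn_gt0.
  have h4 : E * D ^+ k * i <= E * (D ^+ k.+1) / 2.
    have : E * D ^+ k * i <= E * D ^+ k * (D / 2).
      by rewrite ler_wpM2l ?mulr_ge0 ?(ltW E0) ?(ltW Dk)// /D; lra.
    rewrite exprS; lra.
  have h5 : 2 * B * B ^+ k.+1 * i <= E * (D ^+ k.+1) / 2.
    have : 2 * B * i * B ^+ k.+1 <= 2 * B * i * D ^+ k.+1.
      by rewrite ler_wpM2l// ltW// !mulr_gt0.
    rewrite /E; lra.
  have : cabs (b k.+1 - d k) * i <= (2 * B * B ^+ k.+1 + E * D ^+ k) * i.
    by rewrite ler_wpM2r ?(ltW i0)// (le_trans h1)// lerD.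
  lra.
(* Truncation leaves one uncancelled term of order [K], of the size of the remainder. *)
have sumE K h : (l0 + h) * (\sum_(k < K) d k * h ^+ k) = \sum_(k < K) b k * h ^+ k +
    (if K is K'.+1 then d K' * h ^+ K else 0).
  elim: K => [|K IH]; first by rewrite !big_ord0 mulr0 addr0.
  rewrite !big_ord_recr /= mulrDr IH.
  have -> : d K * h ^+ K.+1 = h * (d K * h ^+ K) by rewrite exprS; ring.
  have ld : l0 * d K = b K - (if K is K'.+1 then d K' else 0).
    by case: K {IH} => [|K]; rewrite /d /= mulrC divfK// subr0.
  rewrite mulrDl [l0 * (_ * _)]mulrA ld.
  by case: K {IH ld} => [|K]; ring.
have Bi : 0 < B * i by rewrite mulr_gt0.
exists d, (D + 2 * B * i + E); split; first by rewrite /D; lra.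
move=> K h hB; have h0 := cabs_ge0 h.
have hD : D * cabs h <= 1.
  by apply: le_trans hB; rewrite ler_wpM2r//; lra.
have hB1 : B * cabs h <= 1.
  by apply: le_trans hD; rewrite ler_wpM2r// /D; lra.
have hi : 2 * i * cabs h <= 1.
  by apply: le_trans hD; rewrite ler_wpM2r// /D; lra.
have ha : 2 * cabs h <= a.
  have : a * (2 * i * cabs h) <= a * 1 by rewrite ler_wpM2l// ltW.
  have -> : a * (2 * i * cabs h) = 2 * (i * a) * cabs h by ring.
  by rewrite ia !mulr1.
have la2 : a / 2 <= cabs (l0 + h).
  have := ge_cabsB l0 (- h); rewrite cabsN opprK -/a; lra.
have lh0 : l0 + h != 0 by rewrite -cabs_gt0; lra.
have -> : f (l0 + h) / (l0 + h) - \sum_(k < K) d k * h ^+ k =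
   ((f (l0 + h) - \sum_(k < K) b k * h ^+ k) - (if K is K'.+1 then d K' * h ^+ K else 0)) / (l0 + h).
  apply: (mulIf lh0); rewrite [RHS]divfK// mulrBl divfK// [X in _ - X]mulrC sumE.
  by case: K => [|K]; ring.
have fR := H K h hB1.
have DhK : 0 <= (D * cabs h) ^+ K by rewrite exprn_ge0// mulr_ge0// ltW.
have BDK : (B * cabs h) ^+ K <= (D * cabs h) ^+ K.
  by rewrite lerXn2r ?nnegrE ?mulr_ge0 ?(ltW B0) ?(ltW D0)// ler_wpM2r// /D; lra.
have dR : cabs (if K is K'.+1 then d K' * h ^+ K else 0) <= E * (a / 2) * (D * cabs h) ^+ K.
  case: K {fR DhK BDK} => [|K].
    by rewrite cabs0 expr0 mulr1 ltW// mulr_gt0// divr_gt0.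
  rewrite cabsM cabsX exprMn.
  have hK : 0 <= cabs h ^+ K.+1 by rewrite exprn_ge0.
  rewrite [leRHS]mulrA ler_wpM2r// (le_trans (dE K))// -[leRHS]mulrA ler_pM2l//.
  have DK : 0 < D ^+ K by rewrite exprn_gt0.
  rewrite exprS [leRHS]mulrA -[leLHS]mul1r ler_pM2r// /D mulrDr.
  have -> : a / 2 * (2 * i) = i * a by field.
  rewrite ia; have : 0 < a / 2 * B by rewrite mulr_gt0// divr_gt0. lra.
rewrite cabsM cabsV.
have inv2 : (cabs (l0 + h))^-1 <= 2 * i.
  have -> : 2 * i = (a / 2)^-1 by rewrite /i; field; rewrite gt_eqF.
  by rewrite lef_pV2 ?posrE//; lra.
set t := (D * cabs h) ^+ K in DhK BDK dR *.
apply: (@le_trans _ _ ((B * t + E * (a / 2) * t) * (2 * i))).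
  rewrite ler_pM ?cabs_ge0 ?invr_ge0 ?cabs_ge0//.
  rewrite (le_trans (le_cabsB _ _))// lerD// (le_trans fR)// ler_pM2l//.
have -> : (B * t + E * (a / 2) * t) * (2 * i) = (2 * B * i + E * (i * a)) * t by field.
rewrite ia mulr1 ler_pM//; [by nra| |].
  by rewrite /D; lra.
rewrite /t lerXn2r ?nnegrE ?mulr_ge0 ?(ltW D0)//; first by lra.
by rewrite ler_wpM2r//; lra.
Qed.

Lemma analytic_at_divXn f l0 j : l0 != 0 -> analytic_at f l0 -> analytic_at (fun l => f l / l ^+ j) l0.
Proof.
move=> l00 Lf; elim: j => [|j IH].
  by under eq_fun do rewrite expr0 divr1.
under eq_fun do rewrite exprSr invfM mulrA.
exact: (analytic_at_divX l00 IH).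
Qed.

(** Removable singularity: the coefficients shift by [j], the value at 0 being [b j]. Division by
    [h^j] costs a factor [B^j] in the remainder. *)
Lemma analytic_at_div0 f b B j : taylor_at f 0 b B -> (forall i, (i < j)%N -> b i = 0) ->
  analytic_at (fun l => if l == 0 then b j else f l / l ^+ j) 0.
Proof.
move=> Lf bj; have [B0 H] := Lf.
exists (fun k => b (j + k)%N), (B + 2 * B * B ^+ j).
have Bj : 0 < B ^+ j by rewrite exprn_gt0.
have BBj : 0 < B * B ^+ j by rewrite mulr_gt0.
have B'0 : 0 < B + 2 * B * B ^+ j by lra.
split=> // K h hB; rewrite add0r; have h0 := cabs_ge0 h.
have [->|hn0] := eqVneq h 0.
  case: K => [|K].
    rewrite big_ord0 subr0 expr0 mulr1; have := taylor_at_coef j Lf; lra.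
  rewrite big_ord_recl /= expr0 mulr1 addn0 big1 ?addr0 ?subrr ?cabs0.
    by rewrite mulr_ge0 ?exprn_ge0 ?mulr_ge0// ltW.
  by move=> i _; rewrite /bump /= add1n exprS mul0r mulr0.
have hj : h ^+ j != 0 by rewrite expf_neq0.
have hB1 : B * cabs h <= 1 by apply: le_trans hB; rewrite ler_wpM2r//; lra.
have -> : f h / h ^+ j - \sum_(k < K) b (j + k)%N * h ^+ k =
    (f (0 + h) - \sum_(i < j + K) b i * h ^+ i) / h ^+ j.
  rewrite add0r mulrBl; congr (_ - _).
  rewrite big_split_ord /= [X in X + _]big1 ?add0r; last first.
    by move=> i _; rewrite bj// mul0r.
  rewrite mulr_suml; apply: eq_bigr => i _ /=.
  by rewrite exprD -mulrA [h ^+ j * _]mulrC mulfK.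
rewrite cabsM cabsV cabsX.
have ch : 0 < cabs h by rewrite cabs_gt0.
rewrite ler_pdivrMr ?exprn_gt0//.
apply: le_trans (H (j + K)%N h hB1) _.
rewrite exprD exprMn.
have -> : B * (B ^+ j * cabs h ^+ j * (B * cabs h) ^+ K) =
  B * B ^+ j * (B * cabs h) ^+ K * cabs h ^+ j by ring.
rewrite ler_wpM2r ?exprn_ge0// ler_pM ?exprn_ge0 ?mulr_ge0 ?(ltW B0) ?(ltW Bj)//; first by lra.
rewrite lerXn2r ?nnegrE ?mulr_ge0 ?(ltW B0)//; first by lra.
by rewrite ler_wpM2r//; lra.
Qed.

(* Among the maximum points of [f], [x] has the largest modulus, so [f] cannot be
   locally constant near an interior [x]. *)
Lemma disc_lexmax (f : C -> R) :
  (forall l0, cabs l0 <= 1 -> forall e : R, 0 < e -> exists2 d : R, 0 < d &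
     forall l, cabs l <= 1 -> cabs (l - l0) < d -> f l < f l0 + e) ->
  exists2 x, cabs x <= 1 & forall y, cabs y <= 1 ->
    f y <= f x /\ (f y = f x -> cabs y <= cabs x).
Proof.
move=> usc.
pose cc (p : R * R) : C := (p.1 +i* p.2)%C.
pose K := [set p : R * R | cabs (cc p) <= 1].
have cK : compact K.
  have cS : compact (`[(-1 : R), 1]%classic `*` `[(-1 : R), 1]%classic).
    by apply: compact_setX; exact: segment_compact.
  apply: (subclosed_compact _ cS).
    rewrite (_ : K = (fun p : R * R => p.1 ^+ 2 + p.2 ^+ 2) @^-1` [set t | t <= 1]).
      apply: closed_comp; last exact: closed_le.
      move=> p _; apply: cvgD; apply: cvgM; by [exact: cvg_fst|exact: cvg_snd].
    apply/seteqP; split=> p; rewrite /K /= => h.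
      have := cabs_sqr (cc p); rewrite /= => <-.
      by rewrite exprn_ile1 ?cabs_ge0.
    by rewrite /cabs /= -sqrtr1 ler_wsqrtr.
  move=> p Kp; split; rewrite /= in_itv /= -ler_norml.
    exact: le_trans (normr_Re (cc p)) Kp.
  exact: le_trans (normr_Im (cc p)) Kp.
(* The upper sets of this lexicographic preorder form a filter base on the compact disc. A cluster
   point of it is a maximum: semicontinuity handles [f], and continuity handles the modulus. *)
pose ge (y0 y : R * R) := f (cc y0) < f (cc y) \/
  (f (cc y0) = f (cc y) /\ cabs (cc y0) <= cabs (cc y)).
pose A (y0 : R * R) := [set y | K y /\ ge y0 y].
have geT y0 y1 y2 : ge y0 y1 -> ge y1 y2 -> ge y0 y2.
  rewrite /ge => -[h|[h h']] [k|[k k']].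
  - by left; exact: lt_trans k.
  - by left; rewrite -k.
  - by left; rewrite h.
  - by right; rewrite h k; split=> //; exact: le_trans k'.
have geR y : ge y y by right.
have FF : ProperFilter (filter_from K A).
  apply: filter_from_proper; last by move=> y Ky; exists y.
  apply: filter_from_filter.
    by exists (0, 0); rewrite /K /= (_ : cc (0, 0) = 0) ?cabs0 ?ler01.
  move=> y1 y2 K1 K2.
  have [g12|g21] : ge y1 y2 \/ ge y2 y1.
    rewrite /ge; case: (ltrgtP (f (cc y1)) (f (cc y2))) => h; [by left; left|by right; left|].
    by case: (leP (cabs (cc y1)) (cabs (cc y2))) => h'; [left; right|right; right; rewrite h; split=> //; exact: ltW].
  - by exists y2 => // y [Ky g2]; split; split=> //; exact: geT g2.
  - by exists y1 => // y [Ky g1]; split; split=> //; exact: geT g1.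
have FK : filter_from K A K by exists (0, 0); [rewrite /K /= (_ : cc (0, 0) = 0) ?cabs0 ?ler01|move=> y []].
have [p [Kp clp]] := cK _ FF FK.
have near_p y0 (d : R) : K y0 -> 0 < d -> exists2 y, A y0 y & cabs (cc y - cc p) < d.
  move=> K0 d0.
  have FA : filter_from K A (A y0) by exists y0.
  have NB : nbhs p (ball p (d / 2)) by apply: nbhsx_ballx; rewrite divr_gt0.
  have [y [Ay By]] := clp _ _ FA NB.
  exists y => //; have [B1 B2] := By.
  rewrite (le_lt_trans (cabs_le_ReIm _))// ImB ReB /=.
  move: B1 B2; rewrite /ball /= => B1 B2.
  by rewrite [X in X + _]distrC [X in _ + X]distrC; lra.
have fmax y0 : K y0 -> f (cc y0) <= f (cc p).
  move=> K0; apply/ler_addgt0Pr => e e0.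
  have [d d0 hd] := usc _ Kp e e0.
  have [y [Ky gy] yd] := near_p y0 d K0 d0.
  have := hd _ Ky yd; case: gy => [h|[h _]]; lra.
exists (cc p) => // y yc.
have yE : y = cc (complex.Re y, complex.Im y) by case: y yc.
have K0 : K (complex.Re y, complex.Im y) by rewrite /K /= -yE.
rewrite yE; split; first exact: fmax.
move=> fyp; apply/ler_addgt0Pr => e e0.
have [y' [Ky' gy'] yd] := near_p _ e K0 e0.
have := fmax _ Ky'; case: gy' => [h|[h hc]] hm; first by lra.
rewrite (le_trans hc)//; have := ge_cabsB (cc y') (cc p); lra.
Qed.

End MaximumModulus.

(** * Maximum modulus principle, Schwarz lemma and Taylor remainders *)

Section TaylorOnDisc.
Context {R : realType}.
Local Notation C := R[i].
Implicit Types (f g q : C -> C) (l h c : C) (b : nat -> C) (B M : R).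

Lemma analytic_at_cont f l0 (e : R) : analytic_at f l0 -> 0 < e -> exists2 d : R, 0 < d &
  forall l, cabs (l - l0) < d -> cabs (f l - f l0) <= e.
Proof.
move=> [b [B Lq]] e0; have [B0 H] := Lq; have b0 := taylor_at_val Lq.
have BB : 0 < B * B by rewrite mulr_gt0.
exists (Num.min B^-1 (e / (B * B))).
  by rewrite lt_min invr_gt0 B0 divr_gt0.
move=> l; rewrite lt_min => /andP[h1 h2].
have hB : B * cabs (l - l0) <= 1.
  by rewrite mulrC -ler_pdivlMr// mul1r ltW.
have := H 1%N (l - l0) hB; rewrite big_ord1 expr0 mulr1 b0 [l0 + _]addrC subrK expr1.
move: h2; rewrite ltr_pdivlMr// => h2 h3; lra.
Qed.

Lemma analytic_at_usc q l0 (e : R) : analytic_at q l0 -> 0 < e -> exists2 d : R, 0 < d &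
  forall l, cabs (l - l0) < d -> cabs (q l) < cabs (q l0) + e.
Proof.
move=> Lq e0; have e2 : 0 < e / 2 by rewrite divr_gt0.
have [d d0 hd] := analytic_at_cont Lq e2; exists d => // l /hd.
have := ge_cabsB (q l) (q l0); lra.
Qed.

(** Let [x] be an interior lexicographic maximum. If all higher coefficients vanish, [q] is constant
    near [x] and a step outwards contradicts the maximality of [|x|]. Otherwise, unless [q x = 0], a
    step along which the first higher term points in the direction of [q x] increases [|q|]. *)
Lemma max_modulus q M : (forall l, cabs l <= 1 -> analytic_at q l) ->
  (forall l, cabs l = 1 -> cabs (q l) <= M) -> forall l, cabs l <= 1 -> cabs (q l) <= M.
Proof.
move=> Lq qM.
have M0 : 0 <= M := le_trans (cabs_ge0 _) (qM 1 cabs1).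
have [|x x1 xmax] := @disc_lexmax _ (fun l => cabs (q l)).
  move=> l0 l1 e e0; have [d d0 hd] := analytic_at_usc (Lq _ l1) e0.
  by exists d => // l _; exact: hd.
move=> l l1; apply: le_trans (xmax l l1).1 _.
move: x1; rewrite le_eqVlt => /orP[/eqP|x1]; first exact: qM.
have [b [B Lx]] := Lq x (ltW x1); have [B0 H] := Lx; have b0 := taylor_at_val Lx.
pose i := B^-1; have i0 : 0 < i by rewrite invr_gt0.
have iB : B * i = 1 by rewrite mulfV// gt_eqF.
have [/existsNP[k /eqP bk]|nz] := pselect (~ forall k, b k.+1 = 0); last first.
  have {nz} nz k : b k.+1 = 0 by move/contrapT : nz.
  have qc h : B * cabs h <= 2^-1 -> q (x + h) = q x.
    move=> hB; apply/eqP; rewrite -subr_eq0 -cabs_eq0 eq_le cabs_ge0 andbT.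
    have hB1 : B * cabs h <= 1 by lra.
    have Hk K : cabs (q (x + h) - q x) <= B / 2 * 2^-1 ^+ K.
      rewrite -mulrA -exprS.
      have := H K.+1 h hB1; rewrite big_ord_recl /= expr0 mulr1 b0 big1 ?addr0; last first.
        by move=> j _; rewrite nz mul0r.
      move=> /le_trans; apply; rewrite ler_pM2l// lerXn2r ?nnegrE ?mulr_ge0 ?(ltW B0) ?cabs_ge0//.
    have cv : (fun K => B / 2 * 2^-1 ^+ K) @ \oo --> (0 : R).
      rewrite -[X in _ --> X](mulr0 (B / 2)); apply: cvgMr.
      by apply: cvg_expr; rewrite ger0_norm//; lra.
    rewrite -(cvg_lim _ cv)//; apply: limr_ge; first exact: cvgP cv.
    by near=> K; exact: Hk.
  pose t := Num.min (i / 2) (1 - cabs x).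
  have t0 : 0 < t by rewrite lt_min divr_gt0//= subr_gt0.
  have ti : B * t <= 2^-1.
    have : t <= i / 2 by rewrite ge_min lexx.
    move=> h; have : B * t <= B * (i / 2) by rewrite ler_pM2l.
    by rewrite mulrA iB mul1r.
  have tx : t <= 1 - cabs x by rewrite ge_min lexx orbT.
  (* [u] is the outward direction at [x]; at the origin any direction will do. *)
  have [u u1 xu] : exists2 u : C, cabs u = 1 & x = (cabs x)%:C%C * u.
    have [->|xn0] := eqVneq x 0; first by exists 1; rewrite ?cabs1// cabs0 mul0r.
    have cx : cabs x != 0 by rewrite cabs_eq0.
    exists (x * ((cabs x)^-1)%:C%C).
      by rewrite cabsM cabs_real ger0_norm ?invr_ge0 ?cabs_ge0// mulfV.
    by rewrite mulrCA -rmorphM /= mulfV// mulr1.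
  pose h : C := t%:C%C * u.
  have ch : cabs h = t by rewrite cabsM u1 mulr1 cabs_real ger0_norm// ltW.
  have cxh : cabs (x + h) = cabs x + t.
    rewrite {1}xu /h -mulrDl -rmorphD cabsM u1 mulr1 cabs_real ger0_norm//.
    by rewrite addr_ge0 ?cabs_ge0// ltW.
  have xh1 : cabs (x + h) <= 1 by rewrite cxh; lra.
  have [_] := xmax _ xh1; rewrite qc ?ch// cxh => /(_ erefl); lra.
have exb : exists k, b k.+1 != 0 by exists k.
case: (ex_minnP exb) => j bj jmin {k bk exb}.
pose m := j.+1.
have qx : cabs (q x) <= 0; last by lra.
rewrite leNgt; apply/negP => qx0.
have qxn0 : q x != 0 by rewrite -cabs_gt0.
have cbj : 0 < cabs (b m) by rewrite cabs_gt0.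
(* If [z^m = w], then [b_m (t z)^m] is a positive multiple of [q x]. *)
pose w : C := (q x * ((cabs (q x))^-1)%:C%C) * ((b m)^*%C * ((cabs (b m))^-1)%:C%C).
have w1 : cabs w = 1.
  rewrite !cabsM !cabs_real cabs_conj !ger0_norm ?invr_ge0 ?cabs_ge0//.
  by rewrite !mulfV ?mulr1 // gt_eqF.
pose z : C := m.-root w.
have zm : z ^+ m = w by rewrite rootCK.
have z1 : cabs z = 1.
  have := w1; rewrite -zm cabsX => /eqP; rewrite pexpr_eq1 ?cabs_ge0//.
  by move=> /eqP.
pose D := B * B ^+ m.+1.
have D0 : 0 < D by rewrite mulr_gt0// exprn_gt0.
(* The three bounds keep the Taylor estimate valid, keep [x + h] in the disc, and make the remainder
   [D t^(m+1)] smaller than the gain [|b_m| t^m]. *)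
pose t := Num.min i (Num.min (1 - cabs x) (cabs (b m) / (2 * D))).
have t0 : 0 < t.
  by rewrite !lt_min i0 subr_gt0 x1 /= divr_gt0// mulr_gt0.
have ti : B * t <= 1.
  by rewrite -iB ler_pM2l// ge_min lexx.
have tx : t <= 1 - cabs x by rewrite !ge_min lexx !orbT.
have tD : D * t < cabs (b m).
  have : t <= cabs (b m) / (2 * D) by rewrite !ge_min lexx !orbT.
  rewrite ler_pdivlMr; last exact: mulr_gt0.
  move=> h.
  have : 0 < D * t by rewrite mulr_gt0. lra.
pose h : C := t%:C%C * z.
have ch : cabs h = t by rewrite cabsM z1 mulr1 cabs_real ger0_norm// ltW.
have xh1 : cabs (x + h) <= 1.
  by rewrite (le_trans (le_cabsD _ _))// ch; lra.
have := H m.+1 h; rewrite ch => /(_ ti).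
rewrite big_ord_recr /= big_ord_recl /= expr0 mulr1 b0 big1 ?addr0; last first.
  move=> a _; rewrite /bump /= add1n.
  have -> : b a.+1 = 0; last by rewrite mul0r.
  by apply/eqP; apply: contraTT (ltn_ord a) => /jmin; rewrite -leqNgt.
have -> : q x + b m * h ^+ m = q x * (1 + t ^+ m * cabs (b m) / cabs (q x))%:C%C.
  rewrite rmorphD rmorph1 mulrDr mulr1; congr (_ + _).
  rewrite /h exprMn zm /w !rmorphM /= -rmorphXn /=.
  have -> : b m * ((t ^+ m)%:C%C * (q x * ((cabs (q x))^-1)%:C%C * ((b m)^*%C * ((cabs (b m))^-1)%:C%C)))
    = (b m * (b m)^*%C) * (((cabs (b m))^-1)%:C%C * ((t ^+ m)%:C%C * (q x * ((cabs (q x))^-1)%:C%C))) by ring.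
  rewrite mul_conj mulrA -rmorphM /= expr2 mulfK ?gt_eqF//; ring.
move=> Hm.
have tm : 0 < t ^+ m by rewrite exprn_gt0.
have : cabs (q x) + t ^+ m * cabs (b m) <= cabs (q (x + h)) + B * (B * t) ^+ m.+1.
  have -> : cabs (q x) + t ^+ m * cabs (b m) =
      cabs (q x * (1 + t ^+ m * cabs (b m) / cabs (q x))%:C%C).
    rewrite cabsM cabs_real ger0_norm; last by rewrite addr_ge0// divr_ge0 ?mulr_ge0// ltW.
    by rewrite mulrDr mulr1 mulrCA mulfV ?mulr1// gt_eqF.
  move: Hm; rewrite cabs_distrC => Hm.
  have := ge_cabsB (q x * (1 + t ^+ m * cabs (b m) / cabs (q x))%:C%C) (q (x + h)); lra.
have -> : B * (B * t) ^+ m.+1 = t ^+ m * (D * t).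
  by rewrite exprMn [t ^+ m.+1]exprS /D; ring.
have : t ^+ m * (D * t) < t ^+ m * cabs (b m) by rewrite ltr_pM2l.
have := (xmax _ xh1).1; lra.
Unshelve. all: by end_near.
Qed.

(** Schwarz's lemma at order [j]: the maximum modulus principle for [f l / l^j], completed by [b j]
    at 0. *)
Lemma order_bound f b B j M : (forall l, cabs l <= 1 -> analytic_at f l) ->
  taylor_at f 0 b B -> (forall i, (i < j)%N -> b i = 0) ->
  (forall l, cabs l = 1 -> cabs (f l) <= M) ->
  cabs (b j) <= M /\ forall l, cabs l <= 1 -> cabs (f l) <= M * cabs l ^+ j.
Proof.
move=> Lf L0 bj fM.
pose q l := if l == 0 then b j else f l / l ^+ j.
have qM : forall l, cabs l <= 1 -> cabs (q l) <= M.
  apply: max_modulus.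
    move=> l l1; have [->|l0] := eqVneq l 0; first exact: (analytic_at_div0 L0 bj).
    have cl : 0 < cabs l by rewrite cabs_gt0.
    apply: (@analytic_at_congr _ (fun l => f l / l ^+ j) _ _ (cabs l)) => //.
      move=> h hl; rewrite /q; case: eqP => // lh0.
      have hE : h = - l by apply/eqP; rewrite -addr_eq0 addrC lh0.
      by rewrite hE cabsN ltxx in hl.
    exact: analytic_at_divXn (Lf _ l1).
  move=> l l1; rewrite /q; case: eqP => [l0|_].
    by move: l1; rewrite l0 cabs0 => /esym/eqP; rewrite oner_eq0.
  by rewrite cabsM cabsV cabsX l1 expr1n invr1 mulr1; exact: fM.
have M0 : 0 <= M := le_trans (cabs_ge0 _) (fM 1 cabs1).
split.
  by have := qM 0; rewrite cabs0 /q eqxx; apply; exact: ler01.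
move=> l l1; have [->|l0] := eqVneq l 0.
  have := taylor_at_val L0 => <-; case: j bj @q qM => [|j] bj q qM.
    by rewrite expr0 mulr1; have := qM 0; rewrite cabs0 /q eqxx; apply; exact: ler01.
  by rewrite bj// cabs0 exprS mul0r mulr0.
have := qM l l1; rewrite /q (negbTE l0) cabsM cabsV cabsX ler_pdivrMr//.
by rewrite exprn_gt0// cabs_gt0.
Qed.

Lemma expi_neq1 (t : R) : 0 < t < pi *+ 2 -> expi t != 1.
Proof.
move=> /andP[t0 t2]; apply/eqP => -[ct _].
have : 0 < sin (t / 2).
  apply: sin_gt0_pi; rewrite divr_gt0//= ltr_pdivrMr//.
  by rewrite mulr_natr.
have := cosD (t / 2) (t / 2); rewrite (_ : t / 2 + t / 2 = t); last by field.
rewrite ct; have := cos2Dsin2 (t / 2); move: (cos _) (sin _) => u v; nra.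
Qed.

(** A geometric sum over the powers of [exp (- i d th)], where [i] is the imaginary unit: a (j+1)-st
    root of unity, different from 1 because [0 < d <= j]. *)
Lemma sum_roots (j i : nat) : (i < j)%N ->
  let th : R := pi *+ 2 / j.+1%:R in
  \sum_(s < j.+1) expi (- (j%:R * th * s%:R)) * expi (th * s%:R) ^+ i = 0.
Proof.
move=> ij th; pose d := (j - i)%N; pose e : C := expi (- (d%:R * th)).
have N0 : (j.+1%:R : R) != 0 by rewrite pnatr_eq0.
have -> : \sum_(s < j.+1) expi (- (j%:R * th * s%:R)) * expi (th * s%:R) ^+ i =
    \sum_(s < j.+1) e ^+ s.
  apply: eq_bigr => s _; rewrite -!expi_natM -expiD; congr expi.
  by rewrite /d natrB ?(ltnW ij)//; ring.
have eN : e ^+ j.+1 = 1.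
  rewrite /e -expi_natM (_ : _ * _ = (- d%:Z)%:~R * (pi *+ 2)) ?expi_2pi//.
  by rewrite mulrNz /th -pmulrn; field.
have e1 : e != 1.
  have : expi (d%:R * th) != 1.
    have d0 : 0 < (d%:R : R) by rewrite ltr0n subn_gt0.
    have dj : (d%:R : R) < j.+1%:R by rewrite ltr_nat ltnS leq_subr.
    have p0 := @pi2_gt0 R.
    have j0 : 0 < (j.+1%:R : R) by rewrite ltr0n.
    apply: expi_neq1; apply/andP; split; first by rewrite mulr_gt0// divr_gt0.
    by rewrite /th mulrCA -[ltRHS]mulr1 ltr_pM2l// ltr_pdivrMr// mul1r.
  have eE : e = (expi (d%:R * th))^*%C by rewrite expi_conj.
  rewrite eE; apply: contra => /eqP h.
  by rewrite -[expi _]conjcK h; apply/eqP; exact: conjc1.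
have := subrX1 e j.+1; rewrite eN subrr => /esym/eqP; rewrite mulf_eq0 subr_eq0 (negbTE e1) /=.
by move=> /eqP.
Qed.

(* Averaging [g] over the rotations by the (j+1)-st roots of unity kills the
   coefficients of order less than [j] and keeps the one of order [j]. *)
Lemma coef_bound g b B : (forall l, cabs l <= 1 -> analytic_at g l) -> taylor_at g 0 b B ->
  (forall l, cabs l <= 1 -> cabs (g l) <= 1) -> forall j, cabs (b j) <= 1.
Proof.
move=> Lg L0 g1 j.
pose th : R := pi *+ 2 / j.+1%:R.
pose a (s : 'I_j.+1) : C := (j.+1%:R^-1)%:C%C * expi (- (j%:R * th * s%:R)).
pose w (s : 'I_j.+1) : C := expi (th * s%:R).
have w1 s : cabs (w s) = 1 by exact: cabs_expi.
pose f l := \sum_(s < j.+1) a s * g (w s * l).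
have ca s : cabs (a s) = j.+1%:R^-1.
  by rewrite cabsM cabs_expi mulr1 cabs_real ger0_norm// invr_ge0.
have Lf l : cabs l <= 1 -> analytic_at f l.
  move=> l1; apply: analytic_at_sum => s; apply: analytic_at_scale.
  have wl : cabs (w s * l) <= 1 by rewrite cabsM w1 mul1r.
  have [c [D LD]] := Lg _ wl.
  by exists (fun k => w s ^+ k * c k), D; exact: taylor_at_rot.
have [D L0f] : exists D, taylor_at f 0 (fun k => \sum_(s < j.+1) a s * (w s ^+ k * b k)) D.
  apply: taylor_at_sum0 => s; exists (B * (1 + cabs (a s))).
  by apply: taylor_at_scale; apply: taylor_at_rot => //; rewrite mulr0.
have [] := @order_bound f _ D j 1 Lf L0f.
- move=> i ij.
  have -> : \sum_(s < j.+1) a s * (w s ^+ i * b i) =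
     (j.+1%:R^-1)%:C%C * (\sum_(s < j.+1) expi (- (j%:R * th * s%:R)) * expi (th * s%:R) ^+ i) * b i.
    rewrite mulr_sumr mulr_suml; apply: eq_bigr => s _; rewrite /a /w; ring.
  by rewrite sum_roots// mulr0 mul0r.
- move=> l l1; rewrite (le_trans (le_cabs_sum _ _ _))//.
  apply: (@le_trans _ _ (\sum_(s < j.+1) (j.+1%:R^-1 : R))); last first.
    by rewrite sumr_const card_ord -[_ *+ _]mulr_natr mulVf// pnatr_eq0.
  apply: ler_sum => s _; rewrite cabsM ca -[leRHS]mulr1 ler_wpM2l ?invr_ge0//.
  by apply: g1; rewrite cabsM w1 l1 mul1r.
have -> : \sum_(s < j.+1) a s * (w s ^+ j * b j) = b j; last by [].
under eq_bigr => s _.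
  rewrite (_ : a s * (w s ^+ j * b j) = (j.+1%:R^-1)%:C%C * b j); last first.
    rewrite /a /w -expi_natM.
    have -> : (j.+1%:R^-1)%:C%C * expi (- (j%:R * th * s%:R)) * (expi (j%:R * (th * s%:R)) * b j) =
      (j.+1%:R^-1)%:C%C * (expi (- (j%:R * th * s%:R)) * expi (j%:R * (th * s%:R))) * b j by ring.
    by rewrite -expiD mulrA addNr expi0 mulr1.
  over.
rewrite sumr_const card_ord -mulrnAl -rmorphMn /= -[_ *+ _]mulr_natr mulVf ?pnatr_eq0//.
by rewrite mul1r.
Qed.

(** [order_bound] at order [K] for [g] minus its Taylor polynomial: on the unit circle this is at
    most [1 + K], one for [g] and one for each of the [K] coefficients. *)
Lemma taylor_remainder g b B : (forall l, cabs l <= 1 -> analytic_at g l) -> taylor_at g 0 b B ->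
  (forall l, cabs l <= 1 -> cabs (g l) <= 1) -> forall K l, cabs l <= 1 ->
  cabs (g l - \sum_(k < K) b k * l ^+ k) <= K.+1%:R * cabs l ^+ K.
Proof.
move=> Lg L0 g1 K l l1; have b1 := coef_bound Lg L0 g1.
pose f l := g l + \sum_(k < K) (- b k) * l ^+ k.
have fE x : f x = g x - \sum_(k < K) b k * x ^+ k.
  by rewrite /f -sumrN; congr (_ + _); apply: eq_bigr => k _; rewrite mulNr.
have [D LD] : exists D, taylor_at (fun l => \sum_(k < K) (- b k) * l ^+ k) 0
    (fun i => \sum_(k < K) (- b k) * (i == k)%:R) D.
  by apply: taylor_at_sum0 => k; exact: taylor_at_monomial0.
rewrite -fE; have [] := @order_bound f _ (B + D) K K.+1%:R _ (taylor_at_add L0 LD).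
- move=> x x1; apply: analytic_at_add; first exact: Lg.
  by apply: analytic_at_sum => k; exact: analytic_at_monomial.
- move=> i iK; rewrite (bigD1 (Ordinal iK))//= eqxx mulr1 big1 ?addr0 ?subrr//.
  move=> k ki; case: eqP => [ik|]; last by rewrite mulr0.
  by case/eqP: ki; apply/val_inj.
- move=> x x1; rewrite fE (le_trans (le_cabsB _ _))// -nat1r lerD ?g1 ?x1//.
  rewrite (le_trans (le_cabs_sum _ _ _))//.
  rewrite -[X in _ <= X]mulr1 mulr_natl -[X in _ *+ X](card_ord K) -sumr_const.
  by apply: ler_sum => k _; rewrite cabsM cabsX x1 expr1n mulr1.
by move=> _ /(_ l l1).
Qed.

End TaylorOnDisc.

(** * Polynomial approximation of Schur functions *)

Section Slices.
Context {R : realType} {n : nat}.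
Local Notation C := R[i].
Implicit Types (c z : n.-tuple C) (al : n.-tuple nat) (a : n.-tuple nat -> C).

Definition mdeg al : nat := (\sum_(i < n) tnth al i)%N.

Definition cscale (l : C) z : n.-tuple C := [tuple l * tnth z i | i < n].

Lemma mono_scale (l : C) z al : mono (cscale l z) al = l ^+ mdeg al * mono z al.
Proof.
rewrite /mono /mdeg -prodrXr -big_split /=; apply: eq_bigr => i _.
by rewrite tnth_mktuple exprMn.
Qed.

(** The homogeneous part of degree [k]. Every multi-index of that degree lies in the box of side
    [k.+1], so larger boxes give the same sum. *)
Definition hpoly a (k : nat) z : C :=
  \sum_(al : {ffun 'I_n -> 'I_k.+1} | mdeg (midx al) == k) a (midx al) * mono z (midx al).

Lemma sum_box_deg (N k : nat) (F : n.-tuple nat -> C) : (k < N)%N ->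
  \sum_(al : {ffun 'I_n -> 'I_N} | mdeg (midx al) == k) F (midx al) =
  \sum_(al : {ffun 'I_n -> 'I_k.+1} | mdeg (midx al) == k) F (midx al).
Proof.
move=> kN.
pose w (al : {ffun 'I_n -> 'I_k.+1}) : {ffun 'I_n -> 'I_N} :=
  [ffun i => widen_ord kN (al i)].
pose v (be : {ffun 'I_n -> 'I_N}) : {ffun 'I_n -> 'I_k.+1} := [ffun i => inord (be i)].
have wE (be : {ffun 'I_n -> 'I_k.+1}) : midx (w be) = midx be.
  by apply: eq_from_tnth => i; rewrite !tnth_mktuple ffunE.
rewrite (reindex_onto w v) /=; last first.
  move=> be /eqP bk; apply/ffunP => i; rewrite !ffunE; apply/val_inj => /=.
  rewrite inordK// ltnS -bk /mdeg (bigD1 i)//= tnth_mktuple; exact: leq_addr.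
apply: eq_big => [al|al _]; last by rewrite wE.
rewrite wE; case: eqP => //= _.
by apply/eqP/ffunP => i; rewrite !ffunE /=; apply/val_inj; rewrite /= inordK.
Qed.

Lemma sum_box_deg_lt (N K : nat) (F : n.-tuple nat -> C) : (K <= N)%N ->
  \sum_(al : {ffun 'I_n -> 'I_N} | (mdeg (midx al) < K)%N) F (midx al) =
  \sum_(k < K) \sum_(al : {ffun 'I_n -> 'I_k.+1} | mdeg (midx al) == k) F (midx al).
Proof.
move=> KN.
transitivity (\sum_(k < K) \sum_(al : {ffun 'I_n -> 'I_N} | mdeg (midx al) == k) F (midx al)); last first.
  by apply: eq_bigr => k _; rewrite sum_box_deg// (leq_trans _ KN).
under [RHS]eq_bigr do rewrite big_mkcond /=.
rewrite exchange_big /= big_mkcond; apply: eq_bigr => al _.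
case: ltnP => dK.
  rewrite (bigD1 (Ordinal dK))//= eqxx big1 ?addr0// => k kd.
  by case: eqP => // dk; case/eqP: kd; apply/val_inj.
by rewrite big1// => k _; case: eqP => // dk; move: dK; rewrite dk leqNgt ltn_ord.
Qed.

(** The box sums that define convergence are regrouped by degree. Passing from [h0] to [h]
    multiplies the modulus of a term of degree [d] by [(|h| / h0)^d], so absolute convergence at
    [h0] bounds everything of degree at least [K] by [M (|h| / h0)^K]. *)
Lemma slice_taylor_at (phi : n.-tuple C -> C) a z (l0 : C) (h0 M : R) : 0 < h0 ->
  (forall N, pabssum a (cscale l0 z) (cscale (l0 + h0%:C%C) z) N <= M) ->
  (forall h, cabs h <= h0 ->
     ccvg (psum a (cscale l0 z) (cscale (l0 + h) z)) (phi (cscale (l0 + h) z))) ->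
  exists B, taylor_at (fun l => phi (cscale l z)) l0 (fun k => hpoly a k z) B.
Proof.
move=> h00 pM pc.
have M0 : 0 <= M by apply: le_trans (pM 0%N); apply: sumr_ge0 => al _; exact: cabs_ge0.
have i0 : 0 < h0^-1 by rewrite invr_gt0.
have dz h : [tuple tnth (cscale (l0 + h) z) i - tnth (cscale l0 z) i | i < n] = cscale h z.
  by apply: eq_from_tnth => i; rewrite !tnth_mktuple; ring.
exists (h0^-1 + M); split=> [|K h hB]; first by lra.
have ch0 := cabs_ge0 h.
have hh0 : cabs h <= h0.
  have : h0^-1 * cabs h <= 1 by apply: le_trans hB; rewrite ler_wpM2r//; lra.
  by rewrite mulrC ler_pdivrMr// mul1r.
pose t := cabs h / h0.
have t0 : 0 <= t by rewrite divr_ge0// ltW.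
have t1 : t <= 1 by rewrite ler_pdivrMr// mul1r.
apply: (@le_trans _ _ (M * t ^+ K)); last first.
  have Bp : 0 <= h0^-1 + M by lra.
  rewrite ler_pM ?exprn_ge0//; first by lra.
  rewrite lerXn2r ?nnegrE ?t0 ?mulr_ge0//.
  by rewrite /t mulrC ler_wpM2r//; lra.
apply: (ccvg_dist_le (pc h hh0)).
near=> N.
have KN : (K <= N)%N by near: N; exact: nbhs_infty_ge.
have -> : \sum_(k < K) hpoly a k z * h ^+ k =
    \sum_(al : {ffun 'I_n -> 'I_N} | (mdeg (midx al) < K)%N)
       (a (midx al) * mono (cscale h z) (midx al)).
  rewrite (sum_box_deg_lt (fun al => a al * mono (cscale h z) al))//.
  apply: eq_bigr => k _; rewrite /hpoly mulr_suml; apply: eq_bigr => al /eqP dk.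
  by rewrite mono_scale dk; ring.
rewrite /psum dz (bigID (fun al : {ffun 'I_n -> 'I_N} => (mdeg (midx al) < K)%N))/=.
rewrite addrAC subrr add0r (le_trans (le_cabs_sum _ _ _))//.
apply: (@le_trans _ _ (pabssum a (cscale l0 z) (cscale (l0 + h0%:C%C) z) N * t ^+ K)); last first.
  by rewrite ler_wpM2r ?exprn_ge0.
rewrite /pabssum dz mulr_suml [leRHS](bigID (fun al : {ffun 'I_n -> 'I_N} => ~~ (mdeg (midx al) < K)%N))/=.
rewrite -[leLHS]addr0 lerD//; last first.
  by apply: sumr_ge0 => al _; rewrite mulr_ge0 ?cabs_ge0// exprn_ge0.
apply: ler_sum => al; rewrite -leqNgt => Kd.
rewrite !mono_scale !cabsM !cabsX cabs_real (ger0_norm (ltW h00)).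
have -> : cabs h = h0 * t by rewrite /t mulrCA mulfV ?mulr1// gt_eqF.
rewrite exprMn.
have tt : t ^+ mdeg (midx al) <= t ^+ K.
  by apply: ler_wiXn2l => //; rewrite t0.
set u := cabs (a _); set v := cabs (mono _ _); set y := h0 ^+ _.
have : u * y * v * t ^+ mdeg (midx al) <= u * y * v * t ^+ K.
  by rewrite ler_wpM2l// !mulr_ge0 ?cabs_ge0 ?exprn_ge0// ltW.
lra.
Unshelve. all: by end_near.
Qed.

Lemma in_disc_scale (l : C) z : cabs l <= 1 -> in_disc z -> in_disc (cscale l z).
Proof.
move=> l1 zd i; rewrite tnth_mktuple cabsM; have := zd i; have := cabs_ge0 (tnth z i).
have := cabs_ge0 l; nra.
Qed.

Lemma holomorphic_slice (phi : n.-tuple C -> C) z (l0 : C) :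
  holomorphic_polydisc phi -> in_disc z -> cabs l0 <= 1 -> analytic_at (fun l => phi (cscale l z)) l0.
Proof.
move=> hol zd l1; have [q /andP[q0 q1] zq] := in_disc_bound zd.
have [r r0 [a ha]] := hol _ (in_disc_scale l1 zd).
(* [1 - q] keeps the slice in the polydisc: [(|l0| + 1 - q) q <= (2 - q) q < 1]. *)
pose h0 := Num.min r (1 - q).
have h00 : 0 < h0 by rewrite lt_min r0 subr_gt0.
have h0r : h0 <= r by rewrite ge_min lexx.
have h0q : h0 <= 1 - q by rewrite ge_min lexx orbT.
have H h : cabs h <= h0 -> (exists M, forall N, pabssum a (cscale l0 z) (cscale (l0 + h) z) N <= M) /\
    ccvg (psum a (cscale l0 z) (cscale (l0 + h) z)) (phi (cscale (l0 + h) z)).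
  move=> hh; apply: ha => i; rewrite !tnth_mktuple.
    rewrite cabsM; have := zq i; have := cabs_ge0 (tnth z i); have := le_cabsD l0 h; have := cabs_ge0 (l0 + h).
    by move: (cabs _) (cabs _) (cabs _) l1 hh (cabs _) => *; nra.
  rewrite -mulrBl addrAC subrr add0r cabsM.
  have := zq i; have := cabs_ge0 (tnth z i); have := cabs_ge0 h.
  by move: (cabs _) (cabs _) hh => *; nra.
have [|[M HM] _] := H h0%:C%C; first by rewrite cabs_real ger0_norm// ltW.
have [B LB] := @slice_taylor_at phi a z l0 h0 M h00 HM (fun h hh => (H h hh).2).
by exists (fun k => hpoly a k z), B.
Qed.

(** A single family [a], the expansion of [phi] at the origin, provides the Taylor coefficients of
    all slices; hence an estimate uniform in [z]. *)
Lemma schur_taylor (phi : n.-tuple C -> C) : schur_class phi -> exists a, forall K z (l : C),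
  in_disc z -> cabs l <= 1 ->
  cabs (phi (cscale l z) - \sum_(k < K) hpoly a k z * l ^+ k) <= K.+1%:R * cabs l ^+ K.
Proof.
move=> [hol phi1].
have d0 : in_disc [tuple (0 : C) | i < n] by move=> i; rewrite tnth_mktuple cabs0.
have [r r0 [a ha]] := hol _ d0.
exists a => K z l zd l1.
pose h0 := Num.min r 1.
have h00 : 0 < h0 by rewrite lt_min r0 ltr01.
have h0r : h0 <= r by rewrite ge_min lexx.
have h01 : h0 <= 1 by rewrite ge_min lexx orbT.
have c0 : cscale 0 z = [tuple (0 : C) | i < n].
  by apply: eq_from_tnth => i; rewrite !tnth_mktuple mul0r.
have H h : cabs h <= h0 -> (exists M, forall N, pabssum a (cscale 0 z) (cscale (0 + h) z) N <= M) /\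
    ccvg (psum a (cscale 0 z) (cscale (0 + h) z)) (phi (cscale (0 + h) z)).
  move=> hh; rewrite c0 add0r; apply: ha; first by apply: in_disc_scale => //; lra.
  move=> i; rewrite !tnth_mktuple subr0 cabsM.
  have := zd i; have := cabs_ge0 (tnth z i); have := cabs_ge0 h.
  by move: (cabs _) (cabs _) hh => *; nra.
have [|[M HM] _] := H h0%:C%C; first by rewrite cabs_real ger0_norm// ltW.
have [B LB] := @slice_taylor_at phi a z 0 h0 M h00 HM (fun h hh => (H h hh).2).
apply: (taylor_remainder (g := fun l => phi (cscale l z)) _ LB) => // x x1.
  exact: holomorphic_slice.
by apply: phi1; exact: in_disc_scale.
Qed.

(** With [t = sqrt s], the product [(K+1) t^K] is at most a geometric sum, hence bounded, and a
    second factor [t^K] tends to 0. *)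
Lemma cvg_nat_mul_expr (s : R) : 0 <= s < 1 ->
  (fun K => K.+1%:R * s ^+ K) @ \oo --> (0 : R).
Proof.
move=> /andP[s0 s1]; pose t := Num.sqrt s.
have t0 : 0 <= t := sqrtr_ge0 s.
have t1 : t < 1 by rewrite -sqrtr1 ltr_sqrt.
have tt : s = t * t by rewrite -expr2 sqr_sqrtr.
have bd K : K.+1%:R * t ^+ K <= (1 - t)^-1.
  apply: (@le_trans _ _ (\sum_(j < K.+1) t ^+ j)).
    rewrite mulr_natl -[X in _ *+ X](card_ord K.+1) -sumr_const; apply: ler_sum => j _.
    by apply: ler_wiXn2l; rewrite ?t0 ?(ltW t1)// -ltnS.
  have := subrX1 t K.+1; have : 0 <= t ^+ K.+1 by rewrite exprn_ge0.
  move: (\sum_(_ < _) _) (_ ^+ _) => a b b0 e.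
  by rewrite -[leRHS]mul1r ler_pdivlMr; lra.
have cv : (fun K => (1 - t)^-1 * t ^+ K) @ \oo --> (0 : R).
  rewrite -[X in _ --> X](mulr0 (1 - t)^-1); apply: cvgMr.
  by apply: cvg_expr; rewrite ger0_norm.
apply: squeeze_cvgr (cvg_cst 0) cv; near=> K.
rewrite mulr_ge0 ?exprn_ge0//= tt exprMn mulrA ler_wpM2r ?exprn_ge0//.
Unshelve. all: by end_near.
Qed.

(** The square comes from two shrinkings by [s]: one moves the closed polydisc into the open one,
    the other is the slice parameter, at which the Taylor remainder is at most [(K+1) s^K]. *)
Lemma schur_poly_approx (phi : n.-tuple C -> C) (s e : R) : schur_class phi ->
  0 <= s < 1 -> 0 < e -> exists K (cf : n.-tuple nat -> C), forall z,
  (forall i, cabs (tnth z i) <= 1) ->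
  cabs (phi (cscale (s ^+ 2)%:C%C z) -
    \sum_(al : {ffun 'I_n -> 'I_K}) cf (midx al) * mono z (midx al)) <= e.
Proof.
move=> Sphi s01 e0; have /andP[s0 s1] := s01.
have [a Ha] := schur_taylor Sphi.
have /cvgr0_norm_le/(_ _ e0) := cvg_nat_mul_expr s01.
move=> /filter_ex [K]; rewrite ger0_norm; last by rewrite mulr_ge0 ?exprn_ge0.
move=> Ke.
exists K, (fun al => if (mdeg al < K)%N then a al * (s%:C%C ^+ mdeg al * s%:C%C ^+ mdeg al) else 0) => z z1.
have zd : in_disc (cscale s%:C%C z).
  move=> i; rewrite tnth_mktuple cabsM cabs_real ger0_norm//.
  have := z1 i; have := cabs_ge0 (tnth z i); nra.
have sl : cabs s%:C%C <= 1 by rewrite cabs_real ger0_norm// ltW.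
have := Ha K _ _ zd sl.
have -> : cscale s%:C%C (cscale s%:C%C z) = cscale (s ^+ 2)%:C%C z.
  by apply: eq_from_tnth => i; rewrite !tnth_mktuple mulrA -rmorphM.
rewrite cabs_real (ger0_norm s0) => /le_trans/(_ Ke).
congr (cabs (_ - _) <= _).
under [RHS]eq_bigr do rewrite (fun_if (fun u => u * _)) mul0r.
rewrite -big_mkcond /=.
rewrite (sum_box_deg_lt (fun al => a al * (s%:C%C ^+ mdeg al * s%:C%C ^+ mdeg al) * mono z al))//.
apply: eq_bigr => k _; rewrite /hpoly mulr_suml; apply: eq_bigr => al /eqP dk.
by rewrite mono_scale dk; ring.
Qed.

End Slices.

(** * Hardy space and interpolation *)

Section HardySpace.
Context {R : realType} {n : nat}.
Local Notation C := R[i].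
Local Notation T := (n.-tuple R).
Implicit Types (f g h : T -> C) (z : n.-tuple C) (k : n.-tuple int).

Definition cbounded f := cmeasurable f /\ exists B : R, forall x, cabs (f x) <= B.

Lemma cbounded_cL1 f : cbounded f -> cL1 f.
Proof. by move=> [mf [B fB]]; have [] := L1norm_bound mf fB. Qed.

Lemma cbounded_L2 f : cbounded f -> L2 f.
Proof. by move=> [mf [B fB]]; exact: L2_bound fB. Qed.

Lemma cL1_mulb f g : cbounded f -> cL1 g -> cL1 (fun x => f x * g x).
Proof. by move=> [mf [B fB]] lg; have [] := cL1_mul_bound mf fB lg. Qed.

Lemma cbounded_torchar (k : 'I_n -> int) : cbounded (@torchar R _ k).
Proof.
split; first exact: cmeasurable_torchar.
by exists 1 => x; rewrite cabs_torchar.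
Qed.

Lemma cbounded_lin (c : C) f g : cbounded f -> cbounded g -> cbounded (fun x => c * f x + g x).
Proof.
move=> [mf [B fB]] [mg [D gD]]; split.
  by apply: cmeasurableD => //; exact: cmeasurableZ.
exists (cabs c * B + D) => x; rewrite (le_trans (le_cabsD _ _))// lerD// cabsM.
by rewrite ler_wpM2l ?cabs_ge0.
Qed.

Lemma cbounded_cst (c : C) : cbounded (fun=> c).
Proof. by split; [exact: cmeasurable_cst|exists (cabs c)]. Qed.

Lemma cbounded_conj f : cbounded f -> cbounded (fun x => (f x)^*%C).
Proof.
move=> [mf [B fB]]; split; first exact: cmeasurable_conj.
by exists B => x; rewrite cabs_conj.
Qed.

Lemma cbounded_sum I (s : seq I) (F : I -> T -> C) : (forall i, cbounded (F i)) ->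
  cbounded (fun x => \sum_(i <- s) F i x).
Proof.
move=> H; elim: s => [|i s IH].
  by under eq_fun do rewrite big_nil; exact: cbounded_cst.
under eq_fun do rewrite big_cons -[F i _]mul1r.
exact: cbounded_lin.
Qed.

Lemma cbounded_ckern z : in_disc z -> cbounded (ckern z).
Proof.
move=> /in_disc_bound[q /andP[q0 q1] zq]; split; first exact: cmeasurable_ckern.
by exists ((1 - q) ^- n) => x; exact: ckern_bound.
Qed.

Lemma cbounded_kern z : in_disc z -> cbounded (kern z).
Proof.
move=> zd; rewrite (_ : kern z = fun x => (ckern z x)^*%C).
  by apply: cbounded_conj; exact: cbounded_ckern.
by apply/funext => x; rewrite kernE.
Qed.

Lemma cbounded_bfunc f : cbounded f ->
  exists2 B : R, 0 <= B & bounded_functional B (fun h => cint (fun x => f x * h x)).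
Proof.
move=> [mf [B fB]]; exists B; last exact: bounded_functional_cint_mul.
exact: le_trans (cabs_ge0 _) (fB [tuple 0 | i < n]).
Qed.

Lemma torcharD (k j : 'I_n -> int) (x : T) :
  torchar (fun i => k i + j i) x = torchar k x * torchar j x.
Proof.
rewrite /torchar -expiD -big_split /=; congr expi; apply: eq_bigr => i _.
by rewrite intrD mulrDl.
Qed.

Lemma torchar_conj (k : 'I_n -> int) (x : T) : (torchar k x)^*%C = torchar (fun i => - k i) x.
Proof.
rewrite /torchar expi_conj -sumrN; congr expi; apply: eq_bigr => i _.
by rewrite mulrNz mulNr.
Qed.

Lemma fcoefE f k : fcoef f k = cint (fun x => f x * torchar (fun i => - tnth k i) x).
Proof.
congr cint; apply/funext => x; congr (_ * expi _).
by rewrite -sumrN; apply: eq_bigr => i _; rewrite mulrNz mulNr.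
Qed.

Lemma ip_kern f z : ip f (kern z) = cint (fun x => f x * ckern z x).
Proof. by congr cint; apply/funext => x; rewrite conj_kern. Qed.

(** Reproducing property: [kernel_expansion0], for integration against [f], produces exactly the
    series that defines [h2val]. *)
Lemma h2val_ip f z : cbounded f -> in_disc z -> h2val f z (ip f (kern z)).
Proof.
move=> bf /in_disc_bound[q q01 zq]; have [B B0 bL] := cbounded_bfunc bf.
rewrite ip_kern; have := kernel_expansion0 B0 bL q01 zq.
congr ccvg; apply/funext => K; apply: eq_bigr => al _; rewrite fcoefE; congr (cint _ * _).
apply/funext => x; congr (_ * torchar _ _); apply/funext => i.
by rewrite !tnth_mktuple.
Qed.

Lemma h2val_unique f z v v' : h2val f z v -> h2val f z v' -> v = v'.
Proof. exact: ccvg_unique. Qed.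

(** Only the constant term survives at the origin, so the condition in [H2_0] is the vanishing of
    the zeroth Fourier coefficient. *)
Lemma h2val_origin f : h2val f [tuple (0 : C) | i < n] (fcoef f [tuple 0 | i < n]).
Proof.
apply: ccvg_near; near=> N.
have N0 : (0 < N)%N by near: N; exact: nbhs_infty_gt.
rewrite -(prednK N0) (bigD1 [ffun=> ord0])//= big1 ?addr0.
  rewrite /mono big1 ?mulr1; last by move=> i _; rewrite !tnth_mktuple ffunE expr0.
  by congr fcoef; apply: eq_from_tnth => i; rewrite !tnth_mktuple ffunE.
move=> al al0; have [i ai] : exists i, al i != ord0.
  apply/existsP; rewrite -negb_forall; apply: contra al0 => /forallP h.
  by apply/eqP/ffunP => i; rewrite ffunE; apply/eqP.
rewrite /mono (bigD1 i)//= !tnth_mktuple expr0n.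
by rewrite -(inj_eq val_inj) /= in ai; rewrite (negbTE ai) mul0r mulr0.
Unshelve. all: by end_near.
Qed.

Lemma h2val0 f v : h2val f [tuple (0 : C) | i < n] v -> fcoef f [tuple 0 | i < n] = v.
Proof. exact: h2val_unique (h2val_origin f). Qed.

(** By uniqueness of limits: the series of [h2val_ip] for a character reduces to one term as soon as
    the box contains [al]. *)
Lemma cint_torchar_ckern K (al : {ffun 'I_n -> 'I_K}) z : in_disc z ->
  cint (fun x => torchar (fun i => (al i)%:Z) x * ckern z x) = mono z (midx al).
Proof.
move=> zd.
rewrite -ip_kern; apply: (h2val_unique (h2val_ip (cbounded_torchar _) zd)).
apply: ccvg_near; near=> N.
have KN : (K <= N)%N by near: N; exact: nbhs_infty_ge.
pose be : {ffun 'I_n -> 'I_N} := [ffun i => widen_ord KN (al i)].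
rewrite (bigD1 be)//= big1 ?addr0.
  rewrite fcoefE (_ : (fun x => _) = torchar (fun=> 0)).
    rewrite cint_torchar (_ : [forall i, _]) ?mul1r; last by apply/forallP.
    by apply: eq_bigr => i _; rewrite !tnth_mktuple ffunE.
  apply/funext => x; rewrite -torcharD; congr (torchar _ x); apply/funext => i.
  by rewrite !tnth_mktuple ffunE subrr.
move=> ga gb; rewrite fcoefE; under eq_fun do rewrite -torcharD.
rewrite cint_torchar; case: forallP => [h|_]; last by rewrite mul0r.
case/eqP: gb; apply/ffunP => i; rewrite ffunE; apply/val_inj => /=.
by have := h i; rewrite !tnth_mktuple subr_eq0 => /eqP[].
Unshelve. all: by end_near.
Qed.

Lemma mono_tor (x : T) (al : n.-tuple nat) : mono (tor x) al = torchar (fun i => (tnth al i)%:Z) x.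
Proof.
rewrite /mono /torchar expi_sum; apply: eq_bigr => i _.
by rewrite tnth_map -pmulrn expi_natM.
Qed.

Lemma L2_mul_cL1 f g : L2 f -> L2 g -> cL1 (fun x => f x * g x).
Proof.
have i2 h : L2 h -> (tmeas n).-integrable setT (EFin \o (fun x => cabs (h x) ^+ 2)).
  move=> [mh h2].
  have m2 : measurable_fun setT (EFin \o (fun x => cabs (h x) ^+ 2)).
    by apply/measurable_EFinP; apply: measurable_funX; exact: measurable_cabs.
  apply/integrableP; split=> //.
  under eq_integral do rewrite /= ger0_norm ?sqr_ge0//.
  by rewrite -ge0_tintE// => x; rewrite lee_fin sqr_ge0.
move=> Lf Lg; apply/cL1_cabs; split; first by apply: cmeasurableM; [case: Lf|case: Lg].
apply: le_integrable (integrableD measurableT (i2 _ Lf) (i2 _ Lg)) => //.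
  by apply/measurable_EFinP; apply: measurable_cabs; apply: cmeasurableM; [case: Lf|case: Lg].
move=> x _ /=; rewrite lee_fin ger0_norm ?cabs_ge0// cabsM.
rewrite ger0_norm ?addr_ge0 ?sqr_ge0//.
by have := cabs_ge0 (f x); have := cabs_ge0 (g x); nra.
Qed.

Lemma L2_conj f : L2 f -> L2 (fun x => (f x)^*%C).
Proof.
move=> [mf f2]; split; first exact: cmeasurable_conj.
by rewrite /norm2sq; under eq_fun do rewrite cabs_conj.
Qed.

Lemma fcoef_lin (c : C) f g k : cL1 f -> cL1 g ->
  fcoef (fun x => c * f x + g x) k = c * fcoef f k + fcoef g k.
Proof.
move=> lf lg; rewrite !fcoefE.
have lE h : cL1 h -> cL1 (fun x => h x * torchar (fun i => - tnth k i) x).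
  by move=> lh; under eq_fun do rewrite mulrC; apply: cL1_mulb => //; exact: cbounded_torchar.
rewrite -cintZ; last exact: lE.
rewrite -cintD; [|by apply: cL1Z; exact: lE|exact: lE].
by congr cint; apply/funext => x; ring.
Qed.

Lemma H2_lin (c : C) f g : H2 f -> H2 g -> H2 (fun x => c * f x + g x).
Proof.
move=> [Lf Hf] [Lg Hg]; split; first exact: L2_lin.
by move=> k kn; rewrite fcoef_lin ?Hf ?Hg ?mulr0 ?addr0//; exact: L2_cL1.
Qed.

Lemma H2_0_lin (c : C) f g : H2_0 f -> H2_0 g -> H2_0 (fun x => c * f x + g x).
Proof.
move=> [Hf f0] [Hg g0]; split; first exact: H2_lin.
have := h2val_origin (fun x => c * f x + g x).
rewrite fcoef_lin ?(h2val0 f0) ?(h2val0 g0) ?mulr0 ?addr0//; apply: L2_cL1; [by case: Hf|by case: Hg].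
Qed.

Lemma Mn_lin (c : C) f g : Mn f -> Mn g -> Mn (fun x => c * f x + g x).
Proof.
move=> [Lf Hf] [Lg Hg]; split; first exact: L2_lin.
move=> h1 h2 H1 H2'; have := Hf _ _ H1 H2'; have := Hg _ _ H1 H2'; rewrite /ip => g0 f0.
have Lh : L2 (fun x => ((h1 x)^*%C + h2 x)^*%C).
  apply: L2_conj; have := @L2_lin _ _ 1 _ _ (L2_conj H1.1) H2'.1.
  by under eq_fun do rewrite mul1r.
transitivity (c * cint (fun x => f x * ((h1 x)^*%C + h2 x)^*%C) +
    cint (fun x => g x * ((h1 x)^*%C + h2 x)^*%C)); last by rewrite f0 g0 mulr0 addr0.
rewrite -cintZ; last exact: L2_mul_cL1.
rewrite -cintD; [|by apply: cL1Z; exact: L2_mul_cL1|exact: L2_mul_cL1].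
by congr cint; apply/funext => x; ring.
Qed.

Lemma H2_torchar (k : 'I_n -> int) : (forall i, 0 <= k i) -> H2 (@torchar R _ k).
Proof.
move=> k0; split; first by apply: cbounded_L2; exact: cbounded_torchar.
move=> j [i ji]; rewrite fcoefE; under eq_fun do rewrite -torcharD.
rewrite cint_torchar; case: forallP => // /(_ i) /eqP h.
by move/eqP: h; rewrite subr_eq0 => /eqP h; have := k0 i; rewrite h leNgt ji.
Qed.

Lemma H2_zero : H2 (fun _ : T => 0 : C).
Proof.
split; first by apply: cbounded_L2; exact: cbounded_cst.
move=> k _; rewrite fcoefE; under eq_fun do rewrite -[0](mul0r 0) -mulrA.
by rewrite cintZ ?mul0r//; under eq_fun do rewrite mul0r; exact: cL1_cst.
Qed.

Lemma cL1_H2 f : H2 f -> cL1 f.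
Proof. by move=> [/L2_cL1]. Qed.

Lemma Mn_mono (b : T -> C) (k : 'I_n -> int) : Mn b -> (forall i, 0 <= k i) ->
  cint (fun x => torchar k x * b x) = 0.
Proof.
move=> [_ Hb] k0; rewrite -(Hb _ _ (H2_torchar k0) H2_zero).
by congr cint; apply/funext => x; rewrite addr0 conjcK mulrC.
Qed.

(** The integral is the Fourier coefficient of [c] at [- k]: it vanishes by [H2] if [k] has a
    positive entry, and by the value at the origin if [k = 0]. *)
Lemma H2_0_mono (c : T -> C) (k : 'I_n -> int) : H2_0 c -> (forall i, 0 <= k i) ->
  cint (fun x => torchar k x * c x) = 0.
Proof.
move=> [[_ Hc] c0] k0.
have E : cint (fun x => torchar k x * c x) = fcoef c [tuple - k i | i < n].
  rewrite fcoefE; congr cint; apply/funext => x; rewrite mulrC; congr (_ * torchar _ x).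
  by apply/funext => i; rewrite tnth_mktuple opprK.
have [[i ki]|h] := pselect (exists i, 0 < k i).
  by rewrite E Hc//; exists i; rewrite tnth_mktuple oppr_lt0.
rewrite E -(h2val0 c0); congr fcoef; apply: eq_from_tnth => i; rewrite !tnth_mktuple.
have := k0 i; rewrite le_eqVlt => /orP[/eqP <-|ki]; first by rewrite oppr0.
by case: h; exists i.
Qed.

Lemma Mn_torchar (k : 'I_n -> int) : (exists i, 0 < k i) -> (exists i, k i < 0) ->
  Mn (@torchar R _ k).
Proof.
move=> [i ki] [j kj]; split; first by apply: cbounded_L2; exact: cbounded_torchar.
move=> h1 h2 H1 H2'.
have l1 := cL1_mulb (cbounded_torchar k) (cL1_H2 H1).
have l2 := cL1_mulb (cbounded_torchar (fun i => - k i)) (cL1_H2 H2').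
rewrite /ip (_ : (fun x => _) = fun x => torchar k x * h1 x +
    (torchar (fun i => - k i) x * h2 x)^*%C); last first.
  apply/funext => x; rewrite rmorphD /= conjcK mulrDr; congr (_ + _).
  rewrite rmorphM; congr (_ * _); rewrite -[LHS]conjcK torchar_conj.
  by [].
rewrite cintD//; last exact: cL1_conj.
rewrite cint_conj//.
have -> : cint (fun x => torchar k x * h1 x) = fcoef h1 [tuple - k i | i < n].
  rewrite fcoefE; congr cint; apply/funext => x; rewrite mulrC; congr (_ * torchar _ x).
  by apply/funext => a; rewrite tnth_mktuple opprK.
have -> : cint (fun x => torchar (fun i => - k i) x * h2 x) = fcoef h2 [tuple k i | i < n].
  rewrite fcoefE; congr cint; apply/funext => x; rewrite mulrC; congr (_ * torchar _ x).
  by apply/funext => a; rewrite tnth_mktuple.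
rewrite H1.2; last by exists i; rewrite tnth_mktuple oppr_lt0.
by rewrite H2'.2 ?conjc0 ?addr0//; exists j; rewrite tnth_mktuple.
Qed.

Lemma H2_0_torchar (k : 'I_n -> int) : (exists i, 0 < k i) -> (forall i, 0 <= k i) ->
  H2_0 (@torchar R _ k).
Proof.
move=> [i ki] k0; split; first exact: H2_torchar.
have d0 : in_disc [tuple (0 : C) | i < n] by move=> j; rewrite tnth_mktuple cabs0.
have := h2val_ip (cbounded_torchar k) d0; congr h2val.
rewrite ip_kern (_ : (fun x => _) = torchar k).
  rewrite cint_torchar; case: forallP => // /(_ i) /eqP k00.
  by rewrite k00 in ki.
apply/funext => x; rewrite /ckern big1 ?mulr1// => j _.
by rewrite tnth_mktuple mul0r subr0 invr1.
Qed.

End HardySpace.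

(** * Interpolation nodes, [QZ] and [Mtilde] *)

Section Interpolation.
Context {R : realType} {n m : nat}.
Local Notation C := R[i].
Local Notation T := (n.-tuple R).
Variable Z : 'I_m -> n.-tuple C.
Hypothesis Zd : forall j, in_disc (Z j).
Implicit Types (f g h q : T -> C).

(* Pair F with the polynomials approximating the dilates z |-> phi (s^2 z), s -> 1. *)
Lemma schur_pairing (phi : n.-tuple C -> C) (F : T -> C) (w : 'I_m -> C) :
  schur_class phi -> cL1 F ->
  (forall K (al : {ffun 'I_n -> 'I_K}),
     cint (fun x => torchar (fun i => (al i)%:Z) x * F x) =
     \sum_j w j * mono (Z j) (midx al)) ->
  cabs (\sum_j w j * phi (Z j)) <= L1norm F.
Proof.
move=> Sphi lF Fal; have [hol phi1] := Sphi.
pose S := \sum_j cabs (w j).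
have S0 : 0 <= S by apply: sumr_ge0 => j _; exact: cabs_ge0.
(* An approximating polynomial is at most [1 + e] on the torus and within [2 e] of [phi] at the
   nodes: [e] for the dilation, [e] for the approximation. *)
have main e : 0 < e -> cabs (\sum_j w j * phi (Z j)) <= L1norm F + e * (L1norm F + 2 * S).
  move=> e0.
  have sc1 z : cscale 1 z = z :> n.-tuple C.
    by apply: eq_from_tnth => i; rewrite tnth_mktuple mul1r.
  have ex j : exists d : R, 0 < d /\ forall l, cabs (l - 1) < d ->
      cabs (phi (cscale l (Z j)) - phi (Z j)) <= e.
    have l1 : cabs (1 : C) <= 1 by rewrite cabs1.
    have [d d0 hd] := analytic_at_cont (holomorphic_slice hol (Zd j) l1) e0.
    by exists d; split=> // l ld; have := hd l ld; rewrite sc1.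
  have [d dP] := choice ex.
  pose D := \big[Num.min/1]_j d j.
  have D0 : 0 < D by apply: lt_bigmin => // j _; case: (dP j).
  have Dd j : D <= d j by exact: bigmin_le_cond.
  have D1 : D <= 1 by exact: bigmin_le_id.
  (* [1 - s^2 <= 2 (1 - s) = D / 2], and [D <= 1] keeps [s] positive. *)
  pose s : R := 1 - D / 4.
  have s01 : 0 <= s < 1 by rewrite /s; apply/andP; split; lra.
  have /andP[s0 s1] := s01.
  have sD : cabs ((s ^+ 2)%:C%C - 1) < D.
    rewrite -(rmorph1 (real_complex R)) -rmorphB cabs_real ler0_norm; rewrite /s; nra.
  have [K [cf Hcf]] := schur_poly_approx Sphi s01 e0.
  pose P z := \sum_(al : {ffun 'I_n -> 'I_K}) cf (midx al) * mono z (midx al).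
  have PZ j : cabs (P (Z j) - phi (Z j)) <= 2 * e.
    have h1 : cabs (phi (cscale (s ^+ 2)%:C%C (Z j)) - P (Z j)) <= e.
      by apply: Hcf => i; exact/ltW/Zd.
    have h2 : cabs (phi (cscale (s ^+ 2)%:C%C (Z j)) - phi (Z j)) <= e.
      by apply: (dP j).2; exact: lt_le_trans (Dd j).
    have := le_cabs_dist (P (Z j)) (phi (cscale (s ^+ 2)%:C%C (Z j))) (phi (Z j)).
    rewrite [X in _ <= X + _]cabs_distrC; lra.
  have PT x : cabs (P (tor x)) <= 1 + e.
    have t1 i : cabs (tnth (tor x) i) <= 1 by rewrite tnth_map cabs_expi.
    have h1 := Hcf (tor x) t1.
    have h2 : cabs (phi (cscale (s ^+ 2)%:C%C (tor x))) <= 1.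
      apply: phi1 => i; rewrite tnth_mktuple cabsM tnth_map cabs_expi mulr1 cabs_real.
      by rewrite ger0_norm ?sqr_ge0//; nra.
    have := ge_cabsB (P (tor x)) (phi (cscale (s ^+ 2)%:C%C (tor x))).
    rewrite cabs_distrC; lra.
  have PE : (fun x => P (tor x)) =
      (fun x => \sum_(al : {ffun 'I_n -> 'I_K}) cf (midx al) * torchar (fun i => (al i)%:Z) x).
    apply/funext => x; apply: eq_bigr => al _; rewrite mono_tor.
    by congr (_ * torchar _ x); apply/funext => i; rewrite tnth_mktuple.
  have mP : cmeasurable (fun x => P (tor x)).
    rewrite PE; apply: cmeasurable_sum => al.
    by apply: cmeasurableZ; exact: cmeasurable_torchar.
  have [lPF NPF] := cL1_mul_bound mP PT lF.
  have cE : cint (fun x => P (tor x) * F x) = \sum_j w j * P (Z j).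
    rewrite (_ : (fun x => _) = fun x => \sum_(al : {ffun 'I_n -> 'I_K})
       cf (midx al) * (torchar (fun i => (al i)%:Z) x * F x)); last first.
      apply/funext => x; have := congr1 (fun f => f x) PE; rewrite /= => ->.
      by rewrite mulr_suml; apply: eq_bigr => al _; rewrite mulrA.
    rewrite cint_sum; last first.
      by move=> al; apply: cL1Z; apply: cL1_mulb => //; exact: cbounded_torchar.
    under eq_bigr => al _.
      rewrite cintZ; last by apply: cL1_mulb => //; exact: cbounded_torchar.
      rewrite Fal mulr_sumr.
      over.
    rewrite exchange_big /=; apply: eq_bigr => j _; rewrite mulr_sumr.
    by apply: eq_bigr => al _; ring.
  have h1 : cabs (\sum_j w j * P (Z j)) <= (1 + e) * L1norm F.
    by rewrite -cE (le_trans (le_cint lPF)).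
  have h2 : cabs (\sum_j w j * phi (Z j) - \sum_j w j * P (Z j)) <= S * (2 * e).
    rewrite -sumrB (le_trans (le_cabs_sum _ _ _))// /S mulr_suml.
    apply: ler_sum => j _; rewrite -mulrBr cabsM ler_wpM2l ?cabs_ge0//.
    by rewrite cabs_distrC.
  have := le_cabsD (\sum_j w j * phi (Z j) - \sum_j w j * P (Z j)) (\sum_j w j * P (Z j)).
  rewrite subrK; lra.
have D0 : 0 < L1norm F + 2 * S + 1 by have := L1norm_ge0 F; lra.
apply/ler_addgt0Pr => e e0.
have e1 : 0 < e / (L1norm F + 2 * S + 1) by rewrite divr_gt0.
apply: le_trans (main _ e1) _; rewrite lerD2l mulrAC ler_pdivrMr//.
by rewrite ler_pM2l//; lra.
Qed.

Lemma QZ_bounded q : QZ Z q -> cbounded q.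
Proof.
move=> [c ->]; apply: cbounded_sum => j.
have := cbounded_lin (c j) (cbounded_kern (Zd j)) (@cbounded_cst _ n 0).
by under eq_fun do rewrite addr0.
Qed.

Lemma QZ_lin (c : C) q q' : QZ Z q -> QZ Z q' -> QZ Z (fun x => c * q x + q' x).
Proof.
move=> [a ->] [b ->]; exists (fun j => c * a j + b j); apply/funext => x.
by rewrite mulr_sumr -big_split /=; apply: eq_bigr => j _; ring.
Qed.

Lemma QZ_kern j : QZ Z (kern (Z j)).
Proof.
exists (fun i => (i == j)%:R); apply/funext => x.
rewrite (bigD1 j)//= eqxx mul1r big1 ?addr0// => i ij.
by rewrite (negbTE ij) mul0r.
Qed.

Lemma cbounded_mul_cL1 f g : cbounded f -> cbounded g -> cL1 (fun x => f x * g x).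
Proof. by move=> bf bg; apply: cL1_mulb => //; exact: cbounded_cL1. Qed.

Variable psi : T -> C.
Hypothesis Qpsi : QZ Z psi.

Let bpsi : cbounded psi := QZ_bounded Qpsi.

Lemma ip_fconjE q : ip (fconj q) (fconj psi) = cint (fun x => (q x)^*%C * psi x).
Proof. by congr cint; apply/funext => x; rewrite /fconj conjcK. Qed.

Lemma ip_fconj_lin (c : C) q q' : cbounded q -> cbounded q' ->
  ip (fconj (fun x => c * q x + q' x)) (fconj psi) =
  c^*%C * ip (fconj q) (fconj psi) + ip (fconj q') (fconj psi).
Proof.
move=> bq bq'; rewrite !ip_fconjE.
have l1 := cbounded_mul_cL1 (cbounded_conj bq) bpsi.
have l2 := cbounded_mul_cL1 (cbounded_conj bq') bpsi.
rewrite -cintZ// -cintD//; last exact: cL1Z.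
by congr cint; apply/funext => x; rewrite rmorphD rmorphM /=; ring.
Qed.

Lemma Mtilde_lin (c : C) h h' : Mtilde Z psi h -> Mtilde Z psi h' ->
  Mtilde Z psi (fun x => c * h x + h' x).
Proof.
move=> [_ [b [d [[q [Qq q0 ->]] Mb Hd ->]]]] [_ [b' [d' [[q' [Qq' q0' ->]] Mb' Hd' ->]]]].
exists (fconj (fun x => c^*%C * q x + q' x)), (fun x => c * b x + b' x), (fun x => c * d x + d' x).
split.
- exists (fun x => c^*%C * q x + q' x); split=> //; first exact: QZ_lin.
  by rewrite ip_fconj_lin ?q0 ?q0' ?mulr0 ?addr0//; exact: QZ_bounded.
- exact: Mn_lin.
- exact: H2_0_lin.
- by apply/funext => x; rewrite /fconj rmorphD rmorphM /= conjcK; ring.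
Qed.

Lemma Mn_zero : Mn (fun _ : T => 0 : C).
Proof.
split; first by apply: cbounded_L2; exact: cbounded_cst.
move=> h1 h2 _ _; rewrite /ip (_ : (fun x => _) = fun=> 0 * 0).
  by rewrite cintZ ?mul0r//; exact: cL1_cst.
by apply/funext => x; rewrite !mul0r.
Qed.

Lemma H2_0_zero : H2_0 (fun _ : T => 0 : C).
Proof.
split; first exact: H2_zero.
have := h2val_origin (fun _ : T => 0 : C).
rewrite (_ : fcoef _ _ = 0)// /fcoef (_ : (fun x => _) = fun=> 0 * 0).
  by rewrite cintZ ?mul0r//; exact: cL1_cst.
by apply/funext => x; rewrite !mul0r.
Qed.

Lemma Mtilde_q q : QZ Z q -> ip (fconj q) (fconj psi) = 0 -> Mtilde Z psi (fconj q).
Proof.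
move=> Qq q0; exists (fconj q), (fun=> 0), (fun=> 0); split.
- by exists q.
- exact: Mn_zero.
- exact: H2_0_zero.
- by apply/funext => x; rewrite !addr0.
Qed.

Lemma Mtilde_b b c : Mn b -> H2_0 c -> Mtilde Z psi (fun x => b x + c x).
Proof.
move=> Mb Hc; pose q : T -> C := fun=> 0.
have Qq : QZ Z q.
  by exists (fun=> 0); apply/funext => x; rewrite big1// => j _; rewrite mul0r.
exists (fconj q), b, c; split=> //.
  exists q; split=> //.
  have := ip_fconj_lin (-1) (QZ_bounded Qq) (QZ_bounded Qq).
  rewrite rmorphN rmorph1 mulN1r addNr => <-.
  by congr (ip (fconj _) _); apply/funext => x; rewrite mulr0 addr0.
by apply/funext => x; rewrite /fconj /q conjc0 add0r.
Qed.

Lemma Mtilde_cL1 h : Mtilde Z psi h -> cL1 h.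
Proof.
move=> [_ [b [c [[q [Qq _ ->]] [Lb _] [[Lc _] _] ->]]]].
apply: cL1D; last exact: L2_cL1.
apply: cL1D; last exact: L2_cL1.
by apply: cL1_conj; apply: cbounded_cL1; exact: QZ_bounded.
Qed.

(** Exponents of both signs fall under [Mn]; otherwise all are nonnegative and one is positive,
    which is [H2_0]. *)
Lemma Mtilde_torchar (k : 'I_n -> int) : (exists i, 0 < k i) -> Mtilde Z psi (torchar k).
Proof.
move=> kp; have [kn|kn] := pselect (exists i, k i < 0).
  have := Mtilde_b (Mn_torchar kp kn) H2_0_zero.
  by under eq_fun do rewrite addr0.
have k0 i : 0 <= k i by rewrite leNgt; apply/negP => ki; apply: kn; exists i.
have := Mtilde_b Mn_zero (H2_0_torchar kp k0).
by under eq_fun do rewrite add0r.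
Qed.

Lemma cint_psi_conj : cint (fun x => (psi x)^*%C * psi x) = (fine (norm2sq psi))%:C%C.
Proof.
have -> : (fun x => (psi x)^*%C * psi x) = (fun x => (cabs (psi x) ^+ 2)%:C%C).
  by apply/funext => x; rewrite mulrC mul_conj.
rewrite /cint /=; apply: complexP => //=.
rewrite (_ : tint _ = 0%E)//.
elim: {+}n => // k IH /=.
by rewrite IH integral0 mule0.
Qed.

(** If the L2 norm vanishes, integrating [|psi| <= t + |psi|^2 / t] for every [t > 0] shows that the
    L1 norm vanishes, and with it every pairing with a bounded kernel. *)
Lemma norm2sq_neq0 j : ip psi (kern (Z j)) != 0 -> fine (norm2sq psi) != 0.
Proof.
apply: contra => /eqP nu0.
have [mpsi _] := bpsi; have lpsi := cbounded_cL1 bpsi.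
pose f x : C := (cabs (psi x) ^+ 2)%:C%C.
have bf : cbounded f.
  split; first by apply: cmeasurable_real; apply: measurable_funX; exact: measurable_cabs.
  have [_ [B hB]] := bpsi; exists (B ^+ 2) => x.
  rewrite cabs_real ger0_norm ?sqr_ge0// lerXn2r ?nnegrE ?cabs_ge0//.
  exact: le_trans (cabs_ge0 _) (hB x).
have Nf : L1norm f = 0.
  rewrite -[RHS]nu0; congr (fine (tint _)); apply/funext => x.
  by rewrite cabs_real ger0_norm ?sqr_ge0.
have Npsi : L1norm psi <= 0.
  apply/ler_addgt0Pr => t t0; rewrite add0r.
  pose u x : C := t%:C%C + (t^-1)%:C%C * f x.
  have lf := cbounded_cL1 bf.
  have lt := @cL1_cst _ n t%:C%C.
  have lu : cL1 u by apply: cL1D => //; exact: cL1Z.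
  apply: (@le_trans _ _ (L1norm u)).
    apply: le_L1norm => // x; rewrite /u /f -rmorphM -rmorphD cabs_real /=.
    have c0 := cabs_ge0 (psi x); have i0 : 0 < t^-1 by rewrite invr_gt0.
    rewrite ger0_norm; last by rewrite addr_ge0 ?mulr_ge0 ?sqr_ge0// ltW.
    have it : t^-1 * t = 1 by rewrite mulVf// gt_eqF.
    have : 0 <= t^-1 * (cabs (psi x) - t) ^+ 2 by rewrite mulr_ge0 ?sqr_ge0// ltW.
    have -> : t^-1 * (cabs (psi x) - t) ^+ 2 = t^-1 * cabs (psi x) ^+ 2 -
      2 * (t^-1 * t) * cabs (psi x) + (t^-1 * t) * t by ring.
    rewrite it; lra.
  rewrite (le_trans (L1normD lt (cL1Z _ lf)))// L1normZ// Nf mulr0 addr0.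
  have H (x : T) : cabs t%:C%C <= t by rewrite cabs_real ger0_norm// ltW.
  by have [] := L1norm_bound (@cmeasurable_cst _ n t%:C%C) H.
rewrite -cabs_eq0 eq_le cabs_ge0 andbT ip_kern.
have [mk [B kB]] := cbounded_ckern (Zd j).
have B0 : 0 <= B := le_trans (cabs_ge0 _) (kB [tuple 0 | i < n]).
have [lk Nk] := cL1_mul_bound mk kB lpsi.
rewrite (_ : (fun x => _) = fun x => ckern (Z j) x * psi x); last first.
  by apply/funext => x; rewrite mulrC.
rewrite (le_trans (le_cint lk))// (le_trans Nk)// mulr_ge0_le0//.
Qed.

Lemma conj_QZ (t : 'I_m -> C) x :
  (\sum_j t j * kern (Z j) x)^*%C = \sum_j (t j)^*%C * ckern (Z j) x.
Proof.
rewrite rmorph_sum; apply: eq_bigr => j _; rewrite rmorphM; congr (_ * _).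
exact: conj_kern.
Qed.

Lemma cint_QZ f (t : 'I_m -> C) : cL1 f ->
  cint (fun x => f x * (\sum_j t j * kern (Z j) x)^*%C) =
  \sum_j (t j)^*%C * cint (fun x => f x * ckern (Z j) x).
Proof.
move=> lf.
have lk j : cL1 (fun x => f x * ckern (Z j) x).
  by under eq_fun do rewrite mulrC; apply: cL1_mulb => //; exact: cbounded_ckern.
transitivity (cint (fun x => \sum_j (t j)^*%C * (f x * ckern (Z j) x))).
  congr cint; apply/funext => x; rewrite conj_QZ mulr_sumr.
  by apply: eq_bigr => j _; rewrite mulrCA.
rewrite cint_sum => [|j]; last exact: cL1Z.
by apply: eq_bigr => j _; rewrite cintZ.
Qed.

End Interpolation.

(** Homogeneity turns the distance condition into [|s| <= ||s g + h||_1]. Applied to a difference,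
    this also shows that [s] depends only on the function [s g + h], so the functional to be
    extended is well defined. *)
Lemma dist_ge1_functional (R : realType) (n m : nat) (Z : 'I_m -> n.-tuple R[i])
    (psi g : n.-tuple R -> R[i]) :
  (forall j, in_disc (Z j)) -> QZ Z psi -> cL1 g ->
  (1 <= distL1 g (Mtilde Z psi))%E ->
  exists2 Lam, bounded_functional 1 Lam & forall (s : R[i]) h, Mtilde Z psi h ->
    Lam (fun x => s * g x + h x) = s.
Proof.
move=> Zd Qpsi lg dist1; set MM := Mtilde Z psi.
have M0 : MM (fun=> 0).
  have := Mtilde_b Zd Qpsi Mn_zero H2_0_zero.
  by under eq_fun do rewrite addr0.
have MZ (c : R[i]) h : MM h -> MM (fun x => c * h x).
  move=> Mh; have := Mtilde_lin Zd Qpsi c Mh M0.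
  by under eq_fun do rewrite addr0.
have lM h : MM h -> cL1 h by exact: Mtilde_cL1.
have lsg s h : MM h -> cL1 (fun x => s * g x + h x).
  by move=> Mh; apply: cL1D; [exact: cL1Z|exact: lM].
have key s h : MM h -> cabs s <= L1norm (fun x => s * g x + h x).
  move=> Mh; have [->|s0] := eqVneq s 0; first by rewrite cabs0 L1norm_ge0.
  pose h' x := - s^-1 * h x.
  have Mh' : MM h' by exact: MZ.
  have lgh : cL1 (fun x => g x - h' x) by apply: cL1B => //; exact: lM.
  have : (1 <= norm1 (fun x => g x - h' x)%R)%E.
    by apply: (le_trans dist1); apply: ereal_inf_lbound; exists h'.
  rewrite norm1_fin// lee_fin => h1.
  have -> : (fun x => s * g x + h x) = (fun x => s * (g x - h' x)).
    by apply/funext => x; rewrite /h' mulrBr mulNr mulrN opprK mulrA mulfV// mul1r.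
  by rewrite L1normZ// ler_peMr// cabs_ge0.
have uniq s s' h h' : MM h -> MM h' ->
    (fun x => s * g x + h x) = (fun x => s' * g x + h' x) -> s = s'.
  move=> Mh Mh' E; apply/eqP; rewrite -subr_eq0 -cabs_eq0 eq_le cabs_ge0 andbT.
  have Md := Mtilde_lin Zd Qpsi (-1) Mh' Mh.
  rewrite (le_trans (key (s - s') _ Md))//.
  have -> : (fun x => (s - s') * g x + (-1 * h' x + h x)) = (fun=> 0).
    apply/funext => x; have := congr1 (fun f => f x) E; rewrite /= => Ex.
    have -> : (s - s') * g x + (-1 * h' x + h x) = (s * g x + h x) - (s' * g x + h' x) by ring.
    by rewrite Ex subrr.
  have H (x : n.-tuple R) : cabs (0 : R[i]) <= 0 by rewrite cabs0.
  by have [] := L1norm_bound (@cmeasurable_cst _ n 0) H.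
pose E : set (n.-tuple R -> R[i]) := [set f | exists s h, MM h /\ f = (fun x => s * g x + h x)].
have ex f : exists s, E f -> exists h, MM h /\ f = (fun x => s * g x + h x).
  have [[s [h [Mh fE]]]|nE] := pselect (E f); first by exists s => _; exists h.
  by exists 0 => /nE.
have [l lP] := choice ex.
have lE s h : MM h -> l (fun x => s * g x + h x) = s.
  move=> Mh; have [|h' [Mh' hE]] := lP (fun x => s * g x + h x); first by exists s, h.
  exact: uniq (esym hE).
have [| | | | |Lam bL LE] := @complex_extension R n E l.
- by exists 0, (fun=> 0); split=> //; apply/funext => x; rewrite mul0r addr0.
- by move=> f [s [h [Mh ->]]]; exact: lsg.
- move=> c f f' [s [h [Mh ->]]] [s' [h' [Mh' ->]]].
  exists (c * s + s'), (fun x => c * h x + h' x); split; first exact: Mtilde_lin.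
  by apply/funext => x; ring.
- move=> c f f' [s [h [Mh ->]]] [s' [h' [Mh' ->]]]; rewrite !lE//.
  rewrite -[RHS](@lE _ (fun x => c * h x + h' x)); last exact: Mtilde_lin.
  by congr l; apply/funext => x; ring.
- by move=> f [s [h [Mh ->]]]; rewrite lE//; exact: key.
exists Lam => // s h Mh; rewrite LE ?lE//; by exists s, h.
Qed.

Theorem theorem7p1 (R : realType) (n m : nat) (Z : 'I_m -> n.-tuple R[i])
    (W : 'I_m -> R[i]) (p : n.-tuple R -> R[i])
    (X : (n.-tuple R -> R[i]) -> (n.-tuple R -> R[i])) :
  (1 <= n)%N ->
  injective Z ->
  (forall j, in_disc (Z j)) ->
  (forall j, cabs (W j) < 1) ->
  (exists j, W j != 0) ->
  is_orth_proj (QZ Z) (fun _ => 1) p ->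
  is_XZW Z W X ->
  let psi := X p in
  let g := fun x => (psi x)^*%C * ((fine (norm2sq psi))^-1)%:C%C in
  ((exists phi : n.-tuple R[i] -> R[i],
      schur_class phi /\ forall j, phi (Z j) = W j)
   <-> (1 <= distL1 g (Mtilde Z psi))%E) /\
  ((exists phi : n.-tuple R[i] -> R[i],
      schur_class phi /\ forall j, phi (Z j) = W j) ->
   forall j, h2val psi (Z j) (W j)).
Proof.
move=> _ _ Zd _ [j0 Wj0] [Qp pP] [XQ _ Xip] psi g.
have Qpsi : QZ Z psi := XQ p Qp.
have bpsi := QZ_bounded Zd Qpsi; have bp := QZ_bounded Zd Qp.
(* By the adjoint relation [<X p, k_j> = w_j <p, k_j>], and [<p, k_j> = <1, k_j> = 1] since [p] is
   the projection of 1. *)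
have ipW j : ip psi (kern (Z j)) = W j.
  have bk := cbounded_ckern (Zd j); have lk := cbounded_cL1 bk.
  have lpk := cbounded_mul_cL1 bp bk.
  rewrite /psi Xip//.
  have -> : ip p (fun x => (W j)^*%C * kern (Z j) x) = W j * ip p (kern (Z j)).
    rewrite ip_kern -cintZ//; congr cint; apply/funext => x.
    by rewrite rmorphM /= conjcK conj_kern mulrCA.
  have := pP _ (QZ_kern Z j); rewrite !ip_kern.
  have -> : (fun x => (1 - p x) * ckern (Z j) x) = (fun x => ckern (Z j) x - p x * ckern (Z j) x).
    by apply/funext => x; rewrite mulrBl mul1r.
  have [q q01 zq] := in_disc_bound (Zd j).
  rewrite cintB// (cint_ckern q01 zq) => /eqP; rewrite subr_eq0 => /eqP <-.
  by rewrite mulr1.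
pose nu := fine (norm2sq psi).
(* A nonzero [w_j] forces [psi] to be nonzero. For [W = 0] one would get [g = 0], at distance 0,
   although [phi = 0] interpolates. *)
have nu0 : nu != 0 by apply: (@norm2sq_neq0 _ _ _ Z Zd psi Qpsi j0); rewrite ipW.
have nuC : (nu%:C%C : R[i]) != 0 by rewrite -cabs_eq0 cabs_real normr_eq0.
have cpsi : cint (fun x => (psi x)^*%C * psi x) = nu%:C%C by exact: cint_psi_conj.
have bg : cbounded g.
  have := cbounded_lin (nu^-1)%:C%C (cbounded_conj bpsi) (@cbounded_cst _ n 0).
  by under eq_fun do rewrite addr0 mulrC.
have lg := cbounded_cL1 bg.
have ipq t : cint (fun x => (\sum_j t j * kern (Z j) x)^*%C * psi x) = \sum_j (t j)^*%C * W j.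
  rewrite (_ : (fun x => _) = fun x => psi x * (\sum_j t j * kern (Z j) x)^*%C); last first.
    by apply/funext => x; rewrite mulrC.
  rewrite cint_QZ//; last exact: cbounded_cL1.
  by apply: eq_bigr => j _; rewrite -ip_kern ipW.
split; last by move=> _ j; rewrite -ipW; exact: h2val_ip.
split=> [[phi [Sphi phiW]]|dist1].
  apply: le_ereal_inf_tmp => _ [h Mh <-].
  have lF : cL1 (fun x => g x - h x) by apply: cL1B => //; exact: Mtilde_cL1 Mh.
  rewrite norm1_fin// lee_fin.
  have [d psiE] := Qpsi.
  move: Mh => [_ [b [c [[q [[t qE] q0 ->]] Mb Hc hE]]]].
  (* Against an analytic polynomial [P], [g - h] acts as [sum_j w_j P(z_j)]: the parts in [Mn] and
     [H2_0] disappear and conjugate kernels evaluate. *)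
  pose w j := (nu^-1)%:C%C * (d j)^*%C - (t j)^*%C.
  have Fal K (al : {ffun 'I_n -> 'I_K}) : cint (fun x => torchar (fun i => (al i)%:Z) x * (g x - h x)) =
      \sum_j w j * mono (Z j) (midx al).
    pose e := @torchar R n (fun i => (al i)%:Z).
    have be : cbounded e by exact: cbounded_torchar.
    have le := cbounded_cL1 be.
    have al0 i : 0 <= (al i)%:Z by [].
    have cE (u : 'I_m -> R[i]) : cint (fun x => e x * (\sum_j u j * kern (Z j) x)^*%C) =
        \sum_j (u j)^*%C * mono (Z j) (midx al).
      by rewrite cint_QZ//; apply: eq_bigr => j _; rewrite cint_torchar_ckern.
    have bq : cbounded q by apply: (QZ_bounded Zd); exists t.
    have l1 := cbounded_mul_cL1 be (cbounded_conj bpsi).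
    have l2 := cbounded_mul_cL1 be (cbounded_conj bq).
    have l3 : cL1 (fun x => e x * b x) by apply: cL1_mulb => //; apply: L2_cL1; case: Mb.
    have l4 : cL1 (fun x => e x * c x) by apply: cL1_mulb => //; apply: cL1_H2; case: Hc.
    transitivity (cint (fun x => ((nu^-1)%:C%C * (e x * (psi x)^*%C) - e x * (q x)^*%C)
        - e x * b x - e x * c x)).
      by congr cint; apply/funext => x; rewrite hE /g /fconj -/nu -/e; ring.
    have l12 := cL1B (cL1Z (nu^-1)%:C%C l1) l2.
    rewrite cintB//; last exact: cL1B.
    rewrite cintB// cintB//; last exact: cL1Z.
    rewrite cintZ// (Mn_mono Mb al0) (H2_0_mono Hc al0) !subr0.
    rewrite psiE qE !cE mulr_sumr -sumrB; apply: eq_bigr => j _.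
    by rewrite /w; ring.
  have := schur_pairing Zd Sphi lF Fal.
  (* The value is [<psi, psi> / nu] minus the pairing of [psi] with [q], which is 0. *)
  have -> : \sum_j w j * phi (Z j) = 1; last by rewrite cabs1.
  have dW : \sum_j (d j)^*%C * W j = nu%:C%C.
    rewrite -ipq -cpsi; congr cint; apply/funext => x.
    by have <- : psi x = \sum_j d j * kern (Z j) x by rewrite psiE.
  have tW : \sum_j (t j)^*%C * W j = 0.
    by rewrite -ipq -[RHS]q0 [RHS]ip_fconjE qE.
  rewrite /w; under eq_bigr do rewrite phiW mulrBl -mulrA.
  by rewrite sumrB -mulr_sumr dW tW subr0 -rmorphM /= mulVf.
have [Lam bL LE] := dist_ge1_functional Zd Qpsi lg dist1.
have Lam0 (k : 'I_n -> int) : (exists i, 0 < k i) -> Lam (torchar k) = 0.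
  move=> kp; rewrite -(LE 0 (torchar k)); last exact: Mtilde_torchar.
  by congr Lam; apply/funext => x; rewrite mul0r add0r.
exists (fun z => Lam (ckern z)); split; first exact: functional_schur.
move=> j.
(* Chosen so that [conj q + w_j g] is the conjugate kernel at [z_j]; it is orthogonal to [psi]
   because [<psi, k_j> = w_j]. *)
pose q x := - ((W j)^*%C * (nu^-1)%:C%C) * psi x + kern (Z j) x.
have Qq : QZ Z q by apply: QZ_lin => //; exact: QZ_kern.
have bk := cbounded_kern (Zd j).
have q0 : ip (fconj q) (fconj psi) = 0.
  rewrite (ip_fconj_lin Zd Qpsi)// !ip_fconjE cpsi.
  have -> : cint (fun x => (kern (Z j) x)^*%C * psi x) = W j.
    rewrite -(ipW j) ip_kern; congr cint; apply/funext => x; by rewrite conj_kern mulrC.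
  rewrite rmorphN rmorphM /= conjcK oppr0 mulNr -mulrA -[_%:C%C * _]rmorphM /= mulVf//.
  by rewrite mulr1 addNr.
rewrite -[RHS](LE (W j) (fconj q)); last exact: Mtilde_q.
congr Lam; apply/funext => x.
have -> : fconj q x = - (W j * (nu^-1)%:C%C) * (psi x)^*%C + ckern (Z j) x.
  by rewrite /fconj /q rmorphD rmorphM rmorphN rmorphM /= conjcK oppr0 conj_kern.
by rewrite /g -/nu; ring.
Qed.
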